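(* There is an index (auxiliary data structure) occupying $O(n\log w)$ bits, in addition to the space needed to store the elements of $S$, such that for every query string $x\in\{0,1\}^w$ the index $i$ with $S[i]=x^-$ (the rank of the predecessor of $x$ in $S$) can be computed in time $O(\log\log d(x,S))$.
   Context: Let $w$ be a positive integer and let $S$ be a nonempty set of $n$ binary strings of length $w$; strings of length $w$ are identified with integers in $[0,2^w)$, so lexicographic order coincides with numeric order and differences $y-x$ are integer differences. The model is the word RAM with words of $w$ bits, allowing multiplication, under the full randomness assumption (hash functions behave as truly random functions). The set $S$ is available as a sorted array $S[0],\dots,S[n-1]$ with constant-time access, and space bounds count only the additional bits of the index. For a query $x\in\{0,1\}^w$, let $x^-=\max\{y\in S\mid y<x\}$ (the predecessor) and $x^+=\min\{y\in S\mid y\ge x\}$ (the successor); a predecessor query returns the index $i$ with $S[i]=x^-$ (by convention $-1$ if $x^-$ does not exist). Define $d(x,S)=\min\{x^+-x,\,x-x^-\}$ and $D(x,S)=\max\{x^+-x,\,x-x^-\}$; if only one of $x^-,x^+$ exists, both $d(x,S)$ and $D(x,S)$ equal the distance from $x$ to that one. All logarithms are binary, with the convention that $\log z=1$ whenever $z<2$. *)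

(* Defs.v *)
(* MathComp world, with MathComp-Analysis for the real logarithm. *)
From HB Require Import structures.
From mathcomp Require Import all_boot all_order all_algebra.
From mathcomp Require Import boolp reals exp.

Set Implicit Arguments.
Unset Strict Implicit.
Unset Printing Implicit Defensive.

Import Order.TTheory GRing.Theory Num.Theory.

(* A binary string of length w is identified with the integer it denotes; the
   same type serves for the machine words. *)
Definition word (w : nat) : finType := 'I_(2 ^ w).

Lemma to_word_subproof (w k : nat) : k %% 2 ^ w < 2 ^ w.
Proof. by rewrite ltn_mod expn_gt0. Qed.

Definition to_word (w k : nat) : word w := Ordinal (to_word_subproof w k).

Section Predecessor.
Variables (w : nat) (S : {set word w}).

Definition sorted_array : seq (word w) :=
  sort (fun a b : word w => (a <= b)%N) (enum S).

(* x^- and x^+; [None] when there is no such element of S. *)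
Definition pred_of (x : word w) : option (word w) :=
  [pick y in S | (y < x)%N & [forall z in S, (z < x)%N ==> (z <= y)%N]].

Definition succ_of (x : word w) : option (word w) :=
  [pick y in S | (x <= y)%N & [forall z in S, (x <= z)%N ==> (y <= z)%N]].

(* d(x, S); the value 0 in the last case is immaterial, as S is nonempty. *)
Definition dist_min (x : word w) : nat :=
  match pred_of x, succ_of x with
  | Some y, Some z => minn (z - x) (x - y)
  | Some y, None => x - y
  | None, Some z => z - x
  | None, None => 0
  end.

(* The index -1 is the word 2^w - 1 (two's complement).  It cannot be confused
   with the index of a predecessor, which is at most 2^w - 2. *)
Definition is_pred_index (x i : word w) : Prop :=
  match pred_of x with
  | Some y => (i < #|S|)%N /\ nth (to_word w 0) sorted_array i = y
  | None => i = to_word w (2 ^ w).-1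
  end.

End Predecessor.

Section Log.
Variable R : realType.
Local Open Scope ring_scope.

Definition log2 (z : R) : R := if z < 2 then 1 else ln z / ln 2.

End Log.

(* Word RAM.  A program is a finite list of instructions, independent of w;
   registers, labels and literal constants are natural numbers, and every
   instruction takes one unit of time.  There are three address spaces: the
   sorted array (read-only), the index (read-only), and a working memory of
   2^w words. *)
Inductive binop : Type :=
  | OpAdd | OpSub | OpMul | OpAnd | OpOr | OpXor | OpShl | OpShr.

Inductive instr : Type :=
  | IConst (dst c : nat)                 (* dst := c                          *)
  | IOp (o : binop) (dst a b : nat)      (* dst := a o b                      *)
  | IArray (dst a : nat)                 (* dst := S[a]                       *)
  | IIndex (dst a : nat)                 (* dst := a-th word of the index     *)
  | ILoad (dst a : nat)                  (* dst := mem[a]                     *)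
  | IStore (a b : nat)                   (* mem[a] := b                       *)
  | IHash (dst a b : nat)                (* dst := h_a(b)                     *)
  | IJump (l : nat)                      (* goto l                            *)
  | IJumpLt (a b l : nat)                (* if a < b then goto l              *)
  | IHalt (a : nat).                     (* stop with output a                *)

Definition program : Type := seq instr.

(* A family of 2^w hash functions h_a from words to words. *)
Definition hash_family (w : nat) : finType := {ffun word w * word w -> word w}.

Definition eval_op (w : nat) (o : binop) (a b : word w) : word w :=
  match o with
  | OpAdd => to_word w (a + b)
  | OpSub => to_word w (a + (2 ^ w - b))
  | OpMul => to_word w (a * b)
  | OpAnd => to_word w (Nat.land a b)
  | OpOr  => to_word w (Nat.lor a b)
  | OpXor => to_word w (Nat.lxor a b)
  | OpShl => to_word w (a * 2 ^ b)
  | OpShr => to_word w (a %/ 2 ^ b)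
  end.

(* The index is a string of bits, packed w to a word; bits past its end read
   as 0. *)
Definition index_word (w : nat) (idx : bitseq) (j : word w) : word w :=
  to_word w (\sum_(k < w) nth false idx (j * w + k) * 2 ^ k).

Record state (w : nat) : Type := State {
  pc : nat;
  regs : nat -> word w;
  mem : word w -> word w
}.

Section Execution.
Variables (w : nat) (P : program) (H : hash_family w).
Variables (arr : seq (word w)) (idx : bitseq).

Definition set_reg (s : state w) (r : nat) (v : word w) : state w :=
  State (pc s).+1 (fun q => if q == r then v else regs s q) (mem s).

Definition goto (s : state w) (l : nat) : state w :=
  State l (regs s) (mem s).

(* Running past the end of the program halts with the content of register 0. *)
Definition step (s : state w) : state w + word w :=
  match nth (IHalt 0) P (pc s) with
  | IConst r c => inl (set_reg s r (to_word w c))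
  | IOp o r a b => inl (set_reg s r (eval_op o (regs s a) (regs s b)))
  | IArray r a => inl (set_reg s r (nth (to_word w 0) arr (regs s a)))
  | IIndex r a => inl (set_reg s r (index_word idx (regs s a)))
  | ILoad r a => inl (set_reg s r (mem s (regs s a)))
  | IStore a b =>
      inl (State (pc s).+1 (regs s)
             (fun p => if p == regs s a then regs s b else mem s p))
  | IHash r a b => inl (set_reg s r (H (regs s a, regs s b)))
  | IJump l => inl (goto s l)
  | IJumpLt a b l =>
      inl (goto s (if (regs s a < regs s b)%N then l else (pc s).+1))
  | IHalt a => inr (regs s a)
  end.

(* [Some v] iff the machine halts with output v after at most t steps. *)
Fixpoint run (t : nat) (s : state w) : option (word w) :=
  if t is t'.+1 then
    match step s with
    | inl s' => run t' s'
    | inr v => Some v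
    end
  else None.

(* The query program receives x, n - 1 and w in registers 0, 1 and 2 (n itself
   may be 2^w, which is not a word); everything else is initially 0. *)
Definition init_state (x : word w) : state w :=
  State 0
    (fun r => match r with
              | 0 => x
              | 1 => to_word w (size arr).-1
              | 2 => to_word w w
              | _ => to_word w 0
              end)
    (fun _ => to_word w 0).

End Execution.

Definition run_query (w : nat) (P : program) (H : hash_family w)
    (S : {set word w}) (idx : bitseq) (x : word w) (t : nat) :
    option (word w) :=
  run P H (sorted_array S) idx t (init_state (sorted_array S) x).

Section Randomness.
Variable R : realType.
Local Open Scope ring_scope.

(* Full randomness: the hash family is uniformly distributed, i.e. the values
   h_a(b) are independent uniform words. *)
Definition hash_prob (w : nat) (E : hash_family w -> Prop) : R :=
  #|[set H : hash_family w | `[< E H >]]|%:R / #|hash_family w|%:R.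

(* [idx] has at most C n log w bits, and with it P answers every query x in
   time at most C log log d(x, S). *)
Definition good_index (P : program) (C : R) (w : nat) (S : {set word w})
    (H : hash_family w) (idx : bitseq) : Prop :=
  (size idx)%:R <= C * (#|S|%:R * log2 w%:R) /\
  forall x : word w, exists (t : nat) (i : word w),
    [/\ run_query P H S idx x t = Some i,
        is_pred_index S x i
      & t%:R <= C * log2 (log2 (dist_min S x)%:R)].

End Randomness.

(* Main.v *)
(** The keys form a compacted binary trie, and node [l, r) of it is represented by
    its handle, the 2-fattest level at which [l, r) is a block.  At the levels
    t = 2^2^k, k = 0, 1, ..., the program probes the block of x and its two
    neighbours: as soon as t exceeds log d(x, S), one of them is occupied, and k is
    then at most about log log log d(x, S).  A fat binary search over the levels
    below t takes 2^k more steps, that is O(log log d(x, S)), and ends at the node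
    where x leaves the trie.  The predecessor of x is then one of three candidates:
    the gap on either side of that node or the gap splitting it.  Candidates are
    checked against the array, so the tables may return anything on other inputs.

    The tables are static functions: a value is stored bit by bit as the exclusive or
    of two random cells, which is solvable as soon as the random graph whose edges
    join the two cells of each key has no nonempty set of edges meeting every vertex
    evenly often.  Gaps are numbered inside buckets of T = w^O(1), so that candidates
    cost O(log w) bits; the long values, bucket numbers, are stored only once per
    bucket.  A seed gives bad graphs with probability at most 1/2, and T^2
    independent seeds are available, so that all of them are bad with probability at
    most 2^-(T^2).  For w bounded, a table of all answers is used. *)

Require Import Defs.
From HB Require Import structures.
From mathcomp Require Import all_boot all_order all_algebra.
From mathcomp Require Import boolp reals exp.
From mathcomp Require Import zify.
From Stdlib Require PeanoNat.

Set Implicit Arguments.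
Unset Strict Implicit.
Unset Printing Implicit Defensive.

(** The space bound shapes every table. A node may spend O(log w) bits, so its three candidates
    become six fields of [D] bits with [T = 2 ^ D] polynomial in [w]; a full rank would not fit. The
    table of the levels has up to [K.+1] keys per element of the array, so its values must be
    shorter still: a node having a power of two among its levels has a power of two as its handle
    ([handle_pow2]), whose exponent takes [K.+1] bits, and [K.+1 ^ 2] is O([D]). Bucket numbers take
    whole words, but about [n / T] of them amount to O([n]) bits because [w <= T]. The machine has
    no logarithm. Levels are therefore compared through exclusive ors of adjacent keys, and the
    field width [D] of the header is itself recovered as a hash value. For the time bound, the inner
    search runs at most once, at the first level where the block of x is occupied. If that is level
    [2 ^ 2 ^ k.+1], the failure at [2 ^ 2 ^ k] shows that d(x, S) exceeds [2 ^ 2 ^ 2 ^ k], so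
    [2 ^ k] is below log log d(x, S). *)

Local Notation bit := Nat.testbit.

(** * Bits of natural numbers *)

Lemma bitE a i : bit a i = odd (a %/ 2 ^ i).
Proof.
have oddE n : Nat.odd n = odd n.
  by elim: n => // n IHn; rewrite PeanoNat.Nat.odd_succ -PeanoNat.Nat.negb_odd IHn.
have halfE n : Nat.div2 n = n %/ 2.
  rewrite divn2; elim/ltn_ind: n => [] [|[|n]] //= IHn.
  by rewrite IHn.
elim: i a => [|i IHi] a; first by rewrite expn0 divn1 -oddE.
by rewrite -[bit a i.+1]/(bit (Nat.div2 a) i) IHi expnS divnMA halfE.
Qed.

Lemma bit_divn a k i : bit (a %/ 2 ^ k) i = bit a (k + i).
Proof. by rewrite !bitE -divnMA expnD. Qed.

Lemma bits_inj a b : (forall i, bit a i = bit b i) -> a = b.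
Proof. exact: PeanoNat.Nat.bits_inj. Qed.

Lemma odd_modn2 a k : 0 < k -> odd (a %% 2 ^ k) = odd a.
Proof.
by case: k => // k _; rewrite {2}(divn_eq a (2 ^ k.+1)) oddD oddM expnS oddM andbF.
Qed.

Lemma modn_expn_divn a i k :
  i <= k -> (a %% 2 ^ k) %/ 2 ^ i = (a %/ 2 ^ i) %% 2 ^ (k - i).
Proof.
move=> le_ik.
have lt : (a %% 2 ^ k) %/ 2 ^ i < 2 ^ (k - i).
  by rewrite ltn_divLR ?expn_gt0 // -expnD subnK // ltn_mod expn_gt0.
have aE : a = a %/ 2 ^ k * 2 ^ (k - i) * 2 ^ i + a %% 2 ^ k.
  by rewrite -mulnA -expnD subnK // -divn_eq.
by rewrite [in RHS]aE divnMDl ?expn_gt0 // modnMDl [in RHS]modn_small.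
Qed.

Lemma bit_modn a k i : bit (a %% 2 ^ k) i = (i < k) && bit a i.
Proof.
rewrite !bitE; case: ltnP => ik /=.
  by rewrite modn_expn_divn ?odd_modn2 ?subn_gt0 // ltnW.
by rewrite divn_small // (leq_trans _ (leq_pexp2l _ ik)) ?ltn_mod ?expn_gt0.
Qed.

Lemma bit_small a k i : a < 2 ^ k -> k <= i -> bit a i = false.
Proof.
by move=> ak ki; rewrite bitE divn_small // (leq_trans ak) // leq_exp2l.
Qed.

Lemma bits_lt a k : (forall i, k <= i -> bit a i = false) -> a < 2 ^ k.
Proof.
move=> h; rewrite (_ : a = a %% 2 ^ k) ?ltn_mod ?expn_gt0 //.
apply: bits_inj => i; rewrite bit_modn; case: ltnP => //= ki; exact: h.
Qed.

Lemma bit_xor a b i : bit (Nat.lxor a b) i = bit a i (+) bit b i.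
Proof. by rewrite PeanoNat.Nat.lxor_spec; case: (bit a i) (bit b i) => [] []. Qed.

Lemma bit_and a b i : bit (Nat.land a b) i = bit a i && bit b i.
Proof. exact: PeanoNat.Nat.land_spec. Qed.

Lemma bit_sum w (b : nat -> bool) i :
  bit (\sum_(k < w) b k * 2 ^ k) i = (i < w) && b i.
Proof.
elim: w b i => [|w IHw] b i; first by rewrite big_ord0 bitE div0n.
rewrite big_ord_recl expn0 muln1.
have -> : \sum_(k < w) b (lift ord0 k) * 2 ^ lift ord0 k =
          (\sum_(k < w) b k.+1 * 2 ^ k).*2.
  rewrite -muln2 big_distrl /=; apply: eq_bigr => k _.
  by rewrite /bump /= expnS mulnCA [RHS]mulnC.
case: i => [|i]; first by rewrite bitE expn0 divn1 oddD odd_double addbF; case: (b 0).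
have -> : bit (b 0 + (\sum_(k < w) b k.+1 * 2 ^ k).*2) i.+1 =
          bit (\sum_(k < w) b k.+1 * 2 ^ k) i.
  by rewrite !bitE expnS divnMA divn2 half_bit_double.
by rewrite (IHw (fun k => b k.+1)).
Qed.

Lemma sum_bits_lt w (b : nat -> bool) : \sum_(k < w) b k * 2 ^ k < 2 ^ w.
Proof. by apply: bits_lt => i wi; rewrite bit_sum ltnNge wi. Qed.

Lemma land_le a b : Nat.land a b <= b.
Proof.
by have := PeanoNat.Nat.land_le_r a b; lia.
Qed.

Lemma bit_ones k i : bit (2 ^ k - 1) i = (i < k).
Proof.
have -> : 2 ^ k - 1 = \sum_(j < k) true * 2 ^ j.
  elim: k => [|k IHk]; first by rewrite big_ord0.
  by rewrite big_ord_recr /= -IHk expnS; have := expn_gt0 2 k; lia.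
by rewrite (@bit_sum k (fun=> true)) andbT.
Qed.

Lemma land_ones a k : Nat.land a (2 ^ k - 1) = a %% 2 ^ k.
Proof. by apply: bits_inj => i; rewrite bit_and bit_modn bit_ones andbC. Qed.

Lemma lxor_lt a b k : (Nat.lxor a b < 2 ^ k) = (a %/ 2 ^ k == b %/ 2 ^ k).
Proof.
apply/idP/eqP => [lt|eq].
  apply: bits_inj => i; rewrite !bit_divn.
  have := @bit_small _ _ (k + i) lt (leq_addr _ _).
  by rewrite bit_xor; case: (bit a _) (bit b _) => [] [].
apply: bits_lt => i ki; rewrite bit_xor -(subnKC ki) -!bit_divn eq.
by case: (bit _ _).
Qed.

Lemma lxor_small a b k : a < 2 ^ k -> b < 2 ^ k -> Nat.lxor a b < 2 ^ k.
Proof. by move=> ha hb; rewrite lxor_lt !divn_small. Qed.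

Lemma bit_lt a k : 2 ^ k <= a -> exists2 i, k <= i & bit a i.
Proof.
move=> ka; case: (boolP (has (bit a) (iota k a))) => [/hasP[i]|/hasPn h].
  by rewrite mem_iota => /andP[ki _] bi; exists i.
suff : a < 2 ^ k by rewrite ltnNge ka.
apply: bits_lt => i ki; case: (ltnP i (k + a)) => [ia|ai].
  by apply/negbTE/h; rewrite mem_iota ki.
apply: (@bit_small _ a); first exact: ltn_expl.
by rewrite (leq_trans _ ai) // leq_addl.
Qed.

Lemma bit_le a i : bit a i -> 2 ^ i <= a.
Proof. by rewrite leqNgt => bi; apply/negP => /bit_small/(_ (leqnn i)); rewrite bi. Qed.

(* With [L] the length of the common suffix removed, the two distinct numbers
   [a] and [b] first differ at bit [L], where exactly one of them agrees
   with [x] if [x] agrees with both above [L]. *)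
Lemma land_lxor_lt x a b L :
  2 ^ L <= Nat.lxor a b < 2 ^ L.+1 ->
  (Nat.land (Nat.lxor x a) (Nat.lxor x b) < Nat.lxor a b) =
  (x %/ 2 ^ L.+1 == a %/ 2 ^ L.+1).
Proof.
case/andP => lo hi; rewrite -lxor_lt.
have bab i : bit (Nat.lxor x b) i = bit (Nat.lxor x a) i (+) bit (Nat.lxor a b) i.
  by rewrite !bit_xor; case: (bit x i) (bit a i) (bit b i) => [] [] [].
have bL : bit (Nat.lxor a b) L.
  have [i Li bi] := bit_lt lo; rewrite (_ : L = i) //.
  apply/eqP; rewrite eqn_leq Li /= leqNgt; apply/negP => /(bit_small hi).
  by rewrite bi.
case: (ltnP (Nat.lxor x a)) => [ux|ux].
  apply: (leq_trans _ lo); apply: bits_lt => i Li; rewrite bit_and bab.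
  case: (ltngtP L i) Li => // [Li|<-] _; first by rewrite (bit_small ux).
  by rewrite bL; case: (bit _ _).
have [i Li bi] := bit_lt ux.
apply/negbTE; rewrite -leqNgt; apply: (leq_trans (ltnW hi)).
apply: (@leq_trans (2 ^ i)); first by rewrite leq_exp2l.
by apply: bit_le; rewrite bit_and bab bi (bit_small hi Li).
Qed.

(** * Fattest levels in a compacted trie *)

Definition argmax_seq (f : nat -> nat) (g : seq nat) : nat :=
  nth 0 g (find (fun i => all (fun j => f j <= f i) g) g).

Lemma argmax_seqP f g x :
  x \in g -> argmax_seq f g \in g /\ {in g, forall j, f j <= f (argmax_seq f g)}.
Proof.
move=> xg; have hs : has (fun i => all (fun j => f j <= f i) g) g.
  elim: g x xg => // y g IHg _ _; case: (posnP (size g)) => [/size0nil->|]; first by rewrite /= leqnn.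
  case: g IHg => // z g IHg _; have /hasP[i ig mi] := IHg z (mem_head _ _).
  apply/hasP; case: (leqP (f y) (f i)) => yi.
    by exists i; [rewrite in_cons ig orbT | rewrite [all _ _]/(_ && _) yi].
  exists y; first exact: mem_head.
  rewrite [all _ _]/(_ && _) leqnn; apply: sub_all mi => j h.
  exact: leq_trans h (ltnW yi).
split; first by rewrite mem_nth // -has_find.
by move=> j jg; move/(nth_find 0)/allP: hs; apply.
Qed.

(** For a downward closed [P], the number of elements satisfying it is also the first index where it
    fails. This turns the counts [blk_lo] and [blk_hi] into block boundaries. *)
Lemma ltn_count_iota (P : pred nat) n i :
  (forall i j, i <= j -> j < n -> P j -> P i) -> i < n ->
  (i < count P (iota 0 n)) = P i.
Proof.
elim: n i => // n IHn i mP; rewrite ltnS leq_eqVlt -[in iota _ _]addn1 iotaD count_cat /= addn0 add0n.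
have le : count P (iota 0 n) <= n by rewrite -{2}(size_iota 0 n) count_size.
have mP' : forall i j, i <= j -> j < n -> P j -> P i.
  by move=> a b ab bn; apply: mP => //; rewrite ltnS ltnW.
case: (boolP (P n)) => Pn.
  have allP : all P (iota 0 n).
    apply/allP => j; rewrite mem_iota add0n => /andP[_ jn].
    by apply: (mP j n) => //; rewrite ltnW.
  rewrite (eqP (_ : count P (iota 0 n) == n)); last by rewrite -[X in _ == X](size_iota 0) -all_count.
  case/orP => [/eqP->|lt]; first by rewrite Pn; lia.
  by rewrite (mP i n) //; lia.
rewrite addn0 => /orP[/eqP->|lt]; last by rewrite IHn.
by rewrite (negbTE Pn); apply/negbTE; rewrite -leqNgt.
Qed.

Section Trie.

Variables (s : nat -> nat) (n T : nat).
Hypothesis s_lt : forall i j, i < j -> j < n -> s i < s j.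
Hypothesis s_bound : forall i, i < n -> s i < 2 ^ T.
Hypothesis T_gt0 : 0 < T.

Lemma s_le i j : i <= j -> j < n -> s i <= s j.
Proof. by rewrite leq_eqVlt => /orP[/eqP->//|ij jn]; apply/ltnW/s_lt. Qed.

Lemma sh_le t i j : i <= j -> j < n -> s i %/ 2 ^ t <= s j %/ 2 ^ t.
Proof. by move=> ij jn; apply/leq_div2r/s_le. Qed.

(* The block of level [t] and prefix [q] consists of the indices [i] with
   [s i %/ 2 ^ t = q]; [gaplen i] is the lowest level at which [i] and [i.+1] lie
   in the same block. *)
Definition gapx i := Nat.lxor (s i) (s i.+1).
Definition gaplen i := (trunc_log 2 (gapx i)).+1.

Lemma gapx_lt i t : (gapx i < 2 ^ t) = (s i %/ 2 ^ t == s i.+1 %/ 2 ^ t).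
Proof. exact: lxor_lt. Qed.

Lemma gapx_gt0 i : i.+1 < n -> 0 < gapx i.
Proof.
move=> hi; rewrite lt0n; apply/eqP => e.
have := gapx_lt i 0; rewrite e expn0 !divn1 eqn_leq => /esym/andP[_].
by rewrite leqNgt s_lt.
Qed.

Lemma gaplen_bounds i : i.+1 < n -> 2 ^ (gaplen i).-1 <= gapx i < 2 ^ gaplen i.
Proof. by move=> hi; apply: trunc_log_bounds => //; apply: gapx_gt0. Qed.

Lemma gapx_ltE i t : i.+1 < n -> (gapx i < 2 ^ t) = (gaplen i <= t).
Proof.
move=> hi; have /andP[lo hi'] := gaplen_bounds hi; apply/idP/idP => h.
  by have := leq_ltn_trans lo h; rewrite ltn_exp2l.
by apply: leq_trans hi' _; rewrite leq_exp2l.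
Qed.

Lemma gaplen_le i t : i.+1 < n -> (gaplen i <= t) = (s i %/ 2 ^ t == s i.+1 %/ 2 ^ t).
Proof. by move=> hi; rewrite -gapx_ltE // gapx_lt. Qed.

Lemma gaplen_mono i j : i.+1 < n -> j.+1 < n -> gapx i <= gapx j -> gaplen i <= gaplen j.
Proof. by move=> hi hj h; rewrite -gapx_ltE // (leq_ltn_trans h) // gapx_ltE. Qed.

Lemma same_block t i j : i <= j -> j < n ->
  (forall k, i <= k -> k < j -> gaplen k <= t) -> s i %/ 2 ^ t = s j %/ 2 ^ t.
Proof.
move=> ij jn; rewrite -(subnKC ij) in jn *.
elim: (j - i) jn => [|d IH] jn h; first by rewrite addn0.
rewrite addnS in jn h *; rewrite IH; [|lia|by move=> k ? ?; apply: h; lia].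
by apply/eqP; rewrite -gaplen_le //; apply: h; lia.
Qed.

(* A block branches at most once at a given level, because a bit takes only two
   values. *)
Lemma gaplen_inj L i j : i < j -> j.+1 < n -> gaplen i = L -> gaplen j = L ->
  (forall k, i <= k -> k <= j -> gaplen k <= L) -> False.
Proof.
move=> ij jn Li Lj h.
have e : s i %/ 2 ^ L = s j.+1 %/ 2 ^ L.
  by apply: same_block => //; lia.
have Lgt0 : 0 < L by rewrite -Li.
have lt k : k.+1 < n -> gaplen k = L -> s k %/ 2 ^ L.-1 < s k.+1 %/ 2 ^ L.-1.
  move=> kn kL; rewrite ltn_neqAle sh_le // andbT -gaplen_le //; lia.
have l1 := lt i (ltn_trans _ jn) Li; have l2 := lt j jn Lj.
have l3 := @sh_le L.-1 i.+1 j ij (ltnW jn).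
have d2 a : a %/ 2 ^ L = (a %/ 2 ^ L.-1) %/ 2.
  by rewrite -divnMA -expnSr prednK.
rewrite !d2 in e; have {}l1 := l1 ltac:(lia); lia.
Qed.

(** Both ends of the half-open block are counts, so that they are defined for every prefix, occupied
    or not. *)
Definition blk_lo t q := count (fun i => s i %/ 2 ^ t < q) (iota 0 n).
Definition blk_hi t q := count (fun i => s i %/ 2 ^ t <= q) (iota 0 n).

Lemma blk_loE t q i : i < n -> (i < blk_lo t q) = (s i %/ 2 ^ t < q).
Proof.
by apply: (ltn_count_iota (P := fun i => s i %/ 2 ^ t < q)) => a b ab bn; apply/leq_ltn_trans/sh_le.
Qed.

Lemma blk_hiE t q i : i < n -> (i < blk_hi t q) = (s i %/ 2 ^ t <= q).
Proof.
by apply: (ltn_count_iota (P := fun i => s i %/ 2 ^ t <= q)) => a b ab bn; apply/leq_trans/sh_le.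
Qed.

Lemma blk_hi_le t q : blk_hi t q <= n.
Proof. by rewrite -[X in _ <= X](size_iota 0) count_size. Qed.

Lemma blk_lo_le t q : blk_lo t q <= n.
Proof. by rewrite -[X in _ <= X](size_iota 0) count_size. Qed.

Lemma blkE t q i : i < n -> (blk_lo t q <= i < blk_hi t q) = (s i %/ 2 ^ t == q).
Proof. by move=> hi; rewrite blk_hiE // leqNgt blk_loE // -leqNgt eqn_leq andbC. Qed.

Definition occ t q := blk_lo t q < blk_hi t q.

Lemma occP t q i : i < n -> s i %/ 2 ^ t = q -> occ t q.
Proof. by move=> hi /eqP; rewrite -blkE // => /andP[a b]; exact: leq_ltn_trans a b. Qed.

Lemma occ_mem t q i : occ t q -> blk_lo t q <= i -> i < blk_hi t q -> s i %/ 2 ^ t = q.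
Proof.
move=> o a b; apply/eqP; rewrite -blkE ?a //.
exact: leq_trans b (blk_hi_le _ _).
Qed.

Lemma occ_lo t q : occ t q -> s (blk_lo t q) %/ 2 ^ t = q.
Proof. by move=> o; apply: occ_mem. Qed.

Definition isblk t l r :=
  [&& l < r, blk_lo t (s l %/ 2 ^ t) == l & blk_hi t (s l %/ 2 ^ t) == r].

Lemma occ_isblk t q : occ t q -> isblk t (blk_lo t q) (blk_hi t q).
Proof. by move=> o; rewrite /isblk occ_lo // !eqxx !andbT; exact: o. Qed.

Lemma isblk_le t l r : isblk t l r -> l < r <= n.
Proof. by case/and3P => -> _ /eqP <-; rewrite blk_hi_le. Qed.

Lemma isblkE t l r i : isblk t l r -> i < n ->
  (l <= i < r) = (s i %/ 2 ^ t == s l %/ 2 ^ t).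
Proof. by case/and3P=> _ /eqP e1 /eqP e2 hi; rewrite -blkE // e1 e2. Qed.

Lemma isblkP t l r : l < r <= n ->
  (forall i, i < n -> (l <= i < r) = (s i %/ 2 ^ t == s l %/ 2 ^ t)) -> isblk t l r.
Proof.
case/andP=> lr rn h; rewrite /isblk lr /=.
set q := _ %/ _ in h *.
have o : occ t q by apply: (@occP _ _ l) => //; lia.
have E i : i < n -> (blk_lo t q <= i < blk_hi t q) = (l <= i < r).
  by move=> hi; rewrite blkE // h.
have := blk_hi_le t q; have := blk_lo_le t q; move: o; rewrite /occ.
move: (blk_lo t q) (blk_hi t q) E => a b E ab an bn.
have := E a; have := E b.-1; have := E l; have := E r.-1; lia.
Qed.

Lemma isblk_inner t l r k : isblk t l r -> l <= k -> k.+1 < r -> gaplen k <= t.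
Proof.
move=> bl lk kr; have /andP[lr rn] := isblk_le bl.
rewrite gaplen_le; last lia.
have /eqP -> : s k %/ 2 ^ t == s l %/ 2 ^ t by rewrite -(isblkE bl); lia.
by rewrite eq_sym -(isblkE bl); lia.
Qed.

Lemma isblk_left t l r : isblk t l r -> 0 < l -> t < gaplen l.-1.
Proof.
move=> bl l0; have /andP[lr rn] := isblk_le bl.
rewrite ltnNge gaplen_le prednK //; last lia.
by rewrite -(isblkE bl) //; lia.
Qed.

Lemma isblk_right t l r : isblk t l r -> r < n -> t < gaplen r.-1.
Proof.
move=> bl rn; have /andP[lr _] := isblk_le bl.
rewrite ltnNge gaplen_le prednK //; try lia.
have := isblkE bl (i := r.-1); have := isblkE bl (i := r) rn.
move=> h1 /(_ ltac:(lia)) h2; apply/negP => /eqP e.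
by move: h1 h2; rewrite e; lia.
Qed.

(** Blocks only grow with the level, so the levels of a node form an interval. *)
Lemma isblk_conv t1 t2 t l r : isblk t1 l r -> isblk t2 l r -> t1 <= t <= t2 -> isblk t l r.
Proof.
move=> b1 b2 /andP[h1 h2]; apply: isblkP; first exact: isblk_le b1.
have /andP[lr rn] := isblk_le b1.
have up a i j : a <= t2 -> s i %/ 2 ^ a = s j %/ 2 ^ a -> s i %/ 2 ^ t2 = s j %/ 2 ^ t2.
  by move=> ha e; rewrite -(subnKC ha) expnD !divnMA e.
have up1 i j : s i %/ 2 ^ t1 = s j %/ 2 ^ t1 -> s i %/ 2 ^ t = s j %/ 2 ^ t.
  by move=> e; rewrite -(subnKC h1) expnD !divnMA e.
move=> i hi; apply/idP/eqP => [|e].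
  by rewrite (isblkE b1) // => /eqP/up1.
by rewrite (isblkE b2) //; apply/eqP/(up t).
Qed.

Lemma isblk_up t t' l r i : isblk t l r -> t <= t' -> l <= i < r ->
  s i %/ 2 ^ t' = s l %/ 2 ^ t'.
Proof.
move=> b h lir; have /andP[lr rn] := isblk_le b.
move: (lir); rewrite (isblkE b); last lia.
by move=> /eqP e; rewrite -(subnKC h) expnD !divnMA e.
Qed.

(** The maximum is taken over [gapx], which is computable by an exclusive or; it also maximises
    [gaplen], whose maximum on a range is attained only once ([split_uniq]). *)
Definition split l r := argmax_seq gapx (iota l (r.-1 - l)).

Lemma splitP l r : l.+1 < r -> r <= n ->
  [/\ l <= split l r, (split l r).+1 < r &
      forall j, l <= j -> j.+1 < r -> gaplen j <= gaplen (split l r)].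
Proof.
move=> lr rn; have [|h1 h2] := @argmax_seqP gapx (iota l (r.-1 - l)) l.
  by rewrite mem_iota; lia.
move: h1; rewrite -/(split l r) mem_iota => h1; split; [lia|lia|].
move=> j lj jr; apply: gaplen_mono; [lia|lia|].
by apply: h2; rewrite mem_iota; lia.
Qed.

Lemma split_uniq l r p : l <= p -> p.+1 < r -> r <= n ->
  (forall j, l <= j -> j.+1 < r -> gaplen j <= gaplen p) -> split l r = p.
Proof.
move=> lp pr rn h; have [|h1 h2 h3] := @splitP l r _ rn; first lia.
have e : gaplen (split l r) = gaplen p.
  by apply/eqP; rewrite eqn_leq h // h3.
case: (ltngtP (split l r) p) => // lt; exfalso.
  apply: (gaplen_inj (L := gaplen p) lt) => //; first lia.
  by move=> k ? ?; apply: h; lia.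
apply: (gaplen_inj (L := gaplen p) lt) => //; first lia.
by move=> k ? ?; apply: h; lia.
Qed.

Definition levels l r := [seq t <- iota 1 T | isblk t l r].
(* The level of [l, r) divisible by the highest power of 2, as in z-fast tries. *)
Definition handle l r := argmax_seq (logn 2) (levels l r).

Lemma mem_levels t l r : (t \in levels l r) = (0 < t <= T) && isblk t l r.
Proof. by rewrite mem_filter mem_iota add1n ltnS andbC. Qed.

Lemma handleP t l r : 0 < t <= T -> isblk t l r ->
  [/\ 0 < handle l r <= T, isblk (handle l r) l r &
     forall t', 0 < t' <= T -> isblk t' l r -> logn 2 t' <= logn 2 (handle l r)].
Proof.
move=> ht b; have [|h1 h2] := @argmax_seqP (logn 2) (levels l r) t.
  by rewrite mem_levels ht.
move: h1; rewrite -/(handle l r) mem_levels => /andP[? ?]; split=> // t' ? ?.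
by apply: h2; rewrite mem_levels; apply/andP.
Qed.

Lemma handle_uniq l r g v : 0 < g <= T -> isblk g l r -> 2 ^ v %| g ->
  (forall t, 0 < t <= T -> isblk t l r -> 2 ^ v %| t -> t = g) -> handle l r = g.
Proof.
move=> hg b dv h; have [h1 h2 h3] := handleP hg b.
apply: h => //; apply: dvdn_trans (dvdn_exp2l 2 _) (pfactor_dvdnn 2 _).
by apply: leq_trans (h3 _ hg b); rewrite -pfactor_dvdn //; case/andP: hg.
Qed.

(** If the handle were [k * 2 ^ c] with [k >= 2], then [2 ^ c.+1] would lie between the level
    [2 ^ a] and the handle, hence be a level of the node with a larger 2-adic valuation. This is why
    the level table can store an exponent instead of a handle. *)
Lemma handle_pow2 l r a : 2 ^ a <= T -> isblk (2 ^ a) l r ->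
  handle l r = 2 ^ logn 2 (handle l r) /\ 2 ^ a <= handle l r.
Proof.
move=> aT b; have ha : 0 < 2 ^ a <= T by rewrite expn_gt0.
have [h1 h2 h3] := handleP ha b.
set h := handle l r in h1 h2 h3 *; set c := logn 2 h.
have ac : a <= c by have := h3 _ ha b; rewrite pfactorK.
have h0 : 0 < h by case/andP: h1.
have dv : 2 ^ c %| h := pfactor_dvdnn 2 h.
have [k kE] := dvdnP dv.
have c_le : 2 ^ a <= 2 ^ c by rewrite leq_exp2l.
have k1 : k = 1.
  case: k kE => [|[//|k]] kE; first by rewrite kE in h0.
  exfalso; have le : 2 ^ c.+1 <= h by rewrite expnS kE leq_pmul2r ?expn_gt0.
  have bc : isblk (2 ^ c.+1) l r.
    apply: (isblk_conv b h2); rewrite le andbT expnS; lia.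
  have := h3 (2 ^ c.+1); rewrite pfactorK // -/c ltnn => /(_ _ bc) F.
  suff: false by []. apply: F; rewrite expn_gt0 /=.
  by case/andP: h1 => _; apply: leq_trans.
have hE : h = 2 ^ c by rewrite kE k1 mul1n.
by split=> //; rewrite [X in _ <= X]hE.
Qed.

Lemma isblk_split t l r : isblk t l r -> l.+1 < r -> isblk (gaplen (split l r)) l r.
Proof.
move=> b lr; have /andP[_ rn] := isblk_le b.
have [p1 p2 p3] := splitP lr rn; set p := split l r in p1 p2 p3 *.
have pt : gaplen p <= t by apply: (isblk_inner b).
apply: isblkP; first exact: isblk_le b.
move=> i hi; apply/idP/eqP => [/andP[li ir]|e].
  by apply/esym/same_block => // k ? ?; apply: p3; lia.
by rewrite (isblkE b) //; apply/eqP; rewrite -(subnKC pt) expnD !divnMA e.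
Qed.

Definition gap_lo p := blk_lo (gaplen p) (s p %/ 2 ^ gaplen p).
Definition gap_hi p := blk_hi (gaplen p) (s p %/ 2 ^ gaplen p).

(** Gaps correspond to branching nodes: gap [p] splits the block of its own level. Thus [n.-1] gaps
    enumerate all nodes with at least two keys. *)
Lemma gap_block p : p.+1 < n ->
  [/\ isblk (gaplen p) (gap_lo p) (gap_hi p), gap_lo p <= p, p.+1 < gap_hi p &
      split (gap_lo p) (gap_hi p) = p].
Proof.
move=> pn; have pn' : p < n by lia.
have b : isblk (gaplen p) (gap_lo p) (gap_hi p) by apply/occ_isblk/(occP pn').
have := blkE (gaplen p) (s p %/ 2 ^ gaplen p) pn'.
have := blkE (gaplen p) (s p %/ 2 ^ gaplen p) pn.
rewrite eqxx eq_sym -gaplen_le // leqnn -/(gap_lo p) -/(gap_hi p).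
move=> h1 h2; have l1 : p.+1 < gap_hi p by lia.
have l2 : gap_lo p <= p by lia.
split=> //; have /andP[? ?] := isblk_le b.
by apply: split_uniq => // j lj jr; apply: (isblk_inner b).
Qed.

Lemma gaplen_leT p : p.+1 < n -> gaplen p <= T.
Proof.
by move=> pn; rewrite gaplen_le // !divn_small ?s_bound //; lia.
Qed.

Definition node_handle t q := handle (blk_lo t q) (blk_hi t q).
Definition gap_handle p := handle (gap_lo p) (gap_hi p).

Lemma gap_handleP p : p.+1 < n ->
  gaplen p <= gap_handle p <= T /\ isblk (gap_handle p) (gap_lo p) (gap_hi p).
Proof.
move=> pn; have [b l1 l2 _] := gap_block pn.
have [|/andP[h1 h2] h3 _] := @handleP (gaplen p) (gap_lo p) (gap_hi p) _ b.
  by rewrite gaplen_leT.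
by split=> //; rewrite h2 andbT; apply: (isblk_inner h3).
Qed.

(** This includes an empty list of levels, where [argmax_seq] returns the default 0. *)
Lemma handle_leT l r : handle l r <= T.
Proof.
rewrite /handle /argmax_seq; set i := find _ _.
case: (ltnP i (size (levels l r))) => hi; last by rewrite nth_default.
by have := mem_nth 0 hi; rewrite mem_levels => /andP[/andP[]].
Qed.

(* The handle of the longest gap [p] of a bucket is the only data from which the
   position of any gap of that bucket can be recovered: the table of [keys2] maps it
   to the bucket number, and [c %% T] completes this to [c]. *)
Definition bucket_gaps j := [seq i <- iota (j * T) T | i.+1 < n].
Definition bucket_top j := argmax_seq gapx (bucket_gaps j).

Lemma bucket_topP c : c.+1 < n ->
  let p := bucket_top (c %/ T) in
  [/\ p.+1 < n, p %/ T = c %/ T &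
    forall k, minn p c <= k -> k <= maxn p c -> gaplen k <= gaplen p].
Proof.
move=> cn p; have c_in : c \in bucket_gaps (c %/ T).
  by rewrite mem_filter cn mem_iota -mulSnr leq_divM // ltn_ceil.
have [h1 h2] := argmax_seqP gapx c_in; rewrite -/(bucket_top _) -/p in h1 h2.
move: h1; rewrite mem_filter mem_iota -mulSnr => /and3P[pn p1 p2].
have pc : p %/ T = c %/ T.
  apply/eqP; rewrite eqn_leq -ltnS ltn_divLR // p2 leq_divRL //.
split=> // k k1 k2.
have kn : k.+1 < n by lia.
apply: gaplen_mono => //; apply: h2; rewrite mem_filter kn mem_iota -mulSnr.
move: c_in; rewrite mem_filter mem_iota -mulSnr; lia.
Qed.

Definition key_of t i := (t, s i %/ 2 ^ t).

(** The blocks of level 1 contribute the nodes with a single key, the gaps those that branch. Levels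
    start at 1, so two keys differing in the last bit only form one bottom node, listed by both
    parts. *)
Definition keys1 := [seq key_of (node_handle 1 (s m %/ 2 ^ 1)) m | m <- iota 0 n] ++
                    [seq key_of (gap_handle p) p | p <- iota 0 n.-1].
Definition keys2 := [seq key_of (gap_handle (bucket_top j)) (bucket_top j)
                       | j <- iota 0 (n %/ T).+1].

Lemma handle_keys1 t l r : 0 < t <= T -> isblk t l r ->
  key_of (handle l r) l \in keys1.
Proof.
move=> ht b; have /andP[lr rn] := isblk_le b.
have [h1 h2 _] := handleP ht b; rewrite mem_cat; apply/orP.
case: (ltnP l.+1 r) => lr2.
  right; have [p1 p2 p3] := splitP lr2 rn.
  have bs := isblk_split b lr2.
  have e : key_of (handle l r) l = key_of (gap_handle (split l r)) (split l r).
    have lE : s (split l r) %/ 2 ^ gaplen (split l r) = s l %/ 2 ^ gaplen (split l r).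
      by apply: (isblk_up bs) => //; lia.
    have /and3P[_ /eqP e1 /eqP e2] := bs.
    rewrite /gap_handle /gap_lo /gap_hi lE e1 e2 /key_of; congr (_, _).
    by apply/esym/(isblk_up h2) => //; lia.
  by rewrite e; apply: map_f; rewrite mem_iota; lia.
left; have b1 : isblk 1 l r.
  apply: isblkP; first exact/andP.
  move=> i hi; apply/idP/eqP => [?|e]; first by rewrite (_ : i = l) //; lia.
  rewrite (isblkE b) //; apply/eqP.
  by have /andP[h _] := ht; rewrite -(subnKC h) expnD !divnMA e.
have /and3P[_ /eqP e1 /eqP e2] := b1.
apply/mapP; exists l; first by rewrite mem_iota; lia.
by rewrite /node_handle e1 e2.
Qed.

(* The three gaps recorded at a node: the two bordering its block, and the one
   splitting it. *)
Definition cand l r c := [|| c.+1 == l, c.+1 == r | (l.+1 < r) && (c == split l r)].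

(** The longest gap [p] of the bucket of [c] belongs to an ancestor of the node, or to the node
    itself: its handle [h] is at least the handle of [[l, r)], and its prefix is obtained by
    shortening that of the node. Hence [h - handle l r] and [c %% T] are enough to recover [c] from
    the node, once the bucket number is looked up at the ancestor. *)
Lemma cand_decode l r c : 0 < handle l r <= T -> isblk (handle l r) l r ->
  c.+1 < n -> cand l r c ->
  let p := bucket_top (c %/ T) in let h := gap_handle p in
  [/\ handle l r <= h <= T,
      s l %/ 2 ^ handle l r %/ 2 ^ (h - handle l r) = s p %/ 2 ^ h,
      (h, s p %/ 2 ^ h) \in keys2 &
      split (blk_lo h (s p %/ 2 ^ h)) (blk_hi h (s p %/ 2 ^ h)) %/ T = c %/ T].
Proof.
set f := handle l r => hf b cn cd p h.
have /andP[lr rn] := isblk_le b.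
have [pn pc pk] := bucket_topP cn; rewrite -/p in pn pc pk.
have [/andP[h1 h2] hb] := gap_handleP pn; rewrite -/h in h1 h2 hb.
have [gb g1 g2 g3] := gap_block pn.
have cp : gaplen c <= gaplen p by apply: pk; lia.
(* A bordering gap has [f < gaplen c <= gaplen p <= h]. A splitting gap may be shorter than [f]; if
   [p] is another gap and [gaplen p < f], then [p] lies inside the block too and is as long as the
   splitting gap, against the uniqueness of the split. *)
have fh : f <= h.
  case: (eqVneq p c) cd => [pE|npc]; rewrite /cand.
    case/or3P => [/eqP e|/eqP e|/andP[lr2 /eqP e]].
    - apply: leq_trans h1; rewrite pE; apply: ltnW.
      by have := isblk_left b; rewrite -e /=; apply.
    - apply: leq_trans h1; rewrite pE; apply: ltnW.
      by have := isblk_right b; rewrite -e /=; apply.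
    rewrite /f /h /gap_handle pE e.
    have bs := isblk_split b lr2; have [p1 p2 p3] := splitP lr2 rn.
    have lE : s (split l r) %/ 2 ^ gaplen (split l r) = s l %/ 2 ^ gaplen (split l r).
      by apply: (isblk_up bs) => //; lia.
    have /and3P[_ /eqP e1 /eqP e2] := bs.
    by rewrite /gap_lo /gap_hi lE e1 e2.
  case/or3P => [/eqP e|/eqP e|/andP[lr2 /eqP e]].
  - apply: leq_trans h1; apply: leq_trans cp; apply: ltnW.
    by have := isblk_left b; rewrite -e /=; apply.
  - apply: leq_trans h1; apply: leq_trans cp; apply: ltnW.
    by have := isblk_right b; rewrite -e /=; apply.
  have [c1 c2 c3] := splitP lr2 rn; rewrite -e in c1 c2 c3.
  apply: leq_trans h1; rewrite leqNgt; apply/negP => pf.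
  have lpr : l <= p /\ p.+1 < r.
    case: (ltngtP p c) npc => // lt _.
      have eqs : s p %/ 2 ^ f = s c %/ 2 ^ f.
        apply: same_block => //; [lia|lia|move=> k ? ?].
        by apply: leq_trans (ltnW pf); apply: pk; lia.
      have := isblkE b (i := p); have := isblkE b (i := c); rewrite eqs.
      by move=> <-; lia.
    have eqs : s c %/ 2 ^ f = s p.+1 %/ 2 ^ f.
      apply: same_block => //; [lia|move=> k ? ?].
      by apply: leq_trans (ltnW pf); apply: pk; lia.
    have := isblkE b (i := p.+1); have := isblkE b (i := c); rewrite eqs.
    by move=> <-; lia.
  have pE : gaplen p = gaplen c.
    by apply/eqP; rewrite eqn_leq cp andbT c3; lia.
  case: (ltngtP p c) npc => // lt _.
    by apply: (gaplen_inj (L := gaplen p) lt) => // k ? ?; apply: pk; lia.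
  by apply: (gaplen_inj (L := gaplen p) lt) => // k ? ?; apply: pk; lia.
have spc : s p %/ 2 ^ h = s c %/ 2 ^ h.
  case: (leqP p c) => lt.
    apply: same_block => //; [lia|move=> k ? ?].
    by apply: leq_trans h1; apply: pk; lia.
  apply/esym/same_block; [lia|lia|move=> k ? ?].
  by apply: leq_trans h1; apply: pk; lia.
have slc : s c %/ 2 ^ h = s l %/ 2 ^ h.
  have scc : s c %/ 2 ^ h = s c.+1 %/ 2 ^ h.
    by apply/eqP; rewrite -gaplen_le // (leq_trans cp).
  case/or3P: cd => [/eqP e|/eqP e|/andP[lr2 /eqP e]]; first by rewrite scc e.
    by apply: (isblk_up b fh); lia.
  by have [c1 c2 c3] := splitP lr2 rn; apply: (isblk_up b fh); lia.
split.
- by rewrite fh.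
- by rewrite -divnMA -expnD subnKC // spc slc.
- apply/mapP; exists (c %/ T) => //; rewrite mem_iota /= add0n ltnS.
  by apply: leq_div2r; lia.
have lE : s p %/ 2 ^ h = s (gap_lo p) %/ 2 ^ h by apply: (isblk_up hb) => //; lia.
by have /and3P[_ /eqP e1 /eqP e2] := hb; rewrite lE e1 e2 g3.
Qed.

(** * Locating a query between two consecutive keys *)

Section Search.

Variables (x cs : nat).
Hypothesis cs_n : cs.+1 < n.
Hypothesis x_gt : s cs < x.
Hypothesis x_le : x <= s cs.+1.

(** By [extE], this says that x extends the longest common prefix of the keys [i] and [i.+1].
    Written with bitwise operations it can be tested without computing [gaplen i]. *)
Definition ext i := Nat.land (Nat.lxor x (s i)) (Nat.lxor x (s i.+1)) < gapx i.

Lemma extE i : i.+1 < n -> ext i = (x %/ 2 ^ gaplen i == s i %/ 2 ^ gaplen i).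
Proof. by move=> hi; apply: land_lxor_lt; apply: (gaplen_bounds hi). Qed.

Lemma ext_cs : ext cs.
Proof.
rewrite extE // eqn_leq; apply/andP; split; last exact/leq_div2r/ltnW.
have /eqP -> : s cs %/ 2 ^ gaplen cs == s cs.+1 %/ 2 ^ gaplen cs by rewrite -gaplen_le.
exact: leq_div2r.
Qed.

Lemma x_mem t l r : isblk t l r -> s l %/ 2 ^ t = x %/ 2 ^ t ->
  [/\ l <= cs.+1, cs < r & (cs.+1 != l -> cs.+1 != r -> l <= cs /\ cs.+1 < r)].
Proof.
move=> b e; have /andP[lr rn] := isblk_le b.
have h1 : l <= cs.+1.
  rewrite leqNgt; apply/negP => lt; have := isblkE b (i := cs.+1) cs_n.
  rewrite leqNgt lt /= => /esym/negP; apply; rewrite eqn_leq sh_le /=; try lia.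
  by rewrite e leq_div2r.
have h2 : cs < r.
  rewrite ltnNge; apply/negP => lt; have := isblkE b (i := cs) (ltnW cs_n).
  rewrite [cs < r]ltnNge lt andbF => /esym/negP; apply; rewrite eqn_leq andbC sh_le /=; try lia.
  by rewrite e leq_div2r // ltnW.
by split=> //; lia.
Qed.

Lemma occ_ext t i : i.+1 < n -> ext i -> gaplen i <= t ->
  [/\ occ t (x %/ 2 ^ t), blk_lo t (x %/ 2 ^ t) <= i & i.+1 < blk_hi t (x %/ 2 ^ t)].
Proof.
move=> hi; rewrite extE // => /eqP e le.
have xi : s i %/ 2 ^ t = x %/ 2 ^ t by rewrite -(subnKC le) expnD !divnMA e.
have xi1 : s i.+1 %/ 2 ^ t = x %/ 2 ^ t by rewrite -xi; apply/esym/eqP; rewrite -gaplen_le.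
split; first by apply: (occP (i := i)) => //; lia.
  by have := blkE t (x %/ 2 ^ t) (ltnW hi); rewrite xi eqxx; lia.
by have := blkE t (x %/ 2 ^ t) hi; rewrite xi1 eqxx; lia.
Qed.

(** A miss is progress. When x is in the block and [cs] is none of the candidates, [cs] is strictly
    inside and different from the splitting gap, which is then longer than [cs] and still extended
    by x: it serves as the next upper bound of the search. *)
Lemma x_split t l r : isblk t l r -> s l %/ 2 ^ t = x %/ 2 ^ t -> ~~ cand l r cs ->
  [/\ l.+1 < r, ext (split l r), gaplen (split l r) <= t &
      gaplen cs < gaplen (split l r)].
Proof.
move=> b e; rewrite /cand !negb_or => /and3P[n1 n2 n3].
have [_ _ /(_ n1 n2) [h1 h2]] := x_mem b e.
have /andP[lr rn] := isblk_le b.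
have lr2 : l.+1 < r by lia.
rewrite lr2 /= in n3; have [p1 p2 p3] := splitP lr2 rn.
set p := split l r in n3 p1 p2 p3 *.
have pt : gaplen p <= t by apply: (isblk_inner b).
have cp := p3 cs h1 h2.
have bs := isblk_split b lr2; rewrite -/p in bs.
have scp : s cs %/ 2 ^ gaplen p = s p %/ 2 ^ gaplen p.
  by rewrite !(isblk_up bs (leqnn _)) //; lia.
have xp : ext p.
  rewrite extE; last lia.
  rewrite -scp; move: ext_cs; rewrite extE // => /eqP ec.
  by rewrite -(subnKC cp) expnD !divnMA ec.
split=> //; rewrite ltn_neqAle cp andbT; apply/eqP => eL.
case: (ltngtP cs p) n3 => // lt _.
  by apply: (gaplen_inj (L := gaplen p) lt) => //; [lia|move=> k ? ?; apply: p3; lia].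
by apply: (gaplen_inj (L := gaplen p) lt) => //; [move=> k ? ?; apply: p3; lia].
Qed.

(** When the block of x is empty, [cs] borders any occupied neighbour, so a candidate of that
    neighbour is the answer and no search is required. The same holds on the other side. *)
Lemma empty_right t : ~~ occ t (x %/ 2 ^ t) -> occ t (x %/ 2 ^ t).-1 -> 0 < x %/ 2 ^ t ->
  cs.+1 = blk_hi t (x %/ 2 ^ t).-1.
Proof.
move=> nox o x0; set q := (x %/ 2 ^ t).-1 in o *.
have h1 : cs < blk_hi t q.
  rewrite blk_hiE ?(ltnW cs_n) // -ltnS prednK // ltn_neqAle leq_div2r ?(ltnW x_gt) // andbT.
  by apply: contraNneq nox => e; apply: (occP (i := cs)); rewrite ?(ltnW cs_n).
have h2 : ~~ (cs.+1 < blk_hi t q).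
  rewrite blk_hiE // -ltnNge prednK //; exact: leq_div2r.
by lia.
Qed.

Lemma empty_left t : ~~ occ t (x %/ 2 ^ t) -> occ t (x %/ 2 ^ t).+1 ->
  cs.+1 = blk_lo t (x %/ 2 ^ t).+1.
Proof.
move=> nox o; set q := (x %/ 2 ^ t).+1 in o *.
have h1 : cs < blk_lo t q.
  by rewrite blk_loE ?(ltnW cs_n) // ltnS leq_div2r // ltnW.
have h2 : ~~ (cs.+1 < blk_lo t q).
  rewrite blk_loE // -leqNgt ltn_neqAle leq_div2r // andbT.
  by apply: contraNneq nox => e; apply: (occP (i := cs.+1)).
by lia.
Qed.

(** Blocks have width [2 ^ t], so a key within that distance is in the block of x or next to it.
    Contraposed, three empty blocks give a lower bound on d(x, S). *)
Lemma near_occ t : (x - s cs <= 2 ^ t) || (s cs.+1 - x <= 2 ^ t) ->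
  [|| occ t (x %/ 2 ^ t), (0 < x %/ 2 ^ t) && occ t (x %/ 2 ^ t).-1 | occ t (x %/ 2 ^ t).+1].
Proof.
have p0 : 0 < 2 ^ t by rewrite expn_gt0.
have addE a : (a + 2 ^ t) %/ 2 ^ t = (a %/ 2 ^ t).+1.
  by rewrite divnDr ?dvdnn // divnn p0 addn1.
have aux a b : a < b -> b <= a.+1 -> a = b.-1 /\ b = a.+1 by lia.
case/orP => le.
  have l1 : s cs %/ 2 ^ t <= x %/ 2 ^ t by rewrite leq_div2r // ltnW.
  have l2 : x %/ 2 ^ t <= (s cs %/ 2 ^ t).+1.
    by rewrite -addE leq_div2r //; lia.
  case: (ltngtP (s cs %/ 2 ^ t) (x %/ 2 ^ t)) l1 => // [lt _|e _].
    apply/or3P; apply: Or32; rewrite (leq_ltn_trans (leq0n _) lt).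
    by apply: (occP (i := cs)); [exact: ltnW | have [] := aux _ _ lt l2].
  by rewrite (occP (i := cs)) // ltnW.
have l1 : x %/ 2 ^ t <= s cs.+1 %/ 2 ^ t by rewrite leq_div2r.
have l1' : s cs.+1 %/ 2 ^ t <= (x %/ 2 ^ t).+1.
  by rewrite -addE leq_div2r //; lia.
case: (ltngtP (x %/ 2 ^ t) (s cs.+1 %/ 2 ^ t)) l1 => // [lt _|e _].
  apply/or3P; apply: Or33.
  by apply: (occP (i := cs.+1)) => //; have [] := aux _ _ lt l1'.
by rewrite (occP (i := cs.+1)).
Qed.

(* Invariant of the fat binary search on the levels between [lo] and
   [gaplen b]. *)
Definition search_inv b lo v :=
  [/\ b.+1 < n, ext b, gaplen cs < gaplen b,
      (forall i, i.+1 < n -> ext i -> lo < gaplen i) &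
      (forall y, lo < y -> y < gaplen b -> ~~ (2 ^ v %| y))].

(** With [v = 0] the invariant forbids every level strictly between [lo] and [gaplen b], yet
    [gaplen cs] is one. A search started with exponent [v] must therefore meet the answer within [v]
    steps. *)
Lemma search_end b lo : ~ search_inv b lo 0.
Proof.
case=> bn eb lt h1 h2; have := h2 (gaplen cs) (h1 cs cs_n ext_cs) lt.
by rewrite dvd1n.
Qed.

Definition next_mult lo v := (lo %/ 2 ^ v).+1 * 2 ^ v.

Lemma next_mult_gt lo v : lo < next_mult lo v.
Proof. by apply: ltn_ceil; rewrite expn_gt0. Qed.

Lemma next_mult_le lo v y : lo < y -> 2 ^ v %| y -> next_mult lo v <= y.
Proof.
move=> lt /dvdnP[k yE]; rewrite yE in lt *; rewrite leq_pmul2r ?expn_gt0 //.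
by rewrite ltn_divLR ?expn_gt0.
Qed.

Lemma search_skip b lo v : search_inv b lo v.+1 -> gaplen b <= next_mult lo v ->
  search_inv b lo v.
Proof.
case=> bn eb lt h1 h2 le; split=> // y ly yb; apply/negP => dv.
by have := next_mult_le ly dv; rewrite leqNgt (leq_trans yb le).
Qed.

(** Among two consecutive multiples of [2 ^ v] one is a multiple of [2 ^ v.+1], and none of those is
    left in the interval. So the next multiple is the only one, and raising [lo] to it leaves
    none. *)
Lemma search_none b lo v : search_inv b lo v.+1 -> next_mult lo v < gaplen b ->
  (forall i, i.+1 < n -> ext i -> next_mult lo v < gaplen i) ->
  search_inv b (next_mult lo v) v.
Proof.
case=> bn eb lt h1 h2 gb none; split=> // y gy yb; apply/negP => dv.
set g := next_mult lo v in gb none gy.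
have lg : lo < g := next_mult_gt lo v.
have dg : 2 ^ v %| g by rewrite dvdn_mull.
have ng := h2 g lg gb.
have [k1 e1] := dvdnP dg; have [k2 e2] := dvdnP dv.
have k1o : odd k1.
  apply: contraR ng => ev; rewrite e1 expnS dvdn_pmul2r ?expn_gt0 //.
  by rewrite dvdn2.
have lt12 : k1 < k2 by move: gy; rewrite e1 e2 ltn_pmul2r ?expn_gt0.
have := h2 (k1.+1 * 2 ^ v); rewrite expnS dvdn_pmul2r ?expn_gt0 // dvdn2 /= k1o.
have le : k1.+1 * 2 ^ v <= y by rewrite e2 leq_pmul2r ?expn_gt0.
have ge : g <= k1.+1 * 2 ^ v by rewrite e1 leq_pmul2r ?expn_gt0.
by move=> F; have := F (leq_trans lg ge) (leq_ltn_trans le yb).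
Qed.

(** If some gap of length at most [g] is extended by x, the block of x at level [g] is occupied and
    [g] is its handle, so its table entry can be read. Either [cs] is a candidate there or the split
    becomes the new upper gap. *)
Lemma search_some b lo v i : search_inv b lo v.+1 -> next_mult lo v < gaplen b ->
  i.+1 < n -> ext i -> gaplen i <= next_mult lo v ->
  let g := next_mult lo v in let q := x %/ 2 ^ g in
  let l := blk_lo g q in let r := blk_hi g q in
  [/\ isblk g l r, handle l r = g, s l %/ 2 ^ g = q &
      ~~ cand l r cs -> [/\ l.+1 < r, ext (split l r), gaplen (split l r) <= g &
                           search_inv (split l r) lo v]].
Proof.
case=> bn eb lt h1 h2 gb hi ei ig g q l r.
rewrite -/g in gb ig.
have [o li ir] := occ_ext hi ei ig; rewrite -/q -/l -/r in o li ir.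
have lE : s l %/ 2 ^ g = q by apply: occ_lo.
have b_lr : isblk g l r by apply: occ_isblk.
have lg : lo < g := next_mult_gt lo v.
have bT := gaplen_leT bn.
have gT : 0 < g <= T by lia.
have /andP[lr rn] := isblk_le b_lr.
have dg : 2 ^ v %| g by rewrite dvdn_mull.
(* All levels of this block lie strictly between [lo] and [gaplen b]. A second multiple of [2 ^ v]
   among them would force a multiple of [2 ^ v.+1] into that interval. *)
have hg : handle l r = g.
  apply: (handle_uniq gT b_lr dg) => t /andP[t0 tT] bt dt.
  have lr2 : l.+1 < r by lia.
  have lt_t : lo < t.
    by apply: leq_trans (h1 i hi ei) _; apply: (isblk_inner bt).
  have gt : g <= t by apply: next_mult_le.
  have tb : t < gaplen b.
    rewrite ltnNge; apply/negP => bt'.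
    have [ob lb rb] := occ_ext bn eb bt'.
    have et : x %/ 2 ^ t = s l %/ 2 ^ t by rewrite -(subnKC gt) expnD !divnMA lE.
    have /and3P[_ /eqP e1 /eqP e2] := bt; rewrite et e1 e2 in lb rb.
    by have := isblk_inner b_lr lb rb; lia.
  case: (ltngtP g t) gt => // gt _.
  have none := @h2 t lt_t tb; have none' := @h2 g lg gb.
  have [k1 e1] := dvdnP dg; have [k2 e2] := dvdnP dt.
  have k1o : odd k1.
    by apply: contraR none' => ev; rewrite e1 expnS dvdn_pmul2r ?expn_gt0 // dvdn2.
  have k2o : odd k2.
    by apply: contraR none => ev; rewrite e2 expnS dvdn_pmul2r ?expn_gt0 // dvdn2.
  have lt12 : k1 < k2 by move: gt; rewrite e1 e2 ltn_pmul2r ?expn_gt0.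
  exfalso; have := @h2 (k1.+1 * 2 ^ v); rewrite expnS dvdn_pmul2r ?expn_gt0 // dvdn2 /= k1o.
  have le : k1.+1 * 2 ^ v <= t by rewrite e2 leq_pmul2r ?expn_gt0.
  have ge : g <= k1.+1 * 2 ^ v by rewrite e1 leq_pmul2r ?expn_gt0.
  by move=> F; have := F (leq_trans lg ge) (leq_ltn_trans le tb).
split=> // nc; have [lr2 e1 e2 e3] := x_split b_lr lE nc.
have [p1 p2 p3] := splitP lr2 rn.
split=> //; split=> //; first lia.
move=> y ly yb; apply/negP => dv.
by have := next_mult_le ly dv; rewrite -/g; lia.
Qed.

End Search.

End Trie.

(** * Retrieval from random graphs *)

Definition evenly (V : eqType) (s : seq V) := all (fun v => ~~ odd (count_mem v s)) s.

Lemma evenlyP (V : eqType) (s : seq V) :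
  reflect (forall v, ~~ odd (count_mem v s)) (evenly s).
Proof.
apply: (iffP allP) => h v; last by move=> _; apply: h.
case: (boolP (v \in s)) => [/h//|]; by rewrite -has_pred1 has_count lt0n negbK => /eqP->.
Qed.

Section Solvable.
Import GRing.Theory.
Local Open Scope ring_scope.

Variables (N : nat) (V : eqType) (v1 v2 : 'I_N -> V).

Definition ends_of (E : {set 'I_N}) := flatten [seq [:: v1 i; v2 i] | i <- enum E].

Lemma count_ends E v :
  count_mem v (ends_of E) = (\sum_(i in E) ((v1 i == v) + (v2 i == v)))%N.
Proof.
rewrite /ends_of -big_enum /=.
by elim: (enum E) => [|i l IH]; rewrite ?big_nil // big_cons /= IH addnA.
Qed.

(** A set of edges meeting every vertex evenly often is a linear dependence over F_2 between rows of
    the incidence matrix. Without one the matrix has a right inverse, which solves the system for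
    every right-hand side. *)
Lemma solvable_of_even_free (f : 'I_N -> bool) :
  (forall E : {set 'I_N}, E != set0 -> ~~ evenly (ends_of E)) ->
  exists a : V -> bool, forall i, a (v1 i) (+) a (v2 i) = f i.
Proof.
move=> free; pose vs := undup (ends_of setT).
have v1_vs i : v1 i \in vs.
  rewrite mem_undup; apply/flattenP; exists [:: v1 i; v2 i]; last exact: mem_head.
  by apply/mapP; exists i; rewrite ?mem_enum ?inE.
have v2_vs i : v2 i \in vs.
  rewrite mem_undup; apply/flattenP; exists [:: v1 i; v2 i]; last by rewrite !inE eqxx orbT.
  by apply/mapP; exists i; rewrite ?mem_enum ?inE.
have dflt : forall i : 'I_N, 'I_(size vs).
  by move=> i; apply: (@Ordinal _ (index (v1 i) vs)); rewrite index_mem.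
pose vtx (j : 'I_(size vs)) : V := tnth (in_tuple vs) j.
(* A loop contributes 2 = 0, in agreement with the exclusive or of a cell with itself. *)
pose M : 'M['F_2]_(N, size vs) :=
  \matrix_(i, j) ((v1 i == vtx j) + (v2 i == vtx j))%:R.
have F2_01 (z : 'F_2) : z != 0 -> z = 1.
  by case: z => [] [|[|m]] //= h _; apply: val_inj.
have odd0 m : ((m%:R : 'F_2) == 0) = ~~ odd m.
  by rewrite -(dvdn_pcharf (pchar_Fp (isT : prime 2))) dvdn2.
have free_M : row_free M.
  apply: inj_row_free => u uM0; apply/eqP; apply: contraT => u0.
  pose E := [set i | u 0 i != 0].
  have E0 : E != set0.
    apply: contraNneq u0 => E0; apply/eqP/rowP => i; rewrite mxE.
    by apply/eqP; have := in_set0 i; rewrite -E0 inE => /negbFE.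
  case/negP: (free E E0); apply/evenlyP => v; rewrite count_ends.
  case: (boolP (v \in vs)) => [vvs|nv]; last first.
    rewrite big1 // => i _.
    have /negbTE-> : v1 i != v by apply: contraNneq nv => <-.
    by have /negbTE-> : v2 i != v by apply: contraNneq nv => <-.
  have [j jE] : exists j, vtx j = v.
    by have /tnthP[j e] : v \in in_tuple vs := vvs; exists j.
  have := congr1 (fun A : 'M_(_, _) => A 0 j) uM0; rewrite !mxE => /eqP.
  rewrite (_ : \sum_k _ = (\sum_(i in E) ((v1 i == v) + (v2 i == v)))%:R) ?odd0 //.
  rewrite natr_sum [RHS]big_mkcond /=; apply: eq_bigr => i _.
  rewrite mxE jE inE; case: (eqVneq (u 0 i) 0) => [->|/F2_01->] /=; first by rewrite mul0r.
  by rewrite mul1r.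
have [B MB] := row_freeP free_M.
pose a := B *m (\col_i (f i : nat)%:R).
pose av v := if insub (index v vs) is Some j then a j 0 != 0 else false.
have avE (j : 'I_(size vs)) : av (vtx j) = (a j 0 != 0).
  rewrite /av insubT ?index_mem => [|h]; first by rewrite mem_tnth.
  congr (a _ _ != _); apply: val_inj => /=.
  by rewrite /vtx (tnth_nth (vtx j)) index_uniq // undup_uniq.
exists av => i.
have [j1 j1E] : exists j, vtx j = v1 i.
  by have /tnthP[j e] : v1 i \in in_tuple vs := v1_vs i; exists j.
have [j2 j2E] : exists j, vtx j = v2 i.
  by have /tnthP[j e] : v2 i \in in_tuple vs := v2_vs i; exists j.
have vinj : injective vtx.
  by apply/tuple_uniqP; rewrite undup_uniq.
have Ma : M *m a = \col_i (f i : nat)%:R by rewrite mulmxA MB mul1mx.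
have := congr1 (fun A : 'cV_(_) => A i 0) Ma; rewrite !mxE.
rewrite (eq_bigr (fun k => (if k == j1 then a k 0 else 0) + (if k == j2 then a k 0 else 0))).
  rewrite big_split /= -!big_mkcond /= !big_pred1_eq => e.
  rewrite -j1E -j2E !avE; move: e.
  case: (f i) (a j1 0) (a j2 0) => [] [] [|[|m]] // h1 [] [|[|m']] // h2.
move=> k _; rewrite mxE -j1E -j2E !(inj_eq vinj) ![_ == k]eq_sym natrD mulrDl.
by do 2!case: eqP => _; rewrite ?mul1r ?mul0r.
Qed.

End Solvable.

(** * Counting hash families whose graph is dependent *)

Section Counting.

Variables (P Y : finType).
Local Notation fam := {ffun P -> Y}.
Hypothesis Y_gt0 : 0 < #|Y|.

Definition upd (H : fam) p y : fam := [ffun z => if z == p then y else H z].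

Definition cnt (A : pred fam) := \sum_(H : fam) (A H : nat).

Lemma cnt_card (A : pred fam) : cnt A = #|[set H | A H]|.
Proof. by rewrite /cnt -sum1_card [RHS]big_mkcond; apply: eq_bigr => H _; rewrite inE; case: (A H). Qed.

(** Redrawing the value at [p] preserves the uniform distribution: each family is [upd H p y] for
    exactly [#|Y|] pairs. *)
Lemma resample (phi : fam -> nat) p :
  (\sum_H phi H) * #|Y| = \sum_H \sum_y phi (upd H p y).
Proof.
rewrite pair_big /= (partition_big (fun z : fam * Y => upd z.1 p z.2) xpredT) //=.
rewrite big_distrl /=; apply: eq_bigr => K _.
rewrite (eq_bigr (fun=> phi K)) => [|z /eqP-> //].
rewrite sum_nat_const mulnC; congr (_ * _).
have <- : #|[set (upd K p z, K p) | z : Y]| = #|Y|.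
  by apply: card_imset => y1 y2 [/ffunP/(_ p)]; rewrite !ffunE eqxx.
apply: eq_card => -[H y]; rewrite -[RHS]/(upd H p y == K); apply/imsetP/eqP => [[z _ [-> ->]]|<-].
  by apply/ffunP => q; rewrite !ffunE; case: eqP => // ->.
exists (H p) => //; congr (_, _); last by rewrite ffunE eqxx.
by apply/ffunP => q; rewrite !ffunE; case: eqP => // ->.
Qed.

Lemma cnt_le (A B : pred fam) : (forall H, A H -> B H) -> cnt A <= cnt B.
Proof. by move=> h; apply: leq_sum => H _; have := h H; case: (A H) (B H) => [] [] // ->. Qed.

Definition indep (U : eqType) (f : fam -> U) (ps : seq P) :=
  forall H p y, p \in ps -> f (upd H p y) = f H.

Variables (m1 m2 : nat) (r1 r2 : Y -> nat).
Hypothesis r1_unif : forall v, #|[set y | r1 y == v]| * m1 <= #|Y|.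
Hypothesis r2_unif : forall v, #|[set y | r2 y == v]| * m2 <= #|Y|.

Definition vertex (H : fam) (e : P * P) := (r1 (H e.1), r2 (H e.2)).

(** With all other values fixed, the vertex read at the two points of [e] hits a prescribed vertex
    with probability at most [1 / (m1 * m2)]; the target and the side condition do not depend on
    these two points. *)
Lemma cnt_vertex_eq (e : P * P) (v : fam -> nat * nat) (R : pred fam) :
  e.1 != e.2 -> indep v [:: e.1; e.2] -> indep R [:: e.1; e.2] ->
  cnt (fun H => (v H == vertex H e) && R H) * (m1 * m2) <= cnt R.
Proof.
move=> e12 iv iR.
have sum_unif r m v0 : (forall v, #|[set y | r y == v]| * m <= #|Y|) ->
    (\sum_(y : Y) (r y == v0)) * m <= #|Y|.
  move=> u; apply: leq_trans (u v0); rewrite leq_mul2r -sum1_card; apply/orP; right.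
  by rewrite [X in _ <= X]big_mkcond; apply: leq_sum => y _; rewrite inE; case: eqP.
set A := fun H => _; pose phi H : nat := A H.
have E : cnt A * #|Y| * #|Y| =
    \sum_H R H * ((\sum_y (r1 y == (v H).1)) * (\sum_y (r2 y == (v H).2))).
  rewrite (resample phi e.1) (resample _ e.2); apply: eq_bigr => H _.
  rewrite [in RHS]mulnC big_distrlr /= exchange_big big_distrl; apply: eq_bigr => y2 _.
  rewrite big_distrl; apply: eq_bigr => y1 _ /=.
  rewrite /phi /A !(iv, iR) ?inE ?eqxx ?orbT // /vertex !ffunE eqxx.
  rewrite [e.2 == e.1]eq_sym (negbTE e12) eqxx -pair_eqE /pair_eq /=.
  by rewrite [(v H).1 == _]eq_sym [(v H).2 == _]eq_sym; case: (R H); case: (r1 _ == _); case: (r2 _ == _).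
rewrite -(leq_pmul2r Y_gt0) -(leq_pmul2r Y_gt0).
have -> : cnt A * (m1 * m2) * #|Y| * #|Y| = cnt A * #|Y| * #|Y| * (m1 * m2) by lia.
rewrite E -mulnA /cnt !big_distrl /=; apply: leq_sum => H _.
rewrite -mulnA leq_mul2l; apply/orP; right.
by rewrite mulnACA leq_mul // sum_unif.
Qed.


(** By parity the vertex of [e] occurs once more; removing both occurrences preserves evenness. *)
Lemma evenly_cons (U V : eqType) (f : U -> V) e (L : seq U) :
  evenly (map f (e :: L)) ->
  exists2 e', e' \in L & (f e' == f e) && evenly (map f (rem e' L)).
Proof.
move/evenlyP => h.
have /mapP[e' e'L fe] : f e \in map f L.
  by rewrite -has_pred1 has_count; have := h (f e); rewrite /= eqxx; case: (count _ _).
exists e' => //; rewrite fe eqxx; apply/evenlyP => v.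
have := h v; rewrite /= fe.
have /permP -> : perm_eq (map f L) (map f (e' :: rem e' L)) by apply/perm_map/perm_to_rem.
by rewrite /= addnA oddD addnn odd_double.
Qed.

Definition points (L : seq (P * P)) := flatten [seq [:: e.1; e.2] | e <- L].

Lemma points_mem L e : e \in L -> (e.1 \in points L) /\ (e.2 \in points L).
Proof.
move=> eL; split; apply/flattenP; exists [:: e.1; e.2];
  rewrite ?inE ?eqxx ?orbT //; by apply/mapP; exists e.
Qed.

Lemma points_rem L e : {subset points (rem e L) <= points L}.
Proof.
move=> p /flattenP[s /mapP[e' e'L ->] ps]; apply/flattenP; exists [:: e'.1; e'.2] => //.
by apply/mapP; exists e' => //; apply: mem_rem e'L.
Qed.

Lemma points_uniq_rem L e : uniq (points L) -> uniq (points (rem e L)).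
Proof.
elim: L => //= f L IH; rewrite /points /= => /and3P[h1 h2 h3].
case: eqP => // _ /=; rewrite IH // andbT.
move: h1 h2; rewrite !inE !negb_or => /andP[-> h1] h2 /=; apply/andP; split.
  by apply: contra h1 => /points_rem.
by apply: contra h2 => /points_rem.
Qed.

Lemma indep_vertex e (ps : seq P) : e.1 \notin ps -> e.2 \notin ps ->
  indep (fun H => vertex H e) ps.
Proof.
move=> h1 h2 H p y pps; rewrite /vertex !ffunE.
by case: eqP h1 => [->|_ _]; rewrite ?pps //; case: eqP h2 => [->|_ _]; rewrite ?pps.
Qed.

Lemma indep_map L (ps : seq P) : (forall p, p \in ps -> p \notin points L) ->
  forall H p y, p \in ps -> map (vertex (upd H p y)) L = map (vertex H) L.
Proof.
move=> h H p y pps; apply/eq_in_map => e eL; have [p1 p2] := points_mem eL.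
by rewrite /vertex !ffunE; have := h p pps; case: eqP => [<-|_]; rewrite ?p1 //;
  case: eqP => [<-|_]; rewrite ?p2.
Qed.

(* A configuration in which every vertex occurs evenly often pairs up the
   endpoints; there are [(2l-1)!! <= 2^l l!] pairings of [2l] endpoints. *)
Lemma cnt_evenly l L (Q : pred fam) :
  size L = l.*2 -> uniq (points L) -> indep Q (points L) ->
  cnt (fun H => evenly (map (vertex H) L) && Q H) * (m1 * m2) ^ l <=
  2 ^ l * l`! * cnt Q.
Proof.
elim: l L Q => [|l IH] [|e L] Q //= sz; first by rewrite muln1 !mul1n => _ _; apply: cnt_le.
case: sz => sz /and3P[u1 u2 u3] iQ.
move: u1; rewrite inE negb_or => /andP[e12 u1].
have iQ' : indep Q [:: e.1; e.2].
  by move=> H p y hp; apply: iQ; rewrite /points /= !inE in hp *; case/orP: hp => ->; rewrite ?orbT.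
pose B e' (H : fam) := (vertex H e' == vertex H e) && (evenly (map (vertex H) (rem e' L)) && Q H).
have le1 : cnt (fun H => evenly (map (vertex H) (e :: L)) && Q H) <= \sum_(e' <- L) cnt (B e').
  rewrite /cnt exchange_big /=; apply: leq_sum => H _.
  case: (boolP (evenly _)) => //= ev; case: (boolP (Q H)) => //= QH.
  have [e' e'L /andP[h1 h2]] := evenly_cons ev.
  by rewrite (big_rem e') //= /B h1 h2 QH.
apply: leq_trans (leq_mul le1 (leqnn _)) _.
rewrite expnSr big_distrl /= expnS factS.
have step e' : e' \in L -> cnt (B e') * ((m1 * m2) ^ l * (m1 * m2)) <= 2 ^ l * l`! * cnt Q.
  move=> e'L; have [p1 p2] := points_mem e'L.
  have iR : indep (fun H => evenly (map (vertex H) (rem e' L)) && Q H) [:: e.1; e.2].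
    move=> H p y hp; rewrite iQ' // (@indep_map _ [:: e.1; e.2]) // => q.
    by rewrite !inE => /orP[] /eqP->; [apply: contra u1|apply: contra u2] => /points_rem.
  have iv : indep (fun H => vertex H e') [:: e.1; e.2].
    have ne q q' : q \notin points L -> q' \in points L -> q' != q.
      by move=> h1 h2; apply: contraNneq h1 => <-.
    by apply: indep_vertex; rewrite !inE !negb_or !ne.
  have := cnt_vertex_eq e12 iv iR; rewrite mulnC => h.
  rewrite [X in X <= _]mulnA [_ * (m1 * m2)]mulnC mulnA [X in X <= _]mulnC.
  apply: leq_trans (leq_mul (leqnn _) h) _; rewrite mulnC; apply: IH.
  - by rewrite size_rem // sz.
  - exact: points_uniq_rem.
  - by move=> H p y hp; apply: iQ; rewrite /points /= !inE (points_rem hp) !orbT.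
rewrite big_seq; apply: leq_trans (leq_sum _ (fun i => step i)) _.
(* Here [e] has [l.*2.+1] possible partners, which is bounded by [l.+1.*2], the factor separating
   [2 ^ l.+1] times the factorial of [l.+1] from its predecessor. *)
rewrite -big_seq big_const_seq count_predT iter_addn_0 sz.
rewrite [X in _ <= X](_ : _ = 2 ^ l * l`! * cnt Q * l.+1.*2) ?leq_mul2l ?leq_double ?ltn_Sdouble; last lia.
by rewrite doubleS ltnW ?orbT.
Qed.

(** The sum of [8 ^ -l] over positive [l] is 1/7. *)
Lemma geometric_bound (a : nat -> nat) c k :
  (forall l, 0 < l -> a l * 8 ^ l <= c) -> 7 * \sum_(1 <= l < k.+1) a l <= c.
Proof.
move=> h; have p8 : 0 < 8 ^ k by rewrite expn_gt0.
rewrite -(leq_pmul2r p8); apply: (@leq_trans (7 * (\sum_(1 <= l < k.+1) a l) * 8 ^ k + c)).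
  exact: leq_addr.
elim: k {p8} => [|k IH]; first by rewrite big_geq //; lia.
rewrite big_nat_recr //=; have := h k.+1 isT; rewrite expnS; nia.
Qed.

Section Graph.

Variables (N : nat) (pt : 'I_N -> nat -> P).
Hypothesis pt_inj : forall i i' j j', j < 4 -> j' < 4 -> pt i j = pt i' j' -> i = i' /\ j = j'.
Hypothesis m_ge : 16 * N <= m1 * m2.

(** A key reads four hash values, two for each end of its edge: a row, reduced by [r1], and a slot
    in that row, reduced by [r2]. *)
Definition edge1 H i := vertex H (pt i 0, pt i 1).
Definition edge2 H i := vertex H (pt i 2, pt i 3).

Definition dependent H :=
  [exists E : {set 'I_N}, (E != set0) && evenly (ends_of (edge1 H) (edge2 H) E)].

(** Union bound over the sets of [l] edges: at most [N ^ l] over the factorial of [l] sets, each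
    even with probability at most that factorial times [(2 / (m1 * m2)) ^ l]. As
    [16 * N <= m1 * m2], this is at most [8 ^ -l], and the sum over [l] is at most 1/7. *)
Lemma cnt_dependent (Q : pred fam) :
  (forall H i j y, j < 4 -> Q (upd H (pt i j) y) = Q H) ->
  7 * cnt (fun H => dependent H && Q H) <= cnt Q.
Proof.
move=> iQ; pose L (E : {set 'I_N}) :=
  flatten [seq [:: (pt i 0, pt i 1); (pt i 2, pt i 3)] | i <- enum E].
have ptsL E : points (L E) = [seq pt i j | i <- enum E, j <- iota 0 4].
  by rewrite /L /points; elim: (enum E) => //= i l ->.
have mapL H E : map (vertex H) (L E) = ends_of (edge1 H) (edge2 H) E.
  by rewrite /L /ends_of; elim: (enum E) => //= i l ->.
have szL E : size (L E) = #|E|.*2.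
  by rewrite /L cardE; elim: (enum E) => //= i l ->.
have uL E : uniq (points (L E)).
  rewrite ptsL; apply: allpairs_uniq; rewrite ?enum_uniq ?iota_uniq //.
  have lt4 i j : (i, j) \in [seq (a, b) | a <- enum E, b <- iota 0 4] -> j < 4.
    by case/allpairsP => -[a b] [_ jb [_ ->]]; rewrite mem_iota in jb.
  move=> [i j] [i' j'] /lt4 j4 /lt4 j4' e.
  by have [-> ->] := pt_inj j4 j4' e.
have iL E : indep Q (points (L E)).
  move=> H p y; rewrite ptsL => /allpairsP[[i j] [_ j4 ->]].
  by apply: iQ; rewrite mem_iota in j4.
pose S l := \sum_(E : {set 'I_N} | #|E| == l)
  cnt (fun H => evenly (ends_of (edge1 H) (edge2 H) E) && Q H).
have N0 : forall E : {set 'I_N}, E != set0 -> 0 < #|E| <= N.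
  by move=> E E0; rewrite card_gt0 E0 -[X in _ <= X](card_ord N) max_card.
have le1 : cnt (fun H => dependent H && Q H) <= \sum_(1 <= l < N.+1) S l.
  rewrite /S; under eq_bigr do rewrite /cnt exchange_big /=.
  rewrite exchange_big /=; apply: leq_sum => H _.
  case: (boolP (dependent H)) => //= /existsP[E /andP[E0 ev]].
  have El := N0 E E0.
  rewrite (bigD1_seq #|E|) ?mem_index_iota ?iota_uniq //= (bigD1 E) //= ev /=.
  by case: (Q H) => //=; rewrite -addnA leq_addr.
apply: leq_trans (leq_mul (leqnn 7) le1) _; apply: geometric_bound => l l0.
case: (posnP N) => [N_0|Ngt0].
  rewrite /S big1 // => E /eqP El; exfalso.
  by have lN : l <= N; [rewrite -El -[X in _ <= X](card_ord N) max_card | lia].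
have pN : 0 < N ^ l by rewrite expn_gt0 Ngt0.
rewrite -(leq_pmul2r pN).
have step (E : {set 'I_N}) : #|E| == l ->
    cnt (fun H => evenly (ends_of (edge1 H) (edge2 H) E) && Q H) * (8 ^ l * N ^ l) <= l`! * cnt Q.
  move=> /eqP El; have p2 : 0 < 2 ^ l by rewrite expn_gt0.
  rewrite -(leq_pmul2r p2) -[X in X <= _]mulnA [X in _ <= X]mulnC [X in _ <= X]mulnA.
  have -> : 8 ^ l * N ^ l * 2 ^ l = (16 * N) ^ l.
    by rewrite mulnAC -!expnMn.
  have := cnt_evenly (etrans (szL E) (congr1 double El)) (uL E) (iL E).
  have eqc : cnt (fun H => evenly (map (vertex H) (L E)) && Q H) =
             cnt (fun H => evenly (ends_of (edge1 H) (edge2 H) E) && Q H).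
    by apply: eq_bigr => H _; rewrite mapL.
  rewrite eqc; apply: leq_trans; rewrite leq_mul2l; apply/orP; right.
  by rewrite leq_exp2r //; lia.
rewrite /S -mulnA big_distrl /=; apply: leq_trans (leq_sum _ step) _.
rewrite sum_nat_const mulnA -cardsE card_draws card_ord bin_ffact mulnC leq_mul2l.
apply/orP; right; elim: (l) => [|k IH]; first by rewrite ffactn0.
by rewrite ffactnSr expnSr leq_mul // leq_subr.
Qed.

Lemma solvable_graph H (f : 'I_N -> bool) : ~~ dependent H ->
  exists a : nat * nat -> bool, forall i, a (edge1 H i) (+) a (edge2 H i) = f i.
Proof.
move=> /existsPn h; apply: solvable_of_even_free => E E0.
by have := h E; rewrite E0.
Qed.

End Graph.

End Counting.


(** * Independent repetitions *)

Section Repeat.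

Variables (P Y : finType).
Local Notation fam := {ffun P -> Y}.
Hypothesis Y_gt0 : 0 < #|Y|.

Lemma cnt_miss (r : Y -> nat) (v m : nat) (p : P) (Q : pred fam) :
  #|Y| <= #|[set y | r y == v]| * m -> (forall H y, Q (upd H p y) = Q H) ->
  m * cnt (fun H => (r (H p) != v) && Q H) <= m.-1 * cnt Q.
Proof.
move=> u iQ; rewrite -(leq_pmul2r Y_gt0) -!mulnA.
pose phi (H : fam) : nat := (r (H p) != v) && Q H.
have -> : cnt (fun H => (r (H p) != v) && Q H) * #|Y| = cnt Q * #|[set y | r y != v]|.
  rewrite (resample phi p) /cnt big_distrl; apply: eq_bigr => H _ /=.
  rewrite -sum1_card big_distrr [RHS]big_mkcond; apply: eq_bigr => y _ /=.
  by rewrite /phi ffunE eqxx iQ inE; case: (r y != v); case: (Q H).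
rewrite mulnCA [X in _ <= X]mulnCA leq_mul2l; apply/orP; right.
have := cardsC [set y | r y == v].
have -> : ~: [set y | r y == v] = [set y | r y != v] by apply/setP => y; rewrite !inE.
case: (m) u => [|k]; first by rewrite muln0; lia.
rewrite -pred_Sn; nia.
Qed.

(* Retrying with fresh seeds: seed [g] reads the hash values at [S g] only. *)
Lemma cnt_all (bad : nat -> pred fam) (S : nat -> pred P) a b G :
  (forall g Q, g < G -> (forall H p y, S g p -> Q (upd H p y) = Q H) ->
     a * cnt (fun H => bad g H && Q H) <= b * cnt Q) ->
  (forall g g' H p y, g' < g -> g < G -> S g p -> bad g' (upd H p y) = bad g' H) ->
  a ^ G * cnt (fun H => all (bad^~ H) (iota 0 G)) <= b ^ G * #|{: fam}|.
Proof.
move=> hb ib; suff h k : k <= G ->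
    a ^ k * cnt (fun H => all (bad^~ H) (iota 0 k)) <= b ^ k * #|{: fam}| by exact: h.
elim: k => [_|k IH kG].
  by rewrite !mul1n /cnt /= sum1_card.
rewrite -addn1 iotaD /= add0n addn1.
have -> : cnt (fun H => all (bad^~ H) (iota 0 k ++ [:: k])) =
          cnt (fun H => bad k H && all (bad^~ H) (iota 0 k)).
  by apply: eq_bigr => H _; rewrite all_cat /= andbT andbC.
have := hb k (fun H => all (bad^~ H) (iota 0 k)) kG.
have i0 : forall H p y, S k p -> all (bad^~ (upd H p y)) (iota 0 k) = all (bad^~ H) (iota 0 k).
  move=> H p y Sp; apply: eq_in_all => g; rewrite mem_iota => /andP[_ gk].
  exact: (ib k).
move=> /(_ i0) h; rewrite !expnSr -mulnA.
apply: leq_trans (leq_mul (leqnn _) h) _.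
by rewrite mulnCA [X in _ <= X]mulnAC [X in _ <= X]mulnC leq_mul2l IH ?orbT // ltnW.
Qed.

End Repeat.

(** * Structured programs on the word RAM *)

Inductive expr : Type :=
  | Var (r : nat)
  | Cst (c : nat)
  | Bin (o : binop) (a b : expr)
  | Arr (a : expr)
  | Idx (a : expr)
  | Hsh (a b : expr).

Inductive cmd : Type :=
  | Skip
  | Set_ (r : nat) (e : expr)
  | Seq (c1 c2 : cmd)
  | If (a b : expr) (c1 c2 : cmd)
  | Loop (c : cmd)
  | Halt (e : expr).

(* Code for [e]: the result goes to register [d], registers below [d] are kept. *)
Fixpoint cexpr (d : nat) (e : expr) : program :=
  match e with
  | Var r => [:: IOp OpOr d r r]
  | Cst c => [:: IConst d c]
  | Bin o a b => cexpr d a ++ cexpr d.+1 b ++ [:: IOp o d d d.+1]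
  | Arr a => cexpr d a ++ [:: IArray d d]
  | Idx a => cexpr d a ++ [:: IIndex d d]
  | Hsh a b => cexpr d a ++ cexpr d.+1 b ++ [:: IHash d d d.+1]
  end.

Fixpoint evars (n : nat) (e : expr) : bool :=
  match e with
  | Var r => r < n
  | Cst _ => true
  | Bin _ a b | Hsh a b => evars n a && evars n b
  | Arr a | Idx a => evars n a
  end.

Fixpoint cvars (n : nat) (c : cmd) : bool :=
  match c with
  | Skip => true
  | Set_ r e => (r < n) && evars n e
  | Seq a b => cvars n a && cvars n b
  | If a b c1 c2 => [&& evars n a, evars n b, cvars n c1 & cvars n c2]
  | Loop c => cvars n c
  | Halt e => evars n e
  end.

Section Compile.

Variable n : nat.

(* [p] is the address of the first instruction. *)
Fixpoint ccmd (p : nat) (c : cmd) : program :=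
  match c with
  | Skip => [::]
  | Set_ r e => cexpr n e ++ [:: IOp OpOr r n n]
  | Seq c1 c2 => let k1 := ccmd p c1 in k1 ++ ccmd (p + size k1) c2
  | If a b c1 c2 =>
      let t := cexpr n a ++ cexpr n.+1 b in
      let k2 := ccmd (p + size t).+1 c2 in
      let l1 := (p + size t).+1 + (size k2).+1 in
      let k1 := ccmd l1 c1 in
      t ++ IJumpLt n n.+1 l1 :: k2 ++ IJump (l1 + size k1) :: k1
  | Loop c => ccmd p c ++ [:: IJump p]
  | Halt e => cexpr n e ++ [:: IHalt n]
  end.

Definition compile (c : cmd) : program := ccmd 0 c.

Definition ecost (e : expr) := size (cexpr 0 e).

Lemma size_cexpr d e : size (cexpr d e) = ecost e.
Proof.
have h : forall e d d', size (cexpr d e) = size (cexpr d' e).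
  move=> {d e}; elim=> //= [o a IHa b IHb|a IHa|a IHa|a IHa b IHb] d d';
    by rewrite !size_cat (IHa d d') ?(IHb d.+1 d'.+1).
exact: h.
Qed.

Section Exec.

Variables (w : nat) (H : hash_family w) (arr : seq (word w)) (idx : bitseq).

Definition env := nat -> word w.
Definition setv (v : env) (r : nat) (x : word w) : env := fun q => if q == r then x else v q.

Fixpoint eval (v : env) (e : expr) : word w :=
  match e with
  | Var r => v r
  | Cst c => to_word w c
  | Bin o a b => eval_op o (eval v a) (eval v b)
  | Arr a => nth (to_word w 0) arr (eval v a)
  | Idx a => index_word idx (eval v a)
  | Hsh a b => H (eval v a, eval v b)
  end.

(** The only exit from a [Loop] is a [Halt] inside it, so a derivation for a loop contains a proof
    of termination together with its cost. *)
Inductive exec : cmd -> env -> nat -> env + word w -> Prop :=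
  | ExSkip v : exec Skip v 0 (inl v)
  | ExSet r e v : exec (Set_ r e) v (ecost e).+1 (inl (setv v r (eval v e)))
  | ExSeq c1 c2 v v' t1 t2 res : exec c1 v t1 (inl v') -> exec c2 v' t2 res ->
      exec (Seq c1 c2) v (t1 + t2) res
  | ExSeqHalt c1 c2 v t x : exec c1 v t (inr x) -> exec (Seq c1 c2) v t (inr x)
  | ExIf a b c1 c2 v t res :
      exec (if (eval v a < eval v b)%N then c1 else c2) v t res ->
      exec (If a b c1 c2) v (ecost a + ecost b + t).+2 res
  | ExLoop c v v' t t' res : exec c v t (inl v') -> exec (Loop c) v' t' res ->
      exec (Loop c) v (t + t').+1 res
  | ExLoopHalt c v t x : exec c v t (inr x) -> exec (Loop c) v t (inr x)
  | ExHalt e v : exec (Halt e) v (ecost e).+1 (inr (eval v e)).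

Variable P : program.
Local Notation run := (run P H arr idx).

Definition code_at p (k : program) :=
  forall i, i < size k -> nth (IHalt 0) P (p + i) = nth (IHalt 0) k i.

Lemma code_at_cat p k1 k2 : code_at p (k1 ++ k2) -> code_at p k1 /\ code_at (p + size k1) k2.
Proof.
move=> h; split=> i hi.
  by rewrite h ?nth_cat ?hi // size_cat ltn_addr.
by rewrite -addnA h ?size_cat ?ltn_add2l // nth_cat ltnNge leq_addr /= addKn.
Qed.

Lemma code_at_cons p i k : code_at p (i :: k) -> nth (IHalt 0) P p = i /\ code_at p.+1 k.
Proof.
move=> h; split; first by have := h 0 isT; rewrite addn0.
by move=> j hj; rewrite addSnnS h.
Qed.

Definition agree d (r v : env) := forall q, q < d -> r q = v q.

Lemma eval_agree d r v e : agree d r v -> evars d e -> eval r e = eval v e.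
Proof.
move=> ag; elim: e => //= [o a IHa b IHb|a IHa|a IHa|a IHa b IHb].
- by case/andP => /IHa-> /IHb->.
- by move/IHa->.
- by move/IHa->.
- by case/andP => /IHa-> /IHb->.
Qed.

Lemma evars_leq d d' e : d <= d' -> evars d e -> evars d' e.
Proof.
move=> le; elim: e => //= [q|o a IHa b IHb|a IHa b IHb]; first by move/leq_trans; apply.
  by case/andP => /IHa-> /IHb->.
by case/andP => /IHa-> /IHb->.
Qed.

Lemma run_cexpr e d p r m : code_at p (cexpr d e) -> evars d e ->
  exists2 r', agree d r' r /\ r' d = eval r e &
    forall k, run (ecost e + k) (State p r m) = run k (State (p + ecost e) r' m).
Proof.
(* A register is copied by taking its bitwise or with itself. *)
have or_id (x : word w) : to_word w (Nat.lor x x) = x.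
  by apply: val_inj; rewrite /= PeanoNat.Nat.lor_diag modn_small.
have setd (r0 : env) d0 x : agree d0 (setv r0 d0 x) r0.
  by move=> q; rewrite /setv; case: eqP => // ->; rewrite ltnn.
have agt d0 d1 r1 r2 r3 : d0 <= d1 -> agree d0 r2 r3 -> agree d1 r1 r2 -> agree d0 r1 r3.
  by move=> le h1 h2 q hq; rewrite h2 ?h1 // (leq_trans hq).
elim: e d p r => /= [q|c|o a IHa b IHb|a IHa|a IHa|a IHa b IHb] d p r.
- move=> /code_at_cons[h _] qd; exists (setv r d (r q)).
    by split; rewrite // /setv eqxx.
  by move=> k; rewrite /= /step /= h /= or_id addn1.
- move=> /code_at_cons[h _] _; exists (setv r d (to_word w c)).
    by split; rewrite // /setv eqxx.
  by move=> k; rewrite /= /step /= h /= addn1.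
- move=> /code_at_cat[ha /code_at_cat[hb /code_at_cons[h _]]] /andP[va vb].
  rewrite !size_cexpr in ha hb h.
  have [r1 [a1 e1] run1] := IHa d p r ha va.
  have [r2 [a2 e2] run2] := IHb d.+1 _ r1 hb (evars_leq (leqnSn d) vb).
  exists (setv r2 d (eval_op o (eval r a) (eval r b))).
    split; last by rewrite /setv eqxx.
    exact: (agt _ _ _ _ _ (leqnn d) (agt _ _ _ _ _ (leqnSn d) a1 a2) (setd _ _ _)).
  move=> k; rewrite /ecost /= !size_cat /= !size_cexpr -!addnA run1 run2 add1n /= /step /= h /=.
  by rewrite e2 (a2 d (leqnn _)) e1 (eval_agree a1 vb) !addnA addn1.
- move=> /code_at_cat[ha /code_at_cons[h _]] va; rewrite size_cexpr in ha h.
  have [r1 [a1 e1] run1] := IHa d p r ha va.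
  exists (setv r1 d (nth (to_word w 0) arr (eval r a))).
    split; last by rewrite /setv eqxx.
    exact: (agt _ _ _ _ _ (leqnn d) a1 (setd _ _ _)).
  by move=> k; rewrite /ecost /= size_cat /= size_cexpr -addnA run1 add1n /= /step /= h /= e1 addnA addn1.
- move=> /code_at_cat[ha /code_at_cons[h _]] va; rewrite size_cexpr in ha h.
  have [r1 [a1 e1] run1] := IHa d p r ha va.
  exists (setv r1 d (index_word idx (eval r a))).
    split; last by rewrite /setv eqxx.
    exact: (agt _ _ _ _ _ (leqnn d) a1 (setd _ _ _)).
  by move=> k; rewrite /ecost /= size_cat /= size_cexpr -addnA run1 add1n /= /step /= h /= e1 addnA addn1.
move=> /code_at_cat[ha /code_at_cat[hb /code_at_cons[h _]]] /andP[va vb].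
rewrite !size_cexpr in ha hb h.
have [r1 [a1 e1] run1] := IHa d p r ha va.
have [r2 [a2 e2] run2] := IHb d.+1 _ r1 hb (evars_leq (leqnSn d) vb).
exists (setv r2 d (H (eval r a, eval r b))).
  split; last by rewrite /setv eqxx.
  exact: (agt _ _ _ _ _ (leqnn d) (agt _ _ _ _ _ (leqnSn d) a1 a2) (setd _ _ _)).
move=> k; rewrite /ecost /= !size_cat /= !size_cexpr -!addnA run1 run2 add1n /= /step /= h /=.
by rewrite e2 (a2 d (leqnn _)) e1 (eval_agree a1 vb) !addnA addn1.
Qed.

(** The machine may take less than the time of [exec]: of the two extra units charged for an [If],
    one pays for the test and the other for the jump over the first branch, which only a completed
    second branch performs. *)
Lemma run_ccmd c v t res : exec c v t res -> cvars n c ->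
  forall p r m, code_at p (ccmd p c) -> agree n r v ->
  exists2 t', t' <= t &
    match res with
    | inl v' => exists2 r', agree n r' v' &
        forall k, run (t' + k) (State p r m) = run k (State (p + size (ccmd p c)) r' m)
    | inr x => forall k, run (t' + k) (State p r m) = Some x
    end.
Proof.
have or_id (x : word w) : to_word w (Nat.lor x x) = x.
  by apply: val_inj; rewrite /= PeanoNat.Nat.lor_diag modn_small.
elim=> {c v t res} /=.
- by move=> v _ p r m _ ag; exists 0 => //; exists r => // k; rewrite addn0.
- move=> q e v /andP[qn en] p r m /code_at_cat[h1 /code_at_cons[h2 _]] ag.
  have [r1 [a1 e1] run1] := run_cexpr r m h1 en.
  exists (ecost e).+1 => //; rewrite size_cexpr in h2.
  exists (setv r1 q (eval v e)).
    by move=> z zn; rewrite /setv; case: eqP => // _; rewrite a1 // ag.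
  move=> k; rewrite addSnnS run1 /= /step /= h2 /= or_id e1 (eval_agree ag en).
  by rewrite size_cat /= size_cexpr addn1 addnS.
- move=> c1 c2 v v' t1 t2 res _ IH1 _ IH2 /andP[n1 n2] p r m /code_at_cat[h1 h2] ag.
  have [t1' le1 [r1 ag1 run1]] := IH1 n1 p r m h1 ag.
  have [t2' le2 h] := IH2 n2 _ r1 m h2 ag1.
  exists (t1' + t2'); first exact: leq_add.
  case: res h {IH2} => [v''|x] => [[r2 ag2 run2]|run2].
    by exists r2 => // k; rewrite -addnA run1 run2 size_cat addnA.
  by move=> k; rewrite -addnA run1 run2.
- move=> c1 c2 v t x _ IH1 /andP[n1 n2] p r m /code_at_cat[h1 h2] ag.
  by have [t1' le1 run1] := IH1 n1 p r m h1 ag; exists t1'.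
- move=> a b c1 c2 v t res _ IH /and4P[na nb n1 n2] p r m.
  set l1 := _ + (size _).+1; rewrite -!catA /=.
  move=> /code_at_cat[ha /code_at_cat[hb /code_at_cons[hj /code_at_cat[h2 /code_at_cons[hj2 h1]]]]] ag.
  have [r1 [a1 e1] run1] := run_cexpr r m ha na.
  have [r2 [a2 e2] run2] := run_cexpr r1 m hb (evars_leq (leqnSn n) nb).
  rewrite !size_cexpr in hb hj h2 hj2 h1 run2.
  have ag2 : agree n r2 v.
    by move=> q qn; rewrite a2 ?(leq_trans qn) // a1 // ag.
  have jump k : run (ecost a + (ecost b + k.+1)) (State p r m) =
      run k (State (if (eval v a < eval v b)%N then l1 else (p + ecost a + ecost b).+1) r2 m).
    rewrite run1 run2 /= /step /= hj /= /goto /= e2 (a2 n (leqnn _)) e1.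
    by rewrite (eval_agree a1 nb) !(eval_agree ag) //.
  have l1E : (p + size (cexpr n a ++ cexpr n.+1 b)) = p + ecost a + ecost b.
    by rewrite size_cat !size_cexpr addnA.
  rewrite l1E in h2 hj2 h1 IH *.
  have l1E' : l1 = (p + ecost a + ecost b).+1 + (size (ccmd (p + ecost a + ecost b).+1 c2)).+1.
    by rewrite /l1 l1E.
  rewrite -[_.+1]addnS -l1E' in h1.
  case: ifP jump IH => _ jump IH.
    have [t' le h] := IH n1 l1 r2 m h1 ag2.
    exists (ecost a + (ecost b + t'.+1)); first lia.
    case: res h {IH} => [v'|x] => [[r3 ag3 run3]|run3].
      exists r3 => // k; rewrite -!addnA addSn jump run3; congr (run _ (State _ _ _)).
      by rewrite !size_cat /= !size_cat /= !size_cexpr {1}l1E' [p + (ecost a + ecost b)]addnA; lia.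
    by move=> k; rewrite -!addnA addSn jump run3.
  have [t' le h] := IH n2 (p + ecost a + ecost b).+1 r2 m h2 ag2.
  case: res h {IH} => [v'|x] => [[r3 ag3 run3]|run3].
    exists (ecost a + (ecost b + (t' + 1).+1)); first lia.
    exists r3 => // k; rewrite -!addnA addSn -!addnA jump run3 add1n /= /step /= hj2 /=.
    congr (run _ (State _ _ _)).
    by rewrite !size_cat /= !size_cat /= !size_cexpr {1}l1E' [p + (ecost a + ecost b)]addnA; lia.
  exists (ecost a + (ecost b + t'.+1)); first lia.
  by move=> k; rewrite -!addnA addSn jump run3.
- move=> c v v' t t' res _ IH1 _ IH2 nc p r m h ag.
  have [h1 /code_at_cons[h2 _]] := code_at_cat h.
  have [t1 le1 [r1 ag1 run1]] := IH1 nc p r m h1 ag.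
  have [t2 le2 h3] := IH2 nc p r1 m h ag1.
  have st k : run (t1 + k.+1) (State p r m) = run k (State p r1 m).
    by rewrite run1 /= /step /= h2.
  exists (t1 + t2.+1); first lia.
  case: res h3 {IH2} => [v''|x] => [[r2 ag2 run2]|run2].
    by exists r2 => // k; rewrite -addnA addSn st run2.
  by move=> k; rewrite -addnA addSn st run2.
- move=> c v t x _ IH1 nc p r m /code_at_cat[h1 _] ag.
  by have [t1 le1 run1] := IH1 nc p r m h1 ag; exists t1.
move=> e v en p r m /code_at_cat[h1 /code_at_cons[h2 _]] ag.
have [r1 [a1 e1] run1] := run_cexpr r m h1 en.
exists (ecost e).+1 => // k; rewrite size_cexpr in h2.
by rewrite addSnnS run1 /= /step /= h2 /= e1 (eval_agree ag en).
Qed.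

End Exec.
End Compile.

Fixpoint noloop (c : cmd) : bool :=
  match c with
  | Seq a b | If _ _ a b => noloop a && noloop b
  | Loop _ => false
  | _ => true
  end.

Fixpoint cmax (c : cmd) : nat :=
  match c with
  | Skip | Loop _ => 0
  | Set_ _ e | Halt e => (ecost e).+1
  | Seq a b => cmax a + cmax b
  | If a b c1 c2 => (ecost a + ecost b + maxn (cmax c1) (cmax c2)).+2
  end.

Section Sem.

Variables (w : nat) (H : hash_family w) (arr : seq (word w)) (idx : bitseq).
Local Notation eval := (eval H arr idx).
Local Notation exec := (exec H arr idx).

(** Meant for loop-free commands; the value on [Loop] is a placeholder that [noloop] excludes. *)
Fixpoint sem (c : cmd) (v : env w) : env w + word w :=
  match c with
  | Skip | Loop _ => inl v
  | Set_ r e => inl (setv v r (eval v e))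
  | Seq a b => match sem a v with inl v' => sem b v' | inr x => inr x end
  | If a b c1 c2 => if (eval v a < eval v b)%N then sem c1 v else sem c2 v
  | Halt e => inr (eval v e)
  end.

Lemma exec_sem c v : noloop c -> exists2 t, t <= cmax c & exec c v t (sem c v).
Proof.
elim: c v => //= [|r e|c1 IH1 c2 IH2|a b c1 IH1 c2 IH2|e] v.
- by move=> _; exists 0 => //; constructor.
- by move=> _; exists (ecost e).+1 => //; constructor.
- case/andP => n1 n2; have [t1 l1 x1] := IH1 v n1.
  case E: (sem c1 v) x1 => [v'|y] x1.
    have [t2 l2 x2] := IH2 v' n2; exists (t1 + t2); first exact: leq_add.
    exact: ExSeq x1 x2.
  by exists t1; [rewrite (leq_trans l1) // leq_addr | apply: ExSeqHalt].
- case/andP => n1 n2; case: ifP => E.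
    have [t l x] := IH1 v n1; exists (ecost a + ecost b + t).+2; first lia.
    by constructor; rewrite E.
  have [t l x] := IH2 v n2; exists (ecost a + ecost b + t).+2; first lia.
  by constructor; rewrite E.
by move=> _; exists (ecost e).+1 => //; constructor.
Qed.

End Sem.

(** * The sorted array *)

Section Array.

Variables (w : nat) (S : {set word w}).
Local Notation arr := (sorted_array S).

Definition elt i : nat := nth (to_word w 0) arr i.

Lemma size_arr : size arr = #|S|.
Proof. by rewrite size_sort cardE. Qed.

Lemma mem_arr y : (y \in arr) = (y \in S).
Proof. by rewrite mem_sort mem_enum. Qed.

Lemma elt_lt i j : i < j -> j < #|S| -> elt i < elt j.
Proof.
rewrite -size_arr => ij jn; have hi := ltn_trans ij jn.
rewrite ltn_neqAle; apply/andP; split.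
  apply: contraTneq ij => /val_inj/eqP.
  by rewrite nth_uniq ?sort_uniq ?enum_uniq // => /eqP->; rewrite ltnn.
have tot : total (fun a b : word w => (a <= b)%N) by move=> a b; apply: leq_total.
have tr : transitive (fun a b : word w => (a <= b)%N) by move=> a b c; apply: leq_trans.
have rf : reflexive (fun a b : word w => (a <= b)%N) by move=> a; apply: leqnn.
apply: (sorted_leq_nth tr rf (to_word w 0) (sort_sorted tot _)) => //.
- exact: ltnW.
Qed.

Lemma elt_bound i : elt i < 2 ^ w.
Proof. exact: ltn_ord. Qed.

Lemma elt_default i : #|S| <= i -> elt i = 0.
Proof. by rewrite -size_arr => h; rewrite /elt nth_default //= mod0n. Qed.

Lemma elt_mem i : i < #|S| -> nth (to_word w 0) arr i \in S.
Proof. by rewrite -mem_arr -size_arr; apply: mem_nth. Qed.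

Lemma eltP y : y \in S -> exists2 i, i < #|S| & elt i = y.
Proof.
rewrite -mem_arr => yS; exists (index y arr); first by rewrite -size_arr index_mem.
by rewrite /elt nth_index.
Qed.

Lemma elt_le i j : i <= j -> j < #|S| -> elt i <= elt j.
Proof. by rewrite leq_eqVlt => /orP[/eqP->//|ij jn]; apply/ltnW/elt_lt. Qed.

Variable x : word w.

Lemma pred_of_some c : c < #|S| -> elt c < x -> (c.+1 < #|S| -> x <= elt c.+1) ->
  pred_of S x = Some (nth (to_word w 0) arr c).
Proof.
move=> cn cx xc; rewrite /pred_of; case: pickP => [y /and3P[yS yx /forallP h]|/(_ (nth (to_word w 0) arr c))].
  congr Some; have [i hi iy] := eltP yS; apply: val_inj.
  have := h (nth (to_word w 0) arr c); rewrite elt_mem //= cx /= -/(elt c) => le.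
  apply/eqP; rewrite eqn_leq le andbT -iy.
  case: (leqP i c) => ic; first exact: elt_le.
  have := xc (leq_ltn_trans ic hi); have := elt_le ic hi; rewrite iy; lia.
rewrite elt_mem // cx /= => /negP[]; apply/forallP => z; apply/implyP => zS; apply/implyP => zx.
have [i hi e] := eltP zS; case: (leqP i c) => ic; first by rewrite -e; apply: elt_le.
have := xc (leq_ltn_trans ic hi); have := elt_le ic hi; rewrite e; lia.
Qed.

Lemma pred_of_none : 0 < #|S| -> x <= elt 0 -> pred_of S x = None.
Proof.
move=> n0 x0; rewrite /pred_of; case: pickP => // y /and3P[yS yx _].
by have [i hi e] := eltP yS; have := elt_le (leq0n i) hi; rewrite e; lia.
Qed.

Lemma succ_of_some c : c < #|S| -> x <= elt c -> (forall i, i < c -> elt i < x) ->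
  succ_of S x = Some (nth (to_word w 0) arr c).
Proof.
move=> cn xc lt; rewrite /succ_of.
have min_c z : z \in S -> x <= z -> elt c <= z.
  move=> zS xz; have [i hi e] := eltP zS; rewrite -e.
  by case: (leqP c i) => ic; [exact: elt_le | have := lt i ic; rewrite e ltnNge xz].
case: pickP => [y /and3P[yS xy /forallP h]|/(_ (nth (to_word w 0) arr c))].
  congr Some; apply: val_inj; apply/eqP; rewrite eqn_leq [X in _ && X](min_c y) // andbT.
  by have := h (nth (to_word w 0) arr c); rewrite elt_mem //= xc.
rewrite elt_mem // xc /= => /negP[]; apply/forallP => z; apply/implyP => zS.
by apply/implyP; apply: min_c.
Qed.

Lemma pred_index_between c : c.+1 < #|S| -> elt c < x -> x <= elt c.+1 -> c < 2 ^ w ->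
  is_pred_index S x (to_word w c) /\ dist_min S x = minn (elt c.+1 - x) (x - elt c).
Proof.
move=> cn cx xc cw; have cn' := ltnW cn.
have e1 := pred_of_some cn' cx (fun=> xc).
have e2 : succ_of S x = Some (nth (to_word w 0) arr c.+1).
  apply: succ_of_some => // i ic; apply: leq_ltn_trans cx; exact: elt_le.
by rewrite /is_pred_index /dist_min e1 e2 /= modn_small.
Qed.

Lemma pred_index_first : 0 < #|S| -> x <= elt 0 ->
  is_pred_index S x (to_word w (2 ^ w).-1).
Proof. by move=> n0 x0; rewrite /is_pred_index pred_of_none. Qed.

Lemma pred_index_last i : i < 2 ^ w -> i.+1 = #|S| -> elt i < x ->
  is_pred_index S x (to_word w i).
Proof.
move=> iw e ix; have hi : i < #|S| by rewrite -e.
rewrite /is_pred_index (pred_of_some hi ix) /=; last by rewrite -e ltnn.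
by rewrite modn_small.
Qed.

End Array.


(** * The query program *)

Section WordOps.

Variable w : nat.
Implicit Types a b : word w.

Lemma word_add a b : a + b < 2 ^ w -> eval_op OpAdd a b = a + b :> nat.
Proof. exact: modn_small. Qed.

Lemma word_sub a b : b <= a -> eval_op OpSub a b = a - b :> nat.
Proof.
move=> le; rewrite /= addnBA ?(ltnW (ltn_ord b)) // addnC -addnBA // modnDl modn_small //.
by rewrite (leq_ltn_trans (leq_subr _ _)).
Qed.

Lemma word_mul a b : a * b < 2 ^ w -> eval_op OpMul a b = a * b :> nat.
Proof. exact: modn_small. Qed.

Lemma word_shl a b : a * 2 ^ b < 2 ^ w -> eval_op OpShl a b = a * 2 ^ b :> nat.
Proof. exact: modn_small. Qed.

Lemma word_shr a b : eval_op OpShr a b = a %/ 2 ^ b :> nat.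
Proof. by rewrite /= modn_small // (leq_ltn_trans (leq_div _ _)). Qed.

Lemma word_and a b : eval_op OpAnd a b = Nat.land a b :> nat.
Proof. by rewrite /= modn_small // (leq_ltn_trans (land_le _ _)). Qed.

Lemma word_xor a b : eval_op OpXor a b = Nat.lxor a b :> nat.
Proof. by rewrite /= modn_small // lxor_small. Qed.

Lemma to_word_val c : c < 2 ^ w -> to_word w c = c :> nat.
Proof. exact: modn_small. Qed.

Lemma word_and_ones a b k : b = 2 ^ k - 1 :> nat -> eval_op OpAnd a b = a %% 2 ^ k :> nat.
Proof. by move=> e; rewrite word_and e land_ones. Qed.

End WordOps.

(* Register 2 holds [w]; registers 5 to 13 hold masks and offsets read from the
   header, registers 14 and up are scratch. *)
Definition vX := Var 0.
Definition vN1 := Var 1.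
Definition vT := Var 3.
Definition vD := Var 4.
Definition vA := Var 5.
Definition vWm := Var 6.
Definition vSm1 := Var 7.
Definition vSm0 := Var 8.
Definition vR0 := Var 9.
Definition vWm2 := Var 10.
Definition vVm2 := Var 11.
Definition vOff1 := Var 12.
Definition vOff0 := Var 13.

(** Every level owns sixteen consecutive hash functions, applied to the prefix. The three tables use
    the tags 0 to 3, 4 to 7 and 8 to 11. *)
Definition hash_at (lev q : expr) (k : nat) : expr :=
  Hsh (Bin OpAdd (Bin OpAdd vA (Bin OpMul lev (Cst 16))) (Cst k)) q.

(** The shift brings the cell to the low end of the word and leaves unrelated bits above it; they
    are masked away after the exclusive or of the two halves. *)
Definition half (base off r wm sm lev q : expr) (tag : nat) : expr :=
  Bin OpShr (Idx (Bin OpAdd base (Bin OpAnd (hash_at lev q tag) wm)))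
            (Bin OpAdd off (Bin OpMul (Bin OpAnd (hash_at lev q tag.+1) sm) r)).

Definition look (base off r wm sm lev q : expr) (tag : nat) : expr :=
  Bin OpXor (half base off r wm sm lev q tag) (half base off r wm sm lev q tag.+2).

Definition look0 lev q :=
  Bin OpAnd (look (Cst 0) vOff0 vR0 vWm vSm0 lev q 0)
            (Bin OpSub (Bin OpShl (Cst 1) vR0) (Cst 1)).
Definition look1 lev q :=
  look (Cst 0) vOff1 (Bin OpMul vD (Cst 6)) vWm vSm1 lev q 4.
Definition look2 lev q :=
  Bin OpAnd (look (Bin OpAdd vWm (Cst 1)) (Cst 0) (Cst 0) vWm2 (Cst 0) lev q 8) vVm2.

Definition field (e : expr) (k : nat) : expr :=
  Bin OpAnd (Bin OpShr e (Bin OpMul vD (Cst k))) (Bin OpSub vT (Cst 1)).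

(** Registers 16 and 17 hold the handle and prefix of a node, register 18 its packed fields. Field
    [j.*2] is the distance up to the handle of the bucket, field [j.*2.+1] the number of the gap
    inside the bucket. *)
Definition cand_expr (j : nat) : expr :=
  Bin OpAdd
    (Bin OpShl (look2 (Bin OpAdd (Var 16) (field (Var 18) j.*2))
                      (Bin OpShr (Var 17) (field (Var 18) j.*2))) vD)
    (field (Var 18) j.*2.+1).

Definition test (e : expr) : cmd :=
  Seq (Set_ 19 e)
      (If (Arr (Var 19)) vX
          (If (Arr (Bin OpAdd (Var 19) (Cst 1))) vX Skip (Halt (Var 19)))
          Skip).

(** The splitting gap is tested last, so that register 19 still holds it when [steer] is entered. *)
Definition look_node : cmd :=
  Seq (Set_ 18 (look1 (Var 16) (Var 17)))
      (Seq (test (cand_expr 0)) (Seq (test (cand_expr 2)) (test (cand_expr 1)))).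

Definition probe : cmd :=
  Seq (Set_ 16 (Bin OpShl (Cst 1) (look0 (Var 14) (Var 17))))
      (Seq (Set_ 17 (Bin OpShr (Var 17) (Bin OpSub (Var 16) (Var 14)))) look_node).

(** The gap in register 19 is validated against the array before it is trusted, since a lookup
    outside the keys may return anything. Register 24 receives the verdict and register 25 the
    [gapx] of the gap. *)
Definition steer (g : expr) : cmd :=
  Seq (Set_ 24 (Cst 0))
  (If (Var 19) vN1
    (Seq (Set_ 25 (Bin OpXor (Arr (Var 19)) (Arr (Bin OpAdd (Var 19) (Cst 1)))))
    (If (Bin OpShr (Var 25) g) (Cst 1)
      (If (Bin OpAnd (Bin OpXor vX (Arr (Var 19)))
                     (Bin OpXor vX (Arr (Bin OpAdd (Var 19) (Cst 1)))))
          (Var 25) (Set_ 24 (Cst 1)) Skip)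
      Skip))
    Skip).

(** Registers 20, 21 and 22 hold [gapx] of the upper gap, the lower level and the exponent of the
    step. Whether the next multiple lies below [gaplen] of the upper gap is decided by shifting its
    [gapx]. *)
Definition inner_body : cmd :=
  Seq (Set_ 22 (Bin OpSub (Var 22) (Cst 1)))
  (Seq (Set_ 16 (Bin OpShl (Bin OpAdd (Bin OpShr (Var 21) (Var 22)) (Cst 1)) (Var 22)))
  (If (Cst 0) (Bin OpShr (Var 20) (Var 16))
    (Seq (Set_ 17 (Bin OpShr vX (Var 16)))
    (Seq look_node
    (Seq (steer (Var 16))
         (If (Cst 0) (Var 24) (Set_ 20 (Var 25)) (Set_ 21 (Var 16))))))
    Skip)).

(* At the level [t = 2 ^ 2 ^ k] held by register 14, the block of [x] and its two
   neighbours are probed; if one of them is occupied, a fat binary search over the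
   levels below finds the predecessor in [2 ^ k] further steps. *)
Definition outer_body1 : cmd :=
  Seq (Set_ 17 (Bin OpShr vX (Var 14))) (Seq probe (steer (Var 14))).

Definition outer_body2 : cmd :=
  Seq (Set_ 20 (Var 25)) (Seq (Set_ 21 (Cst 0)) (Set_ 22 (Var 15))).

Definition outer_body3 : cmd :=
  Seq (Set_ 17 (Bin OpSub (Bin OpShr vX (Var 14)) (Cst 1)))
  (Seq probe
  (Seq (Set_ 17 (Bin OpAdd (Bin OpShr vX (Var 14)) (Cst 1)))
  (Seq probe
  (Seq (Set_ 14 (Bin OpMul (Var 14) (Var 14)))
       (Set_ 15 (Bin OpAdd (Var 15) (Var 15))))))).

Definition outer_body : cmd :=
  Seq outer_body1
  (Seq (If (Cst 0) (Var 24) (Seq outer_body2 (Loop inner_body)) Skip) outer_body3).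

(** The usual isolation of the lowest set bit; in the header this bit is [T]. *)
Lemma lxor_pred h d : h %% 2 ^ d.+1 = 2 ^ d -> Nat.lxor h h.-1 = 2 ^ d.+1 - 1.
Proof.
move=> e; have p : 0 < 2 ^ d by rewrite expn_gt0.
have hE := divn_eq h (2 ^ d.+1); rewrite e in hE.
set u := h %/ _ in hE.
have predE : h.-1 = u * 2 ^ d.+1 + (2 ^ d - 1) by rewrite hE; lia.
have low r : r < 2 ^ d.+1 -> (u * 2 ^ d.+1 + r) %% 2 ^ d.+1 = r.
  by move=> lt; rewrite modnMDl modn_small.
have lt1 : 2 ^ d - 1 < 2 ^ d.+1 by rewrite expnS; lia.
have m1 : h.-1 %% 2 ^ d.+1 = 2 ^ d - 1 by rewrite predE low.
have pow i : bit (2 ^ d) i = (i == d).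
  rewrite bitE; case: (ltngtP i d) => [lt|gt|->]; last by rewrite divnn p.
    by rewrite -(subnK (ltnW lt)) expnD mulnK ?expn_gt0 // -(prednK (_ : 0 < d - i)) ?subn_gt0 // expnS oddM.
  by rewrite divn_small // ltn_exp2l.
apply: bits_inj => i; rewrite bit_ones bit_xor.
case: (ltnP i d.+1) => id'; last first.
  rewrite -bit_xor; apply: (@bit_small _ d.+1) => //; rewrite lxor_lt predE [h in h %/ _]hE.
  by rewrite !divnMDl ?expn_gt0 // !divn_small // ltn_exp2l.
have b1 : bit h i = (i == d).
  by have := bit_modn h d.+1 i; rewrite id' e pow.
have b2 : bit h.-1 i = (i < d).
  by have := bit_modn h.-1 d.+1 i; rewrite id' m1 bit_ones.
by rewrite b1 b2; case: (ltngtP i d) => // gt; move: id'; rewrite ltnS leqNgt gt.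
Qed.

Definition pack (T : nat) (l : seq nat) := foldr (fun a b => a + T * b) 0 l.

Lemma pack_lt T l : all (fun a => a < T) l -> pack T l < T ^ size l.
Proof.
elim: l => //= a l IH /andP[aT /IH lt]; rewrite expnS.
apply: (@leq_trans (T * (pack T l).+1)); last by rewrite leq_mul2l lt orbT.
by rewrite mulnS ltn_add2r.
Qed.

Lemma pack_digit T l k : all (fun a => a < T) l -> k < size l ->
  (pack T l %/ T ^ k) %% T = nth 0 l k.
Proof.
elim: l k => // a l IH [|k] /= /andP[aT lT] kl.
  by rewrite expn0 divn1 mulnC addnC modnMDl modn_small.
have T0 : 0 < T by apply: leq_ltn_trans aT.
rewrite expnS divnMA.
have -> : (a + T * pack T l) %/ T = pack T l.
  by rewrite addnC mulnC divnMDl // divn_small // addn0.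
exact: IH.
Qed.

Lemma div_mod_field h N D k m V : 0 < D -> k + m <= N -> h %% 2 ^ (N * D) = V ->
  (h %/ 2 ^ (k * D)) %% 2 ^ (m * D) = (V %/ 2 ^ (k * D)) %% 2 ^ (m * D).
Proof.
move=> D0 kmN <-; have le1 : k * D <= N * D by rewrite leq_mul2r (leq_trans (leq_addr m k)) ?orbT.
rewrite modn_expn_divn // modn_dvdm //.
by apply: dvdn_exp2l; rewrite -mulnBl leq_mul2r; apply/orP; right; lia.
Qed.

Definition set_all (l : seq (nat * expr)) : cmd :=
  foldr (fun re c => Seq (Set_ re.1 re.2) c) Skip l.

Definition eX := Bin OpXor (Var 23) (Bin OpSub (Var 23) (Cst 1)).
Definition eT := Bin OpAdd (Bin OpShr eX (Cst 1)) (Cst 1).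
Definition vTT := Bin OpMul vT vT.
Definition v2T4 := Bin OpMul (Cst 2) (Bin OpMul vTT vTT).
Definition eD := Bin OpAnd (Hsh (Bin OpAnd (Var 23) (Bin OpSub v2T4 (Cst 1))) (Cst 0))
  (Bin OpSub vT (Cst 1)).
Definition eG := Bin OpAnd (Bin OpShr (Var 23) (Bin OpMul vD (Cst 5))) (Bin OpSub vTT (Cst 1)).
Definition ones (k : nat) := Bin OpSub (Bin OpShl (Cst 1) (field (Var 23) k)) (Cst 1).
Definition eS := Bin OpMul (Bin OpAdd vSm1 (Cst 1)) (Bin OpMul vD (Cst 6)).
Definition eO := Bin OpAdd vOff1 eS.

(** Register 11 becomes the negative of the flag, a mask of ones or zeros: without a bucket table
    [look2] then yields bucket 0 and the program does not branch. *)
Definition setup : cmd := set_all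
  [:: (23, Idx (Cst 0));
      (3, eT);
      (4, eD);
      (5, Bin OpMul (Bin OpMul (Cst 32) eG) vT);
      (6, ones 7);
      (7, ones 8);
      (8, ones 9);
      (9, field (Var 23) 11);
      (10, ones 10);
      (11, Bin OpSub (Cst 0) (field (Var 23) 12));
      (12, Bin OpMul vD (Cst 13));
      (13, eO);
      (14, Cst 2);
      (15, Cst 1)].

Arguments eval : simpl never.
Arguments sem : simpl never.

Section Query.

Variables (w : nat) (S : {set word w}) (H : hash_family w) (idx : bitseq).
Local Notation n := #|S|.
Local Notation s := (elt S).
Local Notation arr := (sorted_array S).
Local Notation eval := (eval H arr idx).
Local Notation sem := (sem H arr idx).
Local Notation exec := (exec H arr idx).

Variables (K D T e1 e2 e3 e4 g2 : nat) (fl : bool).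
Hypothesis DE : D = 2 ^ K.
Hypothesis TE : T = 2 ^ D.
Local Notation r0 := K.+1.
Local Notation A := (32 * T * g2).
Local Notation off1 := (13 * D).
Local Notation off0 := (off1 + 2 ^ e2 * (6 * D)).

Hypothesis w_T : w <= T.
Hypothesis cap_w : off0 + 2 ^ e3 * r0 <= w.
Hypothesis cap_a : A + 16 * T + 16 <= 2 ^ w.
Hypothesis cap_i : 2 ^ e1 + 2 ^ e4 < 2 ^ w.
Hypothesis cap_T4 : 2 * T ^ 4 < 2 ^ w.

Definition word_at j := \sum_(k < w) nth false idx (j * w + k) * 2 ^ k.
Definition hval k lev q : nat := H (to_word w (A + lev * 16 + k), to_word w q).
Definition halfN base off r e e' lev q tag :=
  word_at (base + hval tag lev q %% 2 ^ e) %/ 2 ^ (off + hval tag.+1 lev q %% 2 ^ e' * r).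
Definition lookN base off r e e' lev q tag :=
  Nat.lxor (halfN base off r e e' lev q tag) (halfN base off r e e' lev q tag.+2).

Definition vmask2 := if fl then 2 ^ w - 1 else 0.

Definition pvals := [:: n.-1; w; T; D; A; 2 ^ e1 - 1; 2 ^ e2 - 1; 2 ^ e3 - 1; r0;
  2 ^ e4 - 1; vmask2; off1; off0].

Variable x : word w.

Definition params (v : env w) :=
  v 0 = x /\ forall i, i < 13 -> v i.+1 = nth 0 pvals i :> nat.

Lemma params_set v r y : 14 <= r -> params v -> params (setv v r y).
Proof.
move=> hr [h0 h]; split; first by rewrite /setv; case: eqP hr => // <-.
by move=> i hi; rewrite /setv; case: eqP hr => [<-|_ _]; [lia|exact: h].
Qed.

Lemma w_lt : w < 2 ^ w. Proof. exact: ltn_expl. Qed.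

Lemma T_gt0 : 0 < T. Proof. by rewrite TE expn_gt0. Qed.

Lemma cap_T : 2 * T ^ 2 < 2 ^ w.
Proof. by apply: leq_ltn_trans cap_T4; rewrite leq_mul2l leq_pexp2l // T_gt0. Qed.

Lemma T_lt : T < 2 ^ w.
Proof.
apply: leq_trans cap_T; rewrite ltnS expnS expn1 mulnA.
by rewrite leq_pmull // muln_gt0 T_gt0.
Qed.

Lemma D_gt0 : 0 < D. Proof. by rewrite DE expn_gt0. Qed.

Lemma eval_hash_at v lev q k lev' : params v -> eval v lev = lev' :> nat -> lev' <= T -> k < 16 ->
  eval v (hash_at lev q k) = hval k lev' (eval v q) :> nat.
Proof.
move=> [_ h] el le lt; congr (nat_of_ord (H _)); congr (_, _); last first.
  by apply: val_inj; rewrite /= modn_small.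
have eA : v 5 = A :> nat := h 4 isT.
have l16 : 16 < 2 ^ w by lia.
apply: val_inj; rewrite [RHS]/= modn_small; last lia.
have e16 : eval v (Cst 16) = 16 :> nat by apply: to_word_val.
have ek : eval v (Cst k) = k :> nat by apply: to_word_val; lia.
have em : eval v (Bin OpMul lev (Cst 16)) = lev' * 16 :> nat.
  by rewrite -el -[in RHS]e16; apply: word_mul; rewrite [X in _ * X]e16 el; lia.
have ea : eval v (Bin OpAdd vA (Bin OpMul lev (Cst 16))) = A + lev' * 16 :> nat.
  by rewrite -eA -em; apply: word_add; rewrite [X in _ + X]em [X in X + _]eA; lia.
by rewrite -ea -[in RHS]ek; apply: word_add; rewrite [X in _ + X]ek [X in X + _]ea; lia.
Qed.

Lemma eval_half v base off r wm sm lev q tag base' off' r' e e' lev' :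
  params v -> eval v lev = lev' :> nat -> lev' <= T -> tag < 15 ->
  eval v base = base' :> nat -> eval v off = off' :> nat -> eval v r = r' :> nat ->
  eval v wm = 2 ^ e - 1 :> nat -> eval v sm = 2 ^ e' - 1 :> nat ->
  base' + 2 ^ e <= 2 ^ w -> off' + 2 ^ e' * r' < 2 ^ w ->
  eval v (half base off r wm sm lev q tag) =
  halfN base' off' r' e e' lev' (eval v q) tag :> nat.
Proof.
move=> hp el le lt eb eo er ew es hb ho.
have h1 : eval v (Bin OpAnd (hash_at lev q tag) wm) = hval tag lev' (eval v q) %% 2 ^ e :> nat.
  by rewrite -(@eval_hash_at v lev q tag lev') //; [apply: word_and_ones | lia].
have h2 : eval v (Bin OpAnd (hash_at lev q tag.+1) sm) = hval tag.+1 lev' (eval v q) %% 2 ^ e' :> nat.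
  by rewrite -(@eval_hash_at v lev q tag.+1 lev') //; apply: word_and_ones.
have l1 : hval tag lev' (eval v q) %% 2 ^ e < 2 ^ e by rewrite ltn_mod expn_gt0.
have l2 : hval tag.+1 lev' (eval v q) %% 2 ^ e' < 2 ^ e' by rewrite ltn_mod expn_gt0.
set a1 := hval tag lev' _ %% _ in h1 l1; set a2 := hval tag.+1 lev' _ %% _ in h2 l2.
have l3 : off' + a2 * r' < 2 ^ w.
  by apply: leq_ltn_trans ho; rewrite leq_add2l leq_mul2r ltnW ?orbT.
have h3 : eval v (Bin OpMul (Bin OpAnd (hash_at lev q tag.+1) sm) r) = a2 * r' :> nat.
  by rewrite -h2 -er; apply: word_mul; rewrite [X in X * _]h2 [X in _ * X]er; lia.
have h4 : eval v (Bin OpAdd off (Bin OpMul (Bin OpAnd (hash_at lev q tag.+1) sm) r)) = off' + a2 * r' :> nat.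
  by rewrite -h3 -eo; apply: word_add; rewrite [X in X + _]eo [X in _ + X]h3.
have h5 : eval v (Bin OpAdd base (Bin OpAnd (hash_at lev q tag) wm)) = base' + a1 :> nat.
  by rewrite -h1 -eb; apply: word_add; rewrite [X in X + _]eb [X in _ + X]h1; lia.
rewrite /half [LHS]word_shr [X in _ %/ 2 ^ X]h4 /halfN -/a1 -/a2; congr (_ %/ _).
have -> : word_at (base' + a1) = index_word idx (eval v (Bin OpAdd base (Bin OpAnd (hash_at lev q tag) wm))) :> nat.
  rewrite /index_word to_word_val ?(@sum_bits_lt w (fun k => nth false idx (_ + k))) //.
  by rewrite /word_at h5.
by [].
Qed.

Lemma eval_look v base off r wm sm lev q tag base' off' r' e e' lev' :
  params v -> eval v lev = lev' :> nat -> lev' <= T -> tag < 12 ->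
  eval v base = base' :> nat -> eval v off = off' :> nat -> eval v r = r' :> nat ->
  eval v wm = 2 ^ e - 1 :> nat -> eval v sm = 2 ^ e' - 1 :> nat ->
  base' + 2 ^ e <= 2 ^ w -> off' + 2 ^ e' * r' < 2 ^ w ->
  eval v (look base off r wm sm lev q tag) =
  lookN base' off' r' e e' lev' (eval v q) tag :> nat.
Proof.
move=> hp el le lt eb eo er ew es hb ho.
rewrite /look [LHS]word_xor /lookN.
by rewrite -!(eval_half q hp el le _ eb eo er ew es hb ho) //; lia.
Qed.

Definition look0N t q := lookN 0 off0 r0 e1 e3 t q 0 %% 2 ^ r0.
Definition look1N f q := lookN 0 off1 (6 * D) e1 e2 f q 4.
Definition look2N h q := Nat.land (lookN (2 ^ e1) 0 0 e4 0 h q 8) vmask2.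

Lemma r0_lt : r0 < w.
Proof.
apply: leq_trans cap_w; rewrite -addn1 addnC leq_add //.
  by rewrite (leq_trans _ (leq_addr _ _)) // muln_gt0 D_gt0.
by rewrite leq_pmull // expn_gt0.
Qed.

Lemma off_lt : off0 + 2 ^ e3 * r0 < 2 ^ w.
Proof. exact: leq_ltn_trans cap_w w_lt. Qed.

Lemma eval_look0 v t q t' : params v -> eval v t = t' :> nat -> t' <= T ->
  eval v (look0 t q) = look0N t' (eval v q) :> nat.
Proof.
move=> hp et le; have [_ h] := hp.
have e9 : eval v vR0 = r0 :> nat := h 8 isT.
have eone : eval v (Bin OpShl (Cst 1) vR0) = 2 ^ r0 :> nat.
  have e1' : eval v (Cst 1) = 1 :> nat by apply: to_word_val; have := w_lt; have := r0_lt; lia.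
  have := @word_shl w (eval v (Cst 1)) (eval v vR0); rewrite [X in X * _]e1' mul1n e9.
  by move=> -> //; rewrite ltn_exp2l // r0_lt.
have z : eval v (Cst 0) = 0 :> nat by apply: to_word_val; rewrite expn_gt0.
have e13 : eval v vOff0 = off0 :> nat := h 12 isT.
have e6 : eval v vWm = 2 ^ e1 - 1 :> nat := h 5 isT.
have e8 : eval v vSm0 = 2 ^ e3 - 1 :> nat := h 7 isT.
have c1 : 0 + 2 ^ e1 <= 2 ^ w by have := cap_i; lia.
rewrite /look0 [LHS](@word_and_ones _ _ _ r0).
  by rewrite [X in X %% _](eval_look q hp et le (isT : 0 < 12) z e13 e9 e6 e8 c1 off_lt).
rewrite [LHS]word_sub eone.
  by congr (_ - _); apply: to_word_val; have := w_lt; have := r0_lt; lia.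
by rewrite to_word_val ?expn_gt0 //; have := w_lt; have := r0_lt; lia.
Qed.

Lemma six_lt k : k <= 13 -> k * D < 2 ^ w.
Proof.
move=> hk; apply: leq_ltn_trans off_lt.
by do 2!apply: leq_trans (leq_addr _ _); rewrite leq_mul2r hk orbT.
Qed.

Lemma eval_mulD (v : env w) k : v 4 = D :> nat -> k <= 13 -> eval v (Bin OpMul vD (Cst k)) = k * D :> nat.
Proof.
move=> e4' hk.
have ek : eval v (Cst k) = k :> nat.
  by apply: to_word_val; apply: leq_ltn_trans (six_lt hk); rewrite leq_pmulr ?D_gt0.
rewrite mulnC -e4' -[in RHS]ek; apply: word_mul; rewrite [X in _ * X]ek [X in X * _]e4' mulnC.
exact: six_lt.
Qed.

Lemma eval_look1 v f q f' : params v -> eval v f = f' :> nat -> f' <= T ->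
  eval v (look1 f q) = look1N f' (eval v q) :> nat.
Proof.
move=> hp ef le; have [_ h] := hp.
have z : eval v (Cst 0) = 0 :> nat by apply: to_word_val; rewrite expn_gt0.
have e12 : eval v vOff1 = off1 :> nat := h 11 isT.
have e6 : eval v vWm = 2 ^ e1 - 1 :> nat := h 5 isT.
have e7 : eval v vSm1 = 2 ^ e2 - 1 :> nat := h 6 isT.
have c1 : 0 + 2 ^ e1 <= 2 ^ w by have := cap_i; lia.
have c2 : off1 + 2 ^ e2 * (6 * D) < 2 ^ w.
  by apply: leq_ltn_trans off_lt; rewrite leq_addr.
exact: (eval_look q hp ef le (isT : 4 < 12) z e12 (eval_mulD (h 3 isT) (isT : 6 <= 13)) e6 e7 c1 c2).
Qed.

Lemma eval_look2 v f q f' : params v -> eval v f = f' :> nat -> f' <= T ->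
  eval v (look2 f q) = look2N f' (eval v q) :> nat.
Proof.
move=> hp ef le; have [_ h] := hp.
have z : eval v (Cst 0) = 0 :> nat by apply: to_word_val; rewrite expn_gt0.
have e6 : eval v vWm = 2 ^ e1 - 1 :> nat := h 5 isT.
have e10 : eval v vWm2 = 2 ^ e4 - 1 :> nat := h 9 isT.
have e11 : eval v vVm2 = vmask2 :> nat := h 10 isT.
have ez : eval v (Cst 0) = 2 ^ 0 - 1 :> nat by rewrite z.
have eb : eval v (Bin OpAdd vWm (Cst 1)) = 2 ^ e1 :> nat.
  have eo : eval v (Cst 1) = 1 :> nat by apply: to_word_val; have := cap_i; lia.
  have p := expn_gt0 2 e1.
  rewrite [LHS]word_add; rewrite [X in X + _]e6 [X in _ + X]eo; have := cap_i; lia.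
have c1 : 2 ^ e1 + 2 ^ e4 <= 2 ^ w := ltnW cap_i.
have c2 : 0 + 2 ^ 0 * 0 < 2 ^ w by rewrite muln0 expn_gt0.
rewrite /look2 [LHS]word_and /look2N [X in Nat.land _ X]e11.
by rewrite [X in Nat.land X _](eval_look q hp ef le (isT : 8 < 12) eb z z e10 ez c1 c2).
Qed.

Lemma eval_field (v : env w) e k : v 3 = T :> nat -> v 4 = D :> nat -> k <= 13 ->
  eval v (field e k) = (eval v e %/ 2 ^ (k * D)) %% T :> nat.
Proof.
move=> e3' e4' hk.
rewrite /field [LHS](@word_and_ones _ _ _ D).
  by rewrite -TE [X in X %% _]word_shr [X in _ %/ 2 ^ X]eval_mulD.
have eo : eval v (Cst 1) = 1 :> nat by apply: to_word_val; have := cap_i; lia.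
have eT : eval v vT = T :> nat := e3'.
have := @word_sub w (eval v vT) (eval v (Cst 1)); rewrite eo eT -TE.
by apply; rewrite T_gt0.
Qed.


(** * Decoding the header *)

Section Setup.

Variable g1 : nat.
Hypothesis g1_lt : g1 < T ^ 3.
Hypothesis g2_lt : g2 < T ^ 2.
Hypothesis es_lt : [&& e1 < w, e2 < w, e3 < w & e4 < w].

(* The lowest set bit of the header is [T]; the next [3 D] bits are a seed [g1] for
   which [D] is itself a hash value, so that [D] is known without computing a
   logarithm.  The remaining fields can then be cut out with shifts by multiples of
   [D]. *)
Definition header_tail := pack T [:: e1; e2; e3; e4; r0; fl : nat].
Definition header := T + 2 * T * g1 + T ^ 5 * (g2 + T ^ 2 * header_tail).

Lemma T_gt1 : 1 < T.
Proof. by rewrite TE -{1}(expn0 2) ltn_exp2l ?D_gt0. Qed.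

Lemma tail_digits : all (fun a => a < T) [:: e1; e2; e3; e4; r0; fl : nat].
Proof.
have /and4P[h1 h2 h3 h4] := es_lt.
have lt e : e < w -> e < T by move=> he; apply: leq_trans he w_T.
have h5 : r0 < w.
  apply: leq_trans cap_w; rewrite -addn1 addnC leq_add //.
    by rewrite (leq_trans _ (leq_addr _ _)) // muln_gt0 D_gt0.
  by rewrite leq_pmull // expn_gt0.
rewrite /= (lt _ h1) (lt _ h2) (lt _ h3) (lt _ h4) (lt _ h5) andbT.
by apply: leq_ltn_trans T_gt1; case: fl.
Qed.

Lemma header_lo_lt : T + 2 * T * g1 < T ^ 5.
Proof.
have T1 := T_gt1; have := g1_lt; rewrite !expnS expn0 muln1.
set q := T * (T * T) => h; nia.
Qed.

Lemma header_lt : header < 2 ^ (13 * D).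
Proof.
have -> : 2 ^ (13 * D) = T ^ 13 by rewrite mulnC expnM TE.
have lt := pack_lt tail_digits; have lo := header_lo_lt.
have -> : 13 = 5 + (2 + 6) by []. rewrite /header !expnD.
have hi : g2 + T ^ 2 * header_tail < T ^ 2 * T ^ 6.
  apply: (@leq_trans (T ^ 2 * header_tail.+1)); last by rewrite leq_mul2l lt orbT.
  by rewrite mulnS ltn_add2r.
apply: (@leq_trans (T ^ 5 * (g2 + T ^ 2 * header_tail).+1)).
  by rewrite mulnS ltn_add2r.
by rewrite leq_mul2l hi orbT.
Qed.

Lemma expnT k : 2 ^ (k * D) = T ^ k.
Proof. by rewrite mulnC expnM TE. Qed.

Hypothesis header_ok : word_at 0 %% 2 ^ (13 * D) = header.
Hypothesis seed_ok : H (to_word w (T + 2 * T * g1), to_word w 0) %% T = D.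

Local Notation h := (word_at 0).

Lemma h_lt : h < 2 ^ w.
Proof. exact: (@sum_bits_lt w (fun k => nth false idx (0 * w + k))). Qed.

Lemma h_low k : k <= 5 -> h %% T ^ k = (T + 2 * T * g1) %% T ^ k.
Proof.
move=> k5; have := header_ok; rewrite expnT => e.
rewrite -(@modn_dvdm (T ^ 13)); last by apply: dvdn_exp2l; move: k5; clear; lia.
rewrite e /header; set u := g2 + _.
have -> : T ^ 5 * u = T ^ (5 - k) * u * T ^ k by rewrite -(subnK k5) expnD subnK // mulnAC.
by rewrite addnC modnMDl.
Qed.

Lemma h_mod2 : h %% 2 ^ D.+1 = 2 ^ D.
Proof.
have T1 := T_gt1; have eS : 2 ^ D.+1 = 2 * T by rewrite expnS TE.
rewrite eS -(@modn_dvdm (T ^ 5)); last first.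
  by rewrite TE -expnM -expnS dvdn_exp2l //; move: D_gt0; clear; lia.
rewrite h_low // modn_dvdm; last first.
  by rewrite TE -expnM -expnS dvdn_exp2l //; move: D_gt0; clear; lia.
by rewrite -TE addnC [2 * T * g1]mulnC modnMDl modn_small //; move: T1; clear; lia.
Qed.

Lemma h_seed : h %% (2 * T ^ 4) = T + 2 * T * g1.
Proof.
have e24 : 2 * T ^ 4 = 2 ^ (4 * D).+1 by rewrite [RHS]expnS expnT.
rewrite e24 -(@modn_dvdm (T ^ 5)); last first.
  by rewrite TE -expnM dvdn_exp2l //; move: D_gt0; clear; lia.
rewrite h_low // modn_dvdm; last first.
  by rewrite TE -expnM dvdn_exp2l //; move: D_gt0; clear; lia.
rewrite -e24 modn_small //; have := g1_lt; have := T_gt1.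
rewrite !expnS expn0 !muln1; set q := T * (T * T); clear; nia.
Qed.

Lemma h_div5 : (h %/ T ^ 5) %% T ^ 8 = g2 + T ^ 2 * header_tail.
Proof.
rewrite -!expnT (@div_mod_field h 13 D 5 8 header) ?D_gt0 // ?header_ok //.
rewrite !expnT /header addnC mulnC divnMDl ?expn_gt0 ?(ltnW T_gt1) //.
rewrite [X in _ + X]divn_small ?header_lo_lt // addn0 modn_small //.
have -> : 8 = 2 + 6 by []. rewrite expnD.
apply: (@leq_trans (T ^ 2 * header_tail.+1)); last by rewrite leq_mul2l (pack_lt tail_digits) orbT.
by rewrite mulnS ltn_add2r.
Qed.

Lemma h_g2 : (h %/ 2 ^ (5 * D)) %% T ^ 2 = g2.
Proof.
rewrite expnT -(@modn_dvdm (T ^ 8)); last by apply: dvdn_exp2l.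
by rewrite h_div5 mulnC addnC modnMDl modn_small.
Qed.

Lemma h_field k : k < 6 ->
  (h %/ 2 ^ ((7 + k) * D)) %% T = nth 0 [:: e1; e2; e3; e4; r0; fl : nat] k.
Proof.
move=> k6; rewrite expnT expnD -[7]/(5 + 2) expnD -mulnA divnMA.
have e : (h %/ T ^ 5 %/ (T ^ 2 * T ^ k)) %% T = ((h %/ T ^ 5) %% T ^ 8 %/ (T ^ 2 * T ^ k)) %% T.
  rewrite -expnD -!expnT; have := @div_mod_field (h %/ 2 ^ (5 * D)) 8 D (2 + k) 1 _ D_gt0 _ erefl.
  by rewrite mul1n -TE; apply; move: k6; clear; lia.
rewrite e h_div5 divnMA addnC mulnC divnMDl ?expn_gt0 ?(ltnW T_gt1) //.
by rewrite [X in _ + X]divn_small // addn0 (pack_digit tail_digits).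
Qed.


Variable v0 : env w.
Hypothesis v0_0 : v0 0 = x.
Hypothesis v0_1 : v0 1 = n.-1 :> nat.
Hypothesis v0_2 : v0 2 = w :> nat.

Lemma eval_ones (v : env w) e k : eval v e = k :> nat -> k < w ->
  eval v (Bin OpSub (Bin OpShl (Cst 1) e) (Cst 1)) = 2 ^ k - 1 :> nat.
Proof.
move=> ee kw; have one : eval v (Cst 1) = 1 :> nat.
  by apply: to_word_val; apply: leq_ltn_trans T_gt0 T_lt.
have lt : 2 ^ k < 2 ^ w by rewrite ltn_exp2l.
have := @word_shl w (eval v (Cst 1)) (eval v e); rewrite one ee mul1n => /(_ lt) e1'.
have := @word_sub w (eval v (Bin OpShl (Cst 1) e)) (eval v (Cst 1)).
by rewrite (e1' : eval v (Bin OpShl (Cst 1) e) = _ :> nat) one; apply; rewrite expn_gt0.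
Qed.

Lemma setup_ok : exists v, [/\ sem setup v0 = inl v, params v,
  v 14 = 2 :> nat & v 15 = 1 :> nat].
Proof.
have Tw := T_lt; have T1 := T_gt1; have T0 := T_gt0; have cT := cap_T4.
have T4E : 2 * T ^ 4 = 2 * (T * T * (T * T)) by rewrite -[4]/(2 + 2) expnD -mulnn.
have lt16 : 32 <= 2 * T ^ 4.
  by rewrite T4E; move: T1; clear => T1; have : 4 <= T * T; nia.
have cst (v : env w) c : c <= 32 -> eval v (Cst c) = c :> nat.
  by move=> hc; apply: to_word_val; apply: leq_ltn_trans (leq_trans hc lt16) cT.
have hh : eval v0 (Idx (Cst 0)) = word_at 0 :> nat.
  have z : eval v0 (Cst 0) = 0 :> nat by apply: cst.
  rewrite -[LHS]/(nat_of_ord (index_word idx (eval v0 (Cst 0)))) /index_word.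
  by rewrite to_word_val z ?(@sum_bits_lt w (fun k => nth false idx (_ + k))).
pose u1 := setv v0 23 (eval v0 (Idx (Cst 0))).
have h_gt0 : 0 < word_at 0.
  rewrite lt0n; apply/eqP => e; have := h_mod2; rewrite e mod0n => /esym/eqP.
  by rewrite expn_eq0.
have u1h : eval u1 (Var 23) = word_at 0 :> nat by [].
have uT : eval u1 eT = T :> nat.
  have a1 := @word_sub w (eval u1 (Var 23)) (eval u1 (Cst 1)).
  rewrite u1h cst // subn1 in a1; have {}a1 := a1 h_gt0.
  have a2 := word_xor (eval u1 (Var 23)) (eval u1 (Bin OpSub (Var 23) (Cst 1))).
  rewrite u1h (a1 : eval u1 (Bin OpSub (Var 23) (Cst 1)) = _ :> nat) in a2.
  rewrite (lxor_pred h_mod2) expnS -TE in a2.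
  have a3 := word_shr (eval u1 eX) (eval u1 (Cst 1)).
  rewrite (a2 : eval u1 eX = _ :> nat) cst // expn1 in a3.
  have e3' : (2 * T - 1) %/ 2 = T.-1 by move: T0; clear; lia.
  rewrite e3' in a3.
  have a4 := @word_add w (eval u1 (Bin OpShr eX (Cst 1))) (eval u1 (Cst 1)).
  rewrite (a3 : eval u1 (Bin OpShr eX (Cst 1)) = _ :> nat) cst // addn1 prednK // in a4.
  exact: a4.
pose u2 := setv u1 3 (eval u1 eT).
have u2T : eval u2 vT = T :> nat by [].
have u2h : eval u2 (Var 23) = word_at 0 :> nat by [].
have sq (v : env w) : eval v vT = T :> nat -> eval v vTT = T * T :> nat.
  move=> e; have := @word_mul w (eval v vT) (eval v vT); rewrite e; apply.
  apply: leq_ltn_trans cT; rewrite T4E; move: T0; clear => T0.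
  by have : 0 < T * T; nia.
(* The number of the hash function is the header modulo [2 * T ^ 4], which is exactly
   [T + 2 * T * g1] since [g1 < T ^ 3]. *)
have uD : eval u2 eD = D :> nat.
  have b1 := @word_mul w (eval u2 vTT) (eval u2 vTT).
  rewrite sq // in b1.
  have {}b1 : eval u2 (Bin OpMul vTT vTT) = T * T * (T * T) :> nat.
    by apply: b1; apply: leq_ltn_trans cT; rewrite T4E; clear; lia.
  have b2 := @word_mul w (eval u2 (Cst 2)) (eval u2 (Bin OpMul vTT vTT)).
  rewrite cst // b1 -T4E in b2; have {}b2 := b2 cT.
  have b3 := @word_sub w (eval u2 v2T4) (eval u2 (Cst 1)).
  rewrite (b2 : eval u2 v2T4 = _ :> nat) cst // in b3.
  have {}b3 := b3 (leq_trans (isT : 0 < 32) lt16).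
  have e24 : 2 * T ^ 4 = 2 ^ (4 * D).+1 by rewrite [RHS]expnS expnT.
  rewrite [in RHS]e24 in b3.
  have b4 := @word_and_ones w (eval u2 (Var 23)) _ _ b3.
  rewrite -e24 u2h h_seed in b4.
  have b5 := @word_sub w (eval u2 vT) (eval u2 (Cst 1)).
  rewrite u2T cst // [in RHS]TE in b5; have {}b5 := b5 T0.
  have := @word_and_ones w (eval u2 (Hsh (Bin OpAnd (Var 23)
                    (Bin OpSub v2T4
                               (Cst 1))) (Cst 0))) _ _ b5.
  rewrite -TE => b6; apply: etrans b6 _; rewrite -[RHS]seed_ok; congr (nat_of_ord (H _) %% _).
  congr (_, _); apply: val_inj; apply: etrans b4 _; rewrite [RHS]/= modn_small //.
  rewrite -h_seed; exact: leq_ltn_trans (leq_mod _ _) h_lt.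
pose u3 := setv u2 4 (eval u2 eD).
have uA (v : env w) : eval v vT = T :> nat -> eval v vD = D :> nat ->
    eval v (Var 23) = word_at 0 :> nat ->
    eval v (Bin OpMul (Bin OpMul (Cst 32) eG) vT) = A :> nat.
  move=> eT' eD' eh.
  have c2 := word_shr (eval v (Var 23)) (eval v (Bin OpMul vD (Cst 5))).
  rewrite eh eval_mulD // in c2.
  have c3 := @word_sub w (eval v vTT) (eval v (Cst 1)).
  rewrite sq // cst // in c3.
  have TTE : T * T = 2 ^ (2 * D) by rewrite expnT mulnn.
  have {}c3 : eval v (Bin OpSub vTT (Cst 1)) = 2 ^ (2 * D) - 1 :> nat.
    by rewrite -TTE; apply: c3; rewrite muln_gt0 T0.
  have c4 := word_and_ones (eval v (Bin OpShr (Var 23) (Bin OpMul vD (Cst 5)))) c3.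
  rewrite (c2 : eval v (Bin OpShr (Var 23) (Bin OpMul vD (Cst 5))) = _ :> nat) (expnT 2) h_g2 in c4.
  have {}c4 : eval v eG = g2 :> nat := c4.
  have Alt : A < 2 ^ w.
    by apply: leq_trans cap_a; rewrite -addnA -[X in X < _]addn0 ltn_add2l addn_gt0 orbT.
  have c1 := @word_mul w (eval v (Cst 32)) (eval v eG).
  rewrite cst // c4 in c1.
  have {}c1 : eval v (Bin OpMul (Cst 32) eG) = 32 * g2 :> nat.
    by apply: c1; apply: leq_ltn_trans Alt; rewrite leq_mul2r leq_pmulr // orbT.
  have := @word_mul w (eval v (Bin OpMul (Cst 32) eG)) (eval v vT).
  by rewrite c1 eT' mulnAC; apply.
have /and4P[l1 l2 l3 l4] := es_lt.
have ufield (v : env w) k : eval v vT = T :> nat -> eval v vD = D :> nat ->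
    eval v (Var 23) = word_at 0 :> nat -> k < 6 ->
    eval v (field (Var 23) (7 + k)) = nth 0 [:: e1; e2; e3; e4; r0; fl : nat] k :> nat.
  move=> eT' eD' eh k6; rewrite eval_field //; last by move: k6; clear; lia.
  by rewrite eh h_field.
pose u4 := setv u3 5 (eval u3 (Bin OpMul (Bin OpMul (Cst 32) eG) vT)).
pose u5 := setv u4 6 (eval u4 (ones 7)).
pose u6 := setv u5 7 (eval u5 (ones 8)).
pose u7 := setv u6 8 (eval u6 (ones 9)).
pose u8 := setv u7 9 (eval u7 (field (Var 23) 11)).
pose u9 := setv u8 10 (eval u8 (ones 10)).
pose u10 := setv u9 11 (eval u9 (Bin OpSub (Cst 0) (field (Var 23) 12))).
pose u11 := setv u10 12 (eval u10 (Bin OpMul vD (Cst 13))).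
pose u12 := setv u11 13 (eval u11 eO).
pose u13 := setv u12 14 (eval u12 (Cst 2)).
pose u14 := setv u13 15 (eval u13 (Cst 1)).
exists u14.
have e5 : u14 5 = A :> nat := uA u3 u2T uD u2h.
have e6 : u14 6 = 2 ^ e1 - 1 :> nat.
  exact: (eval_ones (ufield u4 0 u2T uD u2h isT) l1).
have e7 : u14 7 = 2 ^ e2 - 1 :> nat.
  exact: (eval_ones (ufield u5 1 u2T uD u2h isT) l2).
have e8 : u14 8 = 2 ^ e3 - 1 :> nat.
  exact: (eval_ones (ufield u6 2 u2T uD u2h isT) l3).
have e9 : u14 9 = r0 :> nat := ufield u7 4 u2T uD u2h isT.
have e10 : u14 10 = 2 ^ e4 - 1 :> nat.
  exact: (eval_ones (ufield u8 3 u2T uD u2h isT) l4).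
have e11 : u14 11 = vmask2 :> nat.
  have f5 := ufield u9 5 u2T uD u2h isT.
  have z : eval u9 (Cst 0) = 0 :> nat by apply: cst.
  have E : u14 11 = (eval u9 (Cst 0) + (2 ^ w - eval u9 (field (Var 23) (7 + 5)))) %% 2 ^ w :> nat.
    by [].
  rewrite E z f5 /vmask2 add0n; clear.
  case: (fl); last by rewrite subn0 modnn.
  by rewrite modn_small // ltn_subrL expn_gt0.
have e12 : u14 12 = off1 :> nat by apply: (eval_mulD (v := u10)).
have e13 : u14 13 = off0 :> nat.
  have p2 : 0 < 2 ^ e2 by rewrite expn_gt0.
  have l6 : 2 ^ e2 * (6 * D) < 2 ^ w.
    by apply: leq_ltn_trans off_lt; rewrite -addnA addnCA leq_addr.
  have d1 := @word_add w (eval u11 vSm1) (eval u11 (Cst 1)).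
  rewrite (e7 : eval u11 vSm1 = _ :> nat) cst // subnK // in d1.
  have {}d1 : eval u11 (Bin OpAdd vSm1 (Cst 1)) = 2 ^ e2 :> nat.
    by apply: d1; rewrite ltn_exp2l.
  have d2 := @word_mul w (eval u11 (Bin OpAdd vSm1 (Cst 1))) (eval u11 (Bin OpMul vD (Cst 6))).
  rewrite d1 eval_mulD // in d2; have {}d2 := d2 l6.
  have d3 := @word_add w (eval u11 vOff1) (eval u11 eS).
  rewrite (e12 : eval u11 vOff1 = _ :> nat) in d3.
  rewrite (d2 : eval u11 eS = _ :> nat) in d3.
  by apply: d3; apply: leq_ltn_trans off_lt; rewrite leq_addr.
split=> //.
- split; first exact: v0_0.
  case=> [_|]; first exact: v0_1.
  case=> [_|]; first exact: v0_2.
  case=> [_|]; first exact: uT.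
  case=> [_|]; first exact: uD.
  case=> [_|]; first exact: e5.
  case=> [_|]; first exact: e6.
  case=> [_|]; first exact: e7.
  case=> [_|]; first exact: e8.
  case=> [_|]; first exact: e9.
  case=> [_|]; first exact: e10.
  case=> [_|]; first exact: e11.
  case=> [_|]; first exact: e12.
  case=> [_|//]; exact: e13.
- exact: (cst u12 2 isT).
exact: (cst u13 1 isT).
Qed.

End Setup.


(** * Reading a node and testing its candidates *)

Local Notation handle := (handle s n T).
Local Notation split := (split s).
Local Notation blk_lo := (blk_lo s n).
Local Notation blk_hi := (blk_hi s n).
Local Notation occ := (occ s n).
Local Notation isblk := (isblk s n).
Local Notation cand := (cand s).

Definition node_cands l r := [:: l.-1; split l r; r.-1].

Hypothesis look0_ok : forall k i, k <= K -> i < n ->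
  look0N (2 ^ 2 ^ k) (s i %/ 2 ^ 2 ^ 2 ^ k) =
  logn 2 (node_handle s n T (2 ^ 2 ^ k) (s i %/ 2 ^ 2 ^ 2 ^ k)).
Hypothesis look1_ok : forall f q j, (f, q) \in keys1 s n T -> j < 3 ->
  let c := nth 0 (node_cands (blk_lo f q) (blk_hi f q)) j in
  (look1N f q %/ 2 ^ (j.*2 * D)) %% T =
    (gap_handle s n T (bucket_top s n T (c %/ T)) - f) %% T /\
  (look1N f q %/ 2 ^ (j.*2.+1 * D)) %% T = c %% T.
Hypothesis look2_ok : forall h q, (h, q) \in keys2 s n T ->
  look2N h q = split (blk_lo h q) (blk_hi h q) %/ T.

Lemma s_lt i j : i < j -> j < n -> s i < s j. Proof. exact: elt_lt. Qed.

Lemma s_bound i : i < n -> s i < 2 ^ T.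
Proof. by move=> _; apply: leq_trans (elt_bound S i) _; rewrite leq_exp2l. Qed.

Lemma n_le : n <= 2 ^ w.
Proof. by rewrite -[X in _ <= X](card_ord (2 ^ w)) max_card. Qed.

Lemma eval_cand v l r j :
  params v -> v 16 = handle l r :> nat -> 0 < handle l r <= T ->
  isblk (handle l r) l r -> v 17 = s l %/ 2 ^ handle l r :> nat ->
  v 18 = look1N (handle l r) (s l %/ 2 ^ handle l r) :> nat -> j < 3 ->
  (nth 0 (node_cands l r) j).+1 < n -> cand l r (nth 0 (node_cands l r) j) ->
  eval v (cand_expr j) = nth 0 (node_cands l r) j :> nat.
Proof.
move=> hp e16 hf b e17 e18 j3; set c := nth _ _ _ => cn cd.
set f := handle l r in e16 hf b e17 e18; set q := _ %/ _ in e17 e18.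
have [h1 h2 h3 h4] := cand_decode s_lt s_bound T_gt0 hf b cn cd.
rewrite -/f -/q in h1 h2 h3; move: h1 h2 h3 h4.
set h := gap_handle _ _ _ _ => h1 h2 h3 h4.
have /and3P[_ /eqP el /eqP er] := b.
have k1 : (f, q) \in keys1 s n T by apply: (handle_keys1 s_lt T_gt0 hf b).
have [] := look1_ok k1 j3; rewrite el er -/c -/h -e18 => f1 f2.
have dlt : h - f < T.
  by move: h1 hf => /andP[h1 h1'] /andP[f0 _]; move: h1 h1' f0; clear; lia.
have {}f1 := etrans f1 (modn_small dlt).
have [_ hreg] := hp.
have e3' : v 3 = T :> nat := hreg 2 isT.
have e4' : v 4 = D :> nat := hreg 3 isT.
have j13 : j.*2.+1 <= 13 by move: j3; clear; lia.
have ed : eval v (field (Var 18) j.*2) = h - f :> nat.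
  rewrite (eval_field _ e3' e4' (ltnW j13)); exact: f1.
have eo : eval v (field (Var 18) j.*2.+1) = c %% T :> nat.
  rewrite (eval_field _ e3' e4' j13); exact: f2.
have eh : eval v (Bin OpAdd (Var 16) (field (Var 18) j.*2)) = h :> nat.
  have le : f + (h - f) = h by rewrite subnKC //; case/andP: h1.
  have := @word_add w (v 16) (eval v (field (Var 18) j.*2)); rewrite ed e16 le.
  by apply; case/andP: h1 => _ hT; apply: leq_ltn_trans hT T_lt.
have eq' : eval v (Bin OpShr (Var 17) (field (Var 18) j.*2)) = s (bucket_top s n T (c %/ T)) %/ 2 ^ h :> nat.
  by have := word_shr (v 17) (eval v (field (Var 18) j.*2)); rewrite ed e17 h2.
have hT : h <= T by case/andP: h1.
have e2' := eval_look2 (Bin OpShr (Var 17) (field (Var 18) j.*2)) hp eh hT.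
rewrite eq' look2_ok // h4 in e2'.
have eD : v 4 = D :> nat by have [_ hh] := hp; exact: (hh 3 isT).
have cw : c < 2 ^ w := leq_trans (ltnW cn) n_le.
have es : eval v (Bin OpShl (look2 (Bin OpAdd (Var 16) (field (Var 18) j.*2))
     (Bin OpShr (Var 17) (field (Var 18) j.*2))) vD) = c %/ T * T :> nat.
  have := @word_shl w (eval v (look2 (Bin OpAdd (Var 16) (field (Var 18) j.*2))
     (Bin OpShr (Var 17) (field (Var 18) j.*2)))) (v 4).
  by rewrite eD -TE e2'; apply; apply: leq_ltn_trans (leq_divM _ _) cw.
have := @word_add w (eval v (Bin OpShl (look2 (Bin OpAdd (Var 16) (field (Var 18) j.*2))
     (Bin OpShr (Var 17) (field (Var 18) j.*2))) vD)) (eval v (field (Var 18) j.*2.+1)).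
by rewrite es eo -divn_eq; apply.
Qed.

Variable cs : nat.
Hypothesis cs_n : cs.+1 < n.
Hypothesis x_gt : s cs < x.
Hypothesis x_le : x <= s cs.+1.
Hypothesis x_gt0 : s 0 < x.

Local Notation csw := (to_word w cs).

Lemma cs_val : csw = cs :> nat.
Proof. by apply: to_word_val; apply: leq_trans n_le; lia. Qed.

Lemma eval_succ v e c : eval v e = c -> eval v (Bin OpAdd e (Cst 1)) = c.+1 %% 2 ^ w :> nat.
Proof.
move=> <-.
have e1' : eval v (Cst 1) = 1 :> nat by apply: to_word_val; apply: leq_ltn_trans T_gt0 T_lt.
by rewrite -[LHS]/((eval v e + eval v (Cst 1)) %% 2 ^ w) e1' addn1.
Qed.

(** The comparison with two adjacent array entries singles out [cs] among all words. An index past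
    the array reads 0, which passes the first comparison; its successor then reads 0 as well or
    wraps around to entry 0, and both are below x, so the second comparison rejects it. *)
Lemma sem_test v e : v 0 = x ->
  sem (test e) v = if eval v e == csw then inr csw else inl (setv v 19 (eval v e)).
Proof.
move=> v0; set c := eval v e; set v' := setv v 19 c.
have -> : sem (test e) v =
   if s c < x then
     if s (c.+1 %% 2 ^ w) < x then inl v' else inr c
   else inl v'.
  have -> : sem (test e) v =
     if s (v' 19) < v' 0 then
       if s (eval v' (Bin OpAdd (Var 19) (Cst 1))) < v' 0 then inl v' else inr (v' 19)
     else inl v' by [].
  have v19 : v' 19 = c by rewrite /v' /setv eqxx.
  by rewrite (@eval_succ v' (Var 19) c v19) v19 (_ : v' 0 = x).
have csn := ltnW cs_n.
case: eqP => [cE|cN].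
  have cv : c = cs :> nat by rewrite cE; exact: cs_val.
  rewrite cv x_gt modn_small; last by apply: leq_trans cs_n n_le.
  by rewrite ltnNge x_le /= cE.
case: ifP => // sx; case: ifP => //; rewrite ltnNge => /negbFE le; exfalso.
have c_lt : c < 2 ^ w := ltn_ord c.
have cN' : c <> cs :> nat by move=> e'; apply: cN; apply: val_inj; exact: etrans e' (esym cs_val).
case: (ltnP c n) => cn; last first.
  move: le; case: (ltngtP c.+1 (2 ^ w)) => [lt||e'].
  - by rewrite modn_small // elt_default ?leqW // leqNgt (leq_ltn_trans (leq0n _) x_gt).
  - by rewrite ltnNge c_lt.
  by rewrite e' modnn leqNgt x_gt0.
have ccs : c < cs.
  case: (ltngtP c cs) => // lt.
  by have := leq_trans x_le (elt_le lt cn); rewrite leqNgt sx.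
move: le; rewrite modn_small; last by apply: leq_trans n_le; apply: leq_trans csn.
by rewrite leqNgt (leq_ltn_trans (elt_le ccs csn) x_gt).
Qed.

Lemma sem_look_node v : params v ->
  let v1 := setv v 18 (eval v (look1 (Var 16) (Var 17))) in
  exists y0 y2 : word w,
  let c1 := eval (setv (setv v1 19 y0) 19 y2) (cand_expr 1) in
  [/\ y0 = eval v1 (cand_expr 0), y2 = eval (setv v1 19 y0) (cand_expr 2) &
  sem look_node v = if [|| y0 == csw, y2 == csw | c1 == csw] then inr csw
                    else inl (setv (setv (setv v1 19 y0) 19 y2) 19 c1)].
Proof.
move=> hp v1.
have hp1 : params v1 by apply: params_set.
exists (eval v1 (cand_expr 0)), (eval (setv v1 19 (eval v1 (cand_expr 0))) (cand_expr 2)).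
have [v0 _] := hp.
have step c1 c2 u : sem (Seq c1 c2) u = match sem c1 u with inl v' => sem c2 v' | inr y => inr y end by [].
have step18 : sem (Set_ 18 (look1 (Var 16) (Var 17))) v = inl v1 by [].
split=> //; rewrite /look_node step step18 step (sem_test _ (proj1 hp1)).
case: (_ == csw) => //=.
have hp2 := params_set (eval v1 (cand_expr 0)) (isT : 14 <= 19) hp1.
rewrite step (sem_test _ (proj1 hp2)); case: (_ == csw) => //=.
have hp3 := params_set (eval (setv v1 19 (eval v1 (cand_expr 0))) (cand_expr 2)) (isT : 14 <= 19) hp2.
by rewrite (sem_test _ (proj1 hp3)).
Qed.

Definition node_res (l r : nat) (v : env w) (res : env w + word w) :=
  match res with
  | inl v' => [/\ params v', (forall q, q \notin [:: 16; 17; 18; 19] -> v' q = v q),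
                ~~ cand l r cs & (l.+1 < r -> v' 19 = split l r :> nat)]
  | inr y => y = csw
  end.

(** This is what survives when the node probed is not in the tables: a halt is still correct,
    because of the test against the array, and otherwise only scratch registers have changed. *)
Definition any_res (v : env w) (res : env w + word w) :=
  match res with
  | inl v' => params v' /\ (forall q, q \notin [:: 16; 17; 18; 19] -> v' q = v q)
  | inr y => y = csw
  end.

Lemma look_node_any v : params v -> any_res v (sem look_node v).
Proof.
move=> hp; have [y0 [y2 [_ _ ->]]] := sem_look_node hp.
case: ifP => //= _; split; first by do 4!apply: params_set => //.
move=> q; rewrite !inE !negb_or => /and4P[_ _ q18 q19].
by rewrite /setv (negbTE q18) (negbTE q19).
Qed.

Lemma look_node_ok v l r : params v -> 0 < handle l r <= T -> isblk (handle l r) l r ->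
  v 16 = handle l r :> nat -> v 17 = s l %/ 2 ^ handle l r :> nat ->
  node_res l r v (sem look_node v).
Proof.
move=> hp hf b e16 e17.
have e16' : eval v (Var 16) = handle l r :> nat := e16.
have e17' : eval v (Var 17) = s l %/ 2 ^ handle l r :> nat := e17.
have hT : handle l r <= T by case/andP: hf.
have e18 := eval_look1 (Var 17) hp e16' hT; rewrite e17' in e18.
have := look_node_any hp; have [y0 [y2 [E0 E2 ->]]] := sem_look_node hp.
set v1 := setv v 18 _ in E0 E2 *; set c1 := eval _ (cand_expr 1).
case: ifP => //= ne [hp' same]; split=> //.
  have hp1 : params v1 by apply: params_set.
  have /norP[n0 /norP[n2 n1]] := negbT ne.
  apply/negP => cd.
  have eqcs (y : word w) : y = cs :> nat -> y == csw.
    by move=> e; apply/eqP/val_inj; rewrite /= modn_small ?e //; apply: leq_trans n_le; lia.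
  have : [|| cs.+1 == l, cs.+1 == r | (l.+1 < r) && (cs == split l r)] := cd.
  case/or3P => [/eqP e|/eqP e|/andP[lr /eqP e]].
  - case/negP: n0; rewrite E0; apply: eqcs.
    have c0 : nth 0 (node_cands l r) 0 = cs by rewrite /= -e.
    by rewrite (@eval_cand v1 l r 0) // c0.
  - case/negP: n2; rewrite E2; apply: eqcs.
    have c0 : nth 0 (node_cands l r) 2 = cs by rewrite /= -e.
    by rewrite (@eval_cand _ l r 2) // ?c0 //; apply: params_set.
  case/negP: n1; apply: eqcs.
  have c0 : nth 0 (node_cands l r) 1 = cs by rewrite /= -e.
  by rewrite (@eval_cand _ l r 1) // ?c0 //; do 2!apply: params_set => //.
move=> lr; have /andP[_ rn] := isblk_le b.
have [p1 p2 p3] := splitP s_lt T_gt0 lr rn.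
apply: (@eval_cand (setv (setv v1 19 y0) 19 y2) l r 1) => //.
- by do 3!apply: params_set => //.
- by apply: leq_trans p2 rn.
- by rewrite /cand lr eqxx !orbT.
Qed.


Lemma sem_seq c1 c2 u :
  sem (Seq c1 c2) u = match sem c1 u with inl v' => sem c2 v' | inr y => inr y end.
Proof. by []. Qed.

Lemma sem_set r e u : sem (Set_ r e) u = inl (setv u r (eval u e)).
Proof. by []. Qed.

Lemma sem_if a b c1 c2 u :
  sem (If a b c1 c2) u = if eval u a < eval u b then sem c1 u else sem c2 u.
Proof. by []. Qed.

Lemma eval_var u r : eval u (Var r) = u r.
Proof. by []. Qed.

Lemma eval_const u c : c < 2 ^ w -> eval u (Cst c) = c :> nat.
Proof. exact: to_word_val. Qed.

Lemma one_lt : 1 < 2 ^ w.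
Proof. exact: leq_ltn_trans T_gt0 T_lt. Qed.

Lemma any_res_trans v1 v res :
  (forall q, q \notin [:: 16; 17; 18; 19] -> v1 q = v q) -> any_res v1 res -> any_res v res.
Proof.
move=> h; case: res => //= v' [hp same]; split=> // q hq; rewrite same //; exact: h.
Qed.

Lemma node_res_trans l r v1 v res :
  (forall q, q \notin [:: 16; 17; 18; 19] -> v1 q = v q) -> node_res l r v1 res -> node_res l r v res.
Proof.
move=> h; case: res => //= v' [hp same h1 h2]; split=> // q hq; rewrite same //; exact: h.
Qed.

Lemma setv_same (v : env w) r y q : q != r -> setv v r y q = v q.
Proof. by rewrite /setv => /negbTE->. Qed.

Lemma setv_eq (v : env w) r y : setv v r y r = y.
Proof. by rewrite /setv eqxx. Qed.

Lemma probe_vars (v : env w) y1 y2 q : q \notin [:: 16; 17; 18; 19] ->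
  setv (setv v 16 y1) 17 y2 q = v q.
Proof. by rewrite !inE !negb_or => /and4P[h1 h2 _ _]; rewrite !setv_same. Qed.

Lemma probe_any v : params v -> any_res v (sem probe v).
Proof.
move=> hp; rewrite /probe sem_seq sem_set sem_seq sem_set.
apply: any_res_trans; last by apply: look_node_any; do 2!apply: params_set => //.
by move=> q hq; rewrite probe_vars.
Qed.

Lemma level_le k : k <= K -> 2 ^ 2 ^ k <= T.
Proof. by move=> h; rewrite TE DE !leq_exp2l. Qed.

Lemma probe_ok v k q : params v -> k <= K -> v 14 = 2 ^ 2 ^ k :> nat -> v 17 = q :> nat ->
  occ (2 ^ 2 ^ k) q ->
  node_res (blk_lo (2 ^ 2 ^ k) q) (blk_hi (2 ^ 2 ^ k) q) v (sem probe v).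
Proof.
move=> hp kK; set t := 2 ^ 2 ^ k => e14 e17 o.
have tT : t <= T := level_le kK.
have b := occ_isblk s_lt o; set l := blk_lo t q in b *; set r := blk_hi t q in b *.
have lq : s l %/ 2 ^ t = q := occ_lo s_lt o.
have ht : 0 < t <= T by rewrite expn_gt0 tT.
have [h0 hb _] := handleP ht b.
have [hE th] := handle_pow2 s_lt T_gt0 tT b.
have /andP[lr rn] := isblk_le b.
have ln : l < n := leq_trans lr rn.
have e0 : eval v (look0 (Var 14) (Var 17)) = logn 2 (handle l r) :> nat.
  rewrite (eval_look0 (Var 17) hp (e14 : eval v (Var 14) = t :> nat) tT).
  rewrite (e17 : eval v (Var 17) = q :> nat) -lq look0_ok //.
  by rewrite /node_handle -/t lq.
have e16 : eval v (Bin OpShl (Cst 1) (look0 (Var 14) (Var 17))) = handle l r :> nat.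
  have := @word_shl w (eval v (Cst 1)) (eval v (look0 (Var 14) (Var 17))).
  rewrite eval_const ?one_lt // e0 mul1n -hE; apply.
  by case/andP: h0 => _ hT; apply: leq_ltn_trans hT T_lt.
rewrite /probe sem_seq sem_set sem_seq sem_set.
apply: node_res_trans; last apply: look_node_ok.
- by move=> q' hq; rewrite probe_vars.
- by do 2!apply: params_set => //.
- exact: h0.
- exact: hb.
- by rewrite setv_same // setv_eq.
rewrite setv_eq; set u := setv _ _ _.
have := word_shr (u 17) (eval u (Bin OpSub (Var 16) (Var 14))).
have -> : eval u (Bin OpSub (Var 16) (Var 14)) = handle l r - t :> nat.
  have u14 : u 14 = t :> nat by [].
  have u16 : u 16 = handle l r :> nat by rewrite -e16.
  by have := @word_sub w (u 16) (u 14); rewrite u14 u16; apply.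
have -> : u 17 = q :> nat by [].
by rewrite -lq -divnMA -expnD subnKC.
Qed.

Definition steer_ok (c g : nat) := [&& c.+1 < n, gaplen s c <= g & ext s x c].

Lemma n_gt1 : 1 < n.
Proof. exact: leq_ltn_trans cs_n. Qed.

Lemma steer_spec v g gr : params v -> gr < 24 -> v gr = g :> nat ->
  exists v', [/\ sem (steer (Var gr)) v = inl v', params v',
    (forall q, q \notin [:: 24; 25] -> v' q = v q),
    (0 < v' 24) = steer_ok (v 19) g &
    (0 < v' 24 -> v' 25 = gapx s (v 19) :> nat)].
Proof.
move=> hp hgr eg; set v1 := setv v 24 (eval v (Cst 0)).
have hp1 : params v1 by apply: params_set.
have z1 : v1 24 = 0 :> nat by rewrite /v1 setv_eq eval_const // expn_gt0.
have en1 : v1 1 = n.-1 :> nat by have [_ h] := hp1; exact: (h 0 isT).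
rewrite /steer sem_seq sem_set -/v1 sem_if (eval_var v1 19) -[eval v1 vN1]/(v1 1) en1.
have v19 : v1 19 = v 19 by [].
have same1 q : q \notin [:: 24; 25] -> v1 q = v q.
  by rewrite !inE !negb_or => /andP[h _]; rewrite /v1 setv_same.
rewrite /steer_ok v19; case: ltnP => lt; last first.
  have -> : ((v 19).+1 < n) = false.
    by apply/negbTE; rewrite -leqNgt -(prednK (ltnW n_gt1)) ltnS.
  by exists v1; split; rewrite ?z1.
have lt1 : (v 19).+1 < n by rewrite -(prednK (ltnW n_gt1)) ltnS.
have es u : u 19 = v 19 -> eval u (Arr (Bin OpAdd (Var 19) (Cst 1))) = s (v 19).+1 :> nat.
  move=> e; have := @eval_succ u (Var 19) (v 19) e.
  rewrite modn_small; last exact: leq_trans lt1 n_le.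
  by move=> e'; rewrite /elt -e'.
have e0 u : u 19 = v 19 -> eval u (Arr (Var 19)) = s (v 19) :> nat.
  by move=> e; rewrite /elt -e.
rewrite sem_seq sem_set; set v2 := setv v1 25 _.
have hp2 : params v2 by apply: params_set.
have v2_19 : v2 19 = v 19 by [].
have v2_0 : v2 0 = x by have [] := hp2.
have v25 : v2 25 = gapx s (v 19) :> nat.
  by rewrite /v2 setv_eq [LHS]word_xor e0 // es.
have same2 q : q \notin [:: 24; 25] -> v2 q = v q.
  move=> h; rewrite -same1 // /v2 setv_same //.
  by move: h; rewrite !inE !negb_or => /andP[].
have z2 : v2 24 = 0 :> nat by rewrite /v2 setv_same.
have vg : v2 gr = g :> nat.
  by rewrite same2 // !inE negb_or !neq_ltn hgr (leq_trans hgr).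
rewrite sem_if eval_const ?one_lt //.
have -> : eval v2 (Bin OpShr (Var 25) (Var gr)) = gapx s (v 19) %/ 2 ^ g :> nat.
  by have := word_shr (v2 25) (v2 gr); rewrite v25 vg.
have -> : (gapx s (v 19) %/ 2 ^ g < 1) = (gaplen s (v 19) <= g).
  by rewrite ltn_divLR ?expn_gt0 // mul1n (gapx_ltE s_lt).
rewrite lt1; case: (leqP (gaplen s (v 19)) g) => lg; last by exists v2; split; rewrite ?z2.
rewrite sem_if.
have -> : eval v2 (Bin OpAnd (Bin OpXor vX (Arr (Var 19)))
     (Bin OpXor vX (Arr (Bin OpAdd (Var 19) (Cst 1))))) =
     Nat.land (Nat.lxor x (s (v 19))) (Nat.lxor x (s (v 19).+1)) :> nat.
  have a1 := word_xor (v2 0) (eval v2 (Arr (Var 19))).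
  have a2 := word_xor (v2 0) (eval v2 (Arr (Bin OpAdd (Var 19) (Cst 1)))).
  rewrite e0 // v2_0 in a1; rewrite es // v2_0 in a2.
  by rewrite [LHS]word_and -a1 -a2 -v2_0.
rewrite (eval_var v2 25) v25 /= -/(ext s x (v 19)).
case: ifP => ex; last by exists v2; split; rewrite ?z2.
rewrite sem_set; exists (setv v2 24 (eval v2 (Cst 1))); split=> //.
- by apply: params_set.
- move=> q hq; rewrite -(same2 q hq) setv_same //.
  by move: hq; rewrite !inE !negb_or => /andP[].
- by rewrite setv_eq eval_const ?one_lt.
Qed.

(** * The fat binary search *)

Definition inner_state (b lo k : nat) (v : env w) :=
  [/\ params v, search_inv s n x cs b lo k, v 20 = gapx s b :> nat,
      v 21 = lo :> nat & v 22 = k :> nat].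

Lemma inner_step v b lo k : k < D -> inner_state b lo k.+1 v ->
  match sem inner_body v with
  | inl v' => exists b' lo', inner_state b' lo' k v'
  | inr y => y = csw
  end.
Proof.
move=> kD [hp inv e20 e21 e22].
have [bn eb ltb hlo _] := inv.
have lob : lo < gaplen s b := hlo b bn eb.
have bT := gaplen_leT s_lt s_bound T_gt0 bn.
set g := next_mult lo k.
have g_lt : g < 2 ^ w.
  have le1 : g <= lo + 2 ^ k by rewrite /g /next_mult mulSnr leq_add2r leq_divM.
  have le2 : lo + 2 ^ k < T + T.
    by rewrite -addSn leq_add // ?(leq_trans lob) // TE leq_exp2l // ltnW.
  apply: leq_ltn_trans le1 _; apply: leq_trans le2 _; apply: ltnW; apply: leq_ltn_trans cap_T.
  by rewrite addnn -mul2n leq_mul2l expnS expn1 leq_pmulr // T_gt0.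
rewrite /inner_body sem_seq sem_set; set v1 := setv v 22 _.
have hp1 : params v1 by apply: params_set.
have v22 : v1 22 = k :> nat.
  rewrite /v1 setv_eq; have := @word_sub w (v 22) (eval v (Cst 1)).
  by rewrite eval_const ?one_lt // e22 subn1; apply.
rewrite sem_seq sem_set; set v2 := setv v1 16 _.
have hp2 : params v2 by apply: params_set.
have v16 : v2 16 = g :> nat.
  rewrite /v2 setv_eq.
  have a1 : eval v1 (Bin OpShr (Var 21) (Var 22)) = lo %/ 2 ^ k :> nat.
    by have := word_shr (v1 21) (v1 22); rewrite v22 (e21 : v1 21 = lo :> nat).
  have a2 : eval v1 (Bin OpAdd (Bin OpShr (Var 21) (Var 22)) (Cst 1)) = (lo %/ 2 ^ k).+1 :> nat.
    have := @word_add w (eval v1 (Bin OpShr (Var 21) (Var 22))) (eval v1 (Cst 1)).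
    rewrite a1 eval_const ?one_lt // addn1; apply; apply: leq_ltn_trans g_lt.
    by rewrite /g /next_mult leq_pmulr // expn_gt0.
  have := @word_shl w (eval v1 (Bin OpAdd (Bin OpShr (Var 21) (Var 22)) (Cst 1))) (v1 22).
  by rewrite a2 v22; apply.
rewrite sem_if eval_const ?expn_gt0 //.
have -> : eval v2 (Bin OpShr (Var 20) (Var 16)) = gapx s b %/ 2 ^ g :> nat.
  by have := word_shr (v2 20) (v2 16); rewrite v16 (e20 : v2 20 = gapx s b :> nat).
have -> : (0 < gapx s b %/ 2 ^ g) = (g < gaplen s b).
  by rewrite divn_gt0 ?expn_gt0 // leqNgt (gapx_ltE s_lt) // -ltnNge.
case: ltnP => gb; last first.
  by exists b, lo; split=> //; apply: search_skip inv gb.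
rewrite sem_seq sem_set; set v3 := setv v2 17 _.
have hp3 : params v3 by apply: params_set.
have v3_16 : v3 16 = g :> nat by [].
have v17 : v3 17 = x %/ 2 ^ g :> nat.
  rewrite /v3 setv_eq; have := word_shr (v2 0) (v2 16); rewrite v16.
  by move=> E; apply: etrans E _; have [-> _] := hp2.
have keep v4 q : q \in [:: 20; 21; 22] ->
    (forall q, q \notin [:: 16; 17; 18; 19] -> v4 q = v3 q) -> v4 q = v1 q.
  by move=> hq h; rewrite h; move: hq; rewrite !inE => /or3P[] /eqP->.
have fin v4 : params v4 -> (forall q, q \notin [:: 16; 17; 18; 19] -> v4 q = v3 q) ->
   v4 16 = g :> nat ->
   (steer_ok (v4 19) g -> search_inv s n x cs (v4 19) lo k) ->
   (~~ steer_ok (v4 19) g -> search_inv s n x cs b g k) ->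
   match sem (Seq (steer (Var 16)) (If (Cst 0) (Var 24) (Set_ 20 (Var 25)) (Set_ 21 (Var 16)))) v4 with
   | inl v' => exists b' lo', inner_state b' lo' k v'
   | inr y => y = csw
   end.
  move=> hp4 same4 v4_16 h1 h2.
  have [v5 [e5 hp5 same5 ok5 x5]] := steer_spec hp4 (isT : 16 < 24) v4_16.
  have [k20 k21 k22] : [/\ v5 20 = v 20, v5 21 = v 21 & v5 22 = v1 22].
    by rewrite !same5 // !(keep v4).
  rewrite sem_seq e5 sem_if eval_const ?expn_gt0 // (eval_var v5 24) ok5.
  case: ifP => ok; rewrite sem_set.
    exists (v4 19), lo; split=> //.
    - by apply: params_set.
    - exact: h1.
    - by rewrite setv_eq (eval_var v5 25) x5 // ok5.
    - by rewrite setv_same // k21.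
    - by rewrite setv_same // k22.
  exists b, g; split=> //.
  - by apply: params_set.
  - by apply: h2; rewrite ok.
  - by rewrite setv_same // k20.
  - by rewrite setv_eq (eval_var v5 16) same5.
  - by rewrite setv_same // k22.
rewrite sem_seq.
have look_form : forall v4, sem look_node v3 = inl v4 -> v4 16 = g :> nat.
  move=> v4; have [y0 [y2 [_ _ ->]]] := sem_look_node hp3.
  by case: ifP => // _ [<-].
(* If no gap of length at most [g] is extended by x, then whatever the tables return is rejected by
   [steer], and [lo] moves up to [g]. *)
case: (boolP (has (fun i => steer_ok i g) (iota 0 n))) => [/hasP[i _ /and3P[i1 i2 i3]]|/hasPn none].
  have [bl hg lq nxt] := search_some s_lt s_bound T_gt0 cs_n x_gt x_le inv gb i1 i3 i2.
  rewrite -/g in bl hg lq nxt.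
  set l := blk_lo g (x %/ 2 ^ g) in bl hg lq nxt.
  set r := blk_hi g (x %/ 2 ^ g) in bl hg lq nxt.
  have gT : 0 < g <= T.
    by rewrite (leq_ltn_trans (leq0n lo) (next_mult_gt lo k)) (leq_trans (ltnW gb) bT).
  have := @look_node_ok v3 l r hp3; rewrite hg => /(_ gT bl v3_16).
  rewrite lq => /(_ v17); case E: (sem look_node v3) => [v4|y] //= [hp4 same4 nc sp].
  have [lr2 e1' e2' e3'] := nxt nc; have {}sp := sp lr2.
  have ok : steer_ok (v4 19) g.
    rewrite sp /steer_ok e1' e2' andbT.
    by case: e3' => /= ->.
  apply: fin => //; [exact: look_form | by rewrite sp | by rewrite ok].
have := look_node_any hp3; case E: (sem look_node v3) => [v4|y] //= [hp4 same4].
have nok i : ~~ steer_ok i g.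
  case: (ltnP i n) => hi; first by apply: none; rewrite mem_iota.
  by rewrite /steer_ok ltnNge (leq_trans hi (leqnSn i)).
apply: fin => //; [exact: look_form | by rewrite (negbTE (nok _)) | move=> _].
apply: (search_none inv gb) => i i1 i2.
by rewrite ltnNge; apply/negP => i3; have := nok i; rewrite /steer_ok i1 i2 i3.
Qed.

(** Each pass halts or lowers the exponent, and [search_end] rules out exponent 0, so the loop halts
    within [k] passes. *)
Lemma inner_loop k : k <= D -> forall v b lo, inner_state b lo k v ->
  exists2 t, t <= k * (cmax inner_body).+1 & exec (Loop inner_body) v t (inr csw).
Proof.
elim: k => [_|k IH kD] v b lo st.
  by case: st => _ /(search_end s_lt cs_n x_gt x_le).
have := inner_step kD st; have [t lt] := exec_sem H arr idx v (isT : noloop inner_body).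
case: (sem inner_body v) => [v'|y] ex; last first.
  move=> e; rewrite e in ex; exists t; last exact: ExLoopHalt.
  by rewrite mulSn (leq_trans lt) // addSn leqW // leq_addr.
case=> b' [lo' st']; have [t' lt' ex'] := IH (ltnW kD) v' b' lo' st'.
exists (t + t').+1; last exact: ExLoop ex ex'.
by rewrite mulSn addSn ltnS leq_add.
Qed.


(** * The loop over the levels *)

Definition outer_state (k : nat) (v : env w) :=
  [/\ params v, v 14 = 2 ^ 2 ^ k :> nat & v 15 = 2 ^ k :> nat].

Definition near_block (k : nat) := let t := 2 ^ 2 ^ k in
  [|| occ t (x %/ 2 ^ t), (0 < x %/ 2 ^ t) && occ t (x %/ 2 ^ t).-1
    | occ t (x %/ 2 ^ t).+1].

Lemma outer_state_probe k v y v' : outer_state k v ->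
  (forall q, q \notin [:: 16; 17; 18; 19] -> v' q = setv v 17 y q) -> params v' ->
  outer_state k v'.
Proof. by move=> [hp e14 e15] same hp'; split; rewrite // same // setv_same. Qed.

(** An occupied block has a correct table entry. Either one of its candidates is the answer, or its
    split starts a search between level 0 and a gap no longer than the probed level. *)
Lemma outer1_occ k v : k <= K -> outer_state k v ->
  occ (2 ^ 2 ^ k) (x %/ 2 ^ 2 ^ 2 ^ k) ->
  match sem outer_body1 v with
  | inl v' => 0 < v' 24 /\ exists b, match sem outer_body2 v' with
      | inl v'' => inner_state b 0 (2 ^ k) v'' | inr y => y = csw end
  | inr y => y = csw
  end.
Proof.
move=> kK st; set t := 2 ^ 2 ^ k => o; have [hp e14 e15] := st.
rewrite /outer_body1 sem_seq sem_set; set v1 := setv v 17 _.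
have hp1 : params v1 by apply: params_set.
have v17 : v1 17 = x %/ 2 ^ t :> nat.
  rewrite /v1 setv_eq; have := word_shr (v 0) (v 14); rewrite e14.
  by move=> E; apply: etrans E _; have [-> _] := hp.
have := probe_ok hp1 kK e14 v17 o; rewrite -/t sem_seq.
have b := occ_isblk s_lt o; set l := blk_lo t _ in b *; set r := blk_hi t _ in b *.
have lq : s l %/ 2 ^ t = x %/ 2 ^ t := occ_lo s_lt o.
case: (sem probe v1) => [v2|y] //= [hp2 same nc sp].
have [lr2 ex le lt] := x_split s_lt T_gt0 cs_n x_gt x_le b lq nc.
have {}sp := sp lr2.
have e14' : v2 14 = t :> nat by rewrite same.
have [v3 [-> hp3 same3 ok3 x3]] := steer_spec hp2 (isT : 14 < 24) e14'.
have /andP[_ rn] := isblk_le b.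
have [p1 p2 p3] := splitP s_lt T_gt0 lr2 rn.
have bn : (split l r).+1 < n := leq_trans p2 rn.
have ok : 0 < v3 24 by rewrite ok3 sp /steer_ok bn le ex.
split; first exact: ok.
exists (split l r).
split.
- by do 3!apply: params_set => //.
(* The exponent can start at [2 ^ k]: [gaplen] of the split is at most [2 ^ 2 ^ k], so no positive
   multiple of that number lies below it. *)
- split=> // z z0 zb; apply/negP => /(dvdn_leq z0) h.
  by have := leq_trans zb le; rewrite ltnNge h.
- by apply: etrans (x3 ok) _; rewrite sp.
- by apply: (@eval_const (setv v3 20 (eval v3 (Var 25))) 0); rewrite expn_gt0.
have E : v3 15 = v 15 by rewrite same3 // same.
exact: etrans (congr1 (@nat_of_ord _) E) e15.
Qed.

Lemma outer1_empty k v : k <= K -> outer_state k v ->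
  ~~ occ (2 ^ 2 ^ k) (x %/ 2 ^ 2 ^ 2 ^ k) ->
  match sem outer_body1 v with
  | inl v' => v' 24 = 0 :> nat /\ outer_state k v'
  | inr y => y = csw
  end.
Proof.
move=> kK st; set t := 2 ^ 2 ^ k => o; have [hp e14 e15] := st.
rewrite /outer_body1 sem_seq sem_set; set v1 := setv v 17 _.
have hp1 : params v1 by apply: params_set.
have := probe_any hp1; rewrite sem_seq.
case: (sem probe v1) => [v2|y] //= [hp2 same].
have e14' : v2 14 = t :> nat by rewrite same.
have [v3 [-> hp3 same3 ok3 x3]] := steer_spec hp2 (isT : 14 < 24) e14'.
split.
  apply/eqP; rewrite -leqn0 leqNgt ok3; apply: contra o => /and3P[h1 h2 h3].
  by have [] := occ_ext s_lt T_gt0 cs_n x_gt x_le h1 h3 h2.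
by split; rewrite // same3 // same.
Qed.

Lemma level_sq_lt k : k < K -> 2 ^ 2 ^ k * 2 ^ 2 ^ k < 2 ^ w.
Proof.
move=> kK; rewrite -expnD addnn -mul2n -expnS.
exact: leq_ltn_trans (level_le kK) T_lt.
Qed.

Lemma outer3_near k v : k <= K -> outer_state k v ->
  ~~ occ (2 ^ 2 ^ k) (x %/ 2 ^ 2 ^ 2 ^ k) ->
  match sem outer_body3 v with
  | inl v' => ~~ near_block k /\ (k < K -> outer_state k.+1 v')
  | inr y => y = csw
  end.
Proof.
move=> kK st; set t := 2 ^ 2 ^ k => o.
rewrite /outer_body3 sem_seq sem_set; set v1 := setv v 17 _.
have [hp e14 e15] := st.
have e0 : v 0 = x by have [] := hp.
have xt : eval v (Bin OpShr vX (Var 14)) = x %/ 2 ^ t :> nat.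
  by have := word_shr (v 0) (v 14); rewrite e14 => E; apply: etrans E _; rewrite e0.
have hp1 : params v1 by apply: params_set.
have near1 : (0 < x %/ 2 ^ t) && occ t (x %/ 2 ^ t).-1 -> sem probe v1 = inr csw.
  move=> /andP[x0 o1].
  have v17 : v1 17 = (x %/ 2 ^ t).-1 :> nat.
    rewrite /v1 setv_eq.
    have := @word_sub w (eval v (Bin OpShr vX (Var 14))) (eval v (Cst 1)).
    by rewrite xt eval_const ?one_lt // subn1; apply.
  have := probe_ok hp1 kK e14 v17 o1; rewrite -/t.
  case: (sem probe v1) => [v2|y]; last by move=> /= ->.
  case=> _ _ nc _; case/negP: nc.
  have e := empty_right s_lt T_gt0 cs_n x_gt x_le o o1 x0.
  by rewrite /cand e eqxx orbT.
rewrite sem_seq; have := probe_any hp1.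
case E1: (sem probe v1) => [v2|y] //= [hp2 same2].
have n1 : ~~ ((0 < x %/ 2 ^ t) && occ t (x %/ 2 ^ t).-1).
  by apply/negP => /near1; rewrite E1.
have st2 : outer_state k v2 := outer_state_probe st same2 hp2.
rewrite sem_seq sem_set; set v3 := setv v2 17 _.
have hp3 : params v3 by apply: params_set.
have [_ e14' e15'] := st2.
have xt2 : eval v2 (Bin OpShr vX (Var 14)) = x %/ 2 ^ t :> nat.
  have := word_shr (v2 0) (v2 14); rewrite e14' => E; apply: etrans E _.
  by have [-> _] := hp2.
have near2 : occ t (x %/ 2 ^ t).+1 -> sem probe v3 = inr csw.
  move=> o1.
  have v17 : v3 17 = (x %/ 2 ^ t).+1 :> nat.
    rewrite /v3 setv_eq.
    have := @word_add w (eval v2 (Bin OpShr vX (Var 14))) (eval v2 (Cst 1)).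
    rewrite xt2 eval_const ?one_lt // addn1; apply.
    have <- := occ_lo s_lt o1.
    exact: leq_ltn_trans (leq_div _ _) (elt_bound _ _).
  have := probe_ok hp3 kK e14' v17 o1; rewrite -/t.
  case: (sem probe v3) => [v4|y]; last by move=> /= ->.
  case=> _ _ nc _; case/negP: nc.
  have e := empty_left s_lt T_gt0 cs_n x_gt x_le o o1.
  by rewrite /cand e eqxx.
rewrite sem_seq; have := probe_any hp3.
case E2: (sem probe v3) => [v4|y] //= [hp4 same4].
have st4 : outer_state k v4 := outer_state_probe st2 same4 hp4.
have [_ e14'' e15''] := st4.
split.
  rewrite /near_block -/t !negb_or o n1 /=.
  by apply/negP => /near2; rewrite E2.
move=> kK'; split.
- by do 2!apply: params_set => //.
- rewrite setv_same // setv_eq; have := @word_mul w (v4 14) (v4 14).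
  by rewrite e14'' => /(_ (level_sq_lt kK')); rewrite -expnD addnn -mul2n -expnS.
rewrite setv_eq; set u := setv v4 14 _.
have := @word_add w (u 15) (u 15); rewrite (e15'' : u 15 = 2 ^ k :> nat).
rewrite addnn -mul2n -expnS; apply.
apply: leq_ltn_trans T_lt; rewrite TE DE; apply: leq_trans (ltnW (ltn_expl (2 ^ k.+1) (isT : 1 < 2))) _.
by rewrite !leq_exp2l.
Qed.

Definition body_cost := (cmax outer_body1 + (ecost (Cst 0) + ecost (Var 24) + cmax outer_body2).+2 + cmax outer_body3).+1.
Definition inner_cost := (cmax inner_body).+1.

Lemma outer_step k v : k <= K -> outer_state k v -> exists res,
  match res with
  | inl v' => ~~ near_block k /\ (k < K -> outer_state k.+1 v')
  | inr y => y = csw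
  end /\ exists2 t, t < body_cost + (if res is inl _ then 0 else 2 ^ k * inner_cost) &
      exec outer_body v t res.
Proof.
move=> kK st; rewrite /body_cost.
have [t1 le1 ex1] := exec_sem H arr idx v (isT : noloop outer_body1).
case: (boolP (occ (2 ^ 2 ^ k) (x %/ 2 ^ 2 ^ 2 ^ k))) => o.
  have := outer1_occ kK st o.
  case: (sem outer_body1 v) ex1 => [v'|y] ex1.
    case=> v24 [b]; have [t2 le2 ex2] := exec_sem H arr idx v' (isT : noloop outer_body2).
    have finish t y : exec (Seq outer_body2 (Loop inner_body)) v' t (inr y) ->
        exec outer_body v (t1 + (ecost (Cst 0) + ecost (Var 24) + t).+2) (inr y).
      move=> ex; apply: ExSeq ex1 _; apply: ExSeqHalt; apply: ExIf.
      by rewrite eval_const ?expn_gt0 // (eval_var v' 24) v24.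
    have kD : 2 ^ k <= D by rewrite DE leq_exp2l.
    case: (sem outer_body2 v') ex2 => [v''|y] ex2.
      move=> st''; have [t3 le3 ex3] := inner_loop kD st''.
      exists (inr csw); split=> //; eexists; last exact: finish (ExSeq ex2 ex3).
      move: le1 le2 le3; rewrite /inner_cost; clear; lia.
    move=> e; rewrite e in ex2; exists (inr csw); split=> //; eexists; last exact: finish (ExSeqHalt _ ex2).
    move: le1 le2; clear; lia.
  move=> e; rewrite e in ex1; exists (inr csw); split=> //; eexists; last exact: ExSeqHalt ex1.
  move: le1; clear; lia.
have := outer1_empty kK st o.
case: (sem outer_body1 v) ex1 => [v'|y] ex1; last first.
  move=> e; rewrite e in ex1; exists (inr csw); split=> //; eexists; last exact: ExSeqHalt ex1.
  move: le1; clear; lia.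
case=> v24 st'; have := outer3_near kK st' o.
have [t3 le3 ex3] := exec_sem H arr idx v' (isT : noloop outer_body3).
case: (sem outer_body3 v') ex3 => [v''|y] ex3 h.
  exists (inl v''); split=> //; eexists; last first.
    apply: ExSeq ex1 _; apply: ExSeq ex3; apply: ExIf.
    rewrite eval_const ?expn_gt0 // (eval_var v' 24) v24 ltnn; exact: ExSkip.
  move: le1 le3; clear; lia.
exists (inr csw); split=> //; rewrite h in ex3; eexists; last first.
  apply: ExSeq ex1 _; apply: ExSeq ex3; apply: ExIf.
  rewrite eval_const ?expn_gt0 // (eval_var v' 24) v24 ltnn; exact: ExSkip.
move: le1 le3; clear; lia.
Qed.

Lemma halt_bound (B I k a t : nat) : t < B + 2 ^ k * I -> t <= a.+1 * B + 2 ^ (k + a) * I.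
Proof.
move=> /ltnW/leq_trans; apply; rewrite leq_add //; first by rewrite leq_pmull.
by rewrite leq_mul2r leq_exp2l // leq_addr orbT.
Qed.

Lemma step_bound (B j t t' C : nat) : t < B + 0 -> t' <= j.+1 * B + C ->
  (t + t').+1 <= j.+2 * B + C.
Proof. by rewrite addn0 [j.+2 * B]mulSn -addnA => lt lt'; rewrite -addSn leq_add. Qed.

(** A pass that enters the inner search never returns from it, so one search is paid for in total,
    at an exponent no larger than that of the last level. *)
Lemma outer_loop j : forall k v, near_block (k + j) -> k + j <= K -> outer_state k v ->
  exists2 t, t <= j.+1 * body_cost + 2 ^ (k + j) * inner_cost &
    exec (Loop outer_body) v t (inr csw).
Proof.
elim: j => [|j IH] k v nb kK st.
  rewrite addn0 in nb kK.
  have [[v'|y] [h [t lt ex]]] := outer_step kK st; first by case: h; rewrite nb.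
  rewrite h in ex; exists t; last exact: ExLoopHalt.
  exact: halt_bound.
have kK' : k < K by apply: leq_trans kK; rewrite addnS ltnS leq_addr.
have [[v'|y] [h [t lt ex]]] := outer_step (ltnW kK') st; last first.
  rewrite h in ex; exists t; last exact: ExLoopHalt.
  exact: halt_bound.
case: h => _ /(_ kK') st'; rewrite -addSnnS in nb kK *.
have [t' lt' ex'] := IH k.+1 v' nb kK st'.
exists (t + t').+1; last exact: ExLoop ex ex'.
exact: step_bound lt lt'.
Qed.

(** At level [T] the query and all keys have prefix 0, so the loop over the levels ends there at the
    latest. *)
Lemma near_top : near_block K.
Proof.
rewrite /near_block -DE -TE; apply/orP; left.
apply: (occP s_lt (ltnW cs_n)).
by rewrite !divn_small //; [apply: leq_trans (ltn_ord x) _; rewrite leq_exp2l | apply: s_bound; exact: ltnW].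
Qed.

Lemma not_near_dist k : ~~ near_block k ->
  2 ^ 2 ^ 2 ^ k < minn (s cs.+1 - x) (x - s cs).
Proof.
move=> nb; rewrite leq_min !ltnNge -negb_or; apply: contra nb => h.
apply: (near_occ s_lt T_gt0 cs_n x_gt x_le).
by rewrite orbC.
Qed.

Lemma query_mid v0 k : v0 0 = x -> v0 1 = n.-1 :> nat -> v0 2 = w :> nat ->
  (exists2 v, sem setup v0 = inl v & outer_state 0 v) ->
  near_block k -> k <= K ->
  exists2 t, t <= cmax setup + k.+1 * body_cost + 2 ^ k * inner_cost &
    exec (Seq setup (Loop outer_body)) v0 t (inr csw).
Proof.
move=> h0 h1 h2 [v e st] nb kK.
have [t1 le1 ex1] := exec_sem H arr idx v0 (isT : noloop setup).
rewrite e in ex1; have [t2 le2 ex2] := @outer_loop k 0 v nb kK st.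
exists (t1 + t2); last exact: ExSeq ex1 ex2.
by rewrite -addnA leq_add.
Qed.

End Query.

(** The constant [2 ^ m] is reduced modulo [2 ^ w] and thus vanishes exactly when [w <= m]; this
    lets one program serve both the table of all answers and the search. Queries before the second
    or after the last key are settled by the array ends. *)
Definition main (m : nat) : cmd :=
  If (Cst 0) (Cst (2 ^ m))
    (If (Arr (Cst 0)) vX
        (If (Arr vN1) vX (Halt vN1) (Seq setup (Loop outer_body)))
        (Halt (Bin OpSub (Cst 0) (Cst 1))))
    (Halt (Idx vX)).

Section Main.

Variables (w : nat) (S : {set word w}) (H : hash_family w) (idx : bitseq).
Local Notation n := #|S|.
Local Notation s := (elt S).
Local Notation arr := (sorted_array S).
Local Notation exec := (exec H arr idx).
Local Notation eval := (eval H arr idx).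
Variables (x : word w) (v0 : env w) (m : nat).
Hypothesis w_gt0 : 0 < w.
Hypothesis v0_0 : v0 0 = x.
Hypothesis v0_1 : v0 1 = n.-1 :> nat.

Definition main_cost := ecost (Cst 0) + ecost (Arr (Cst 0)) + ecost (Arr vN1) + 3 * ecost vX +
  ecost (Idx vX) + ecost (Bin OpSub (Cst 0) (Cst 1)) + 2 * ecost (Cst 0) + ecost vN1 + 7.

Lemma cost_pow : ecost (Cst (2 ^ m)) = ecost (Cst 0). Proof. by []. Qed.

Lemma eval_zero : eval v0 (Cst 0) = 0 :> nat.
Proof. exact: mod0n. Qed.

Lemma main_small : w <= m -> exists2 t, t <= main_cost & exec (main m) v0 t (inr (index_word idx x)).
Proof.
move=> wm; eexists; last first.
  apply: ExIf; rewrite eval_zero.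
  have -> : eval v0 (Cst (2 ^ m)) = 0 :> nat.
    by apply/eqP; apply: dvdn_exp2l.
  rewrite ltnn -v0_0; exact: ExHalt.
rewrite cost_pow /main_cost; clear; lia.
Qed.

Hypothesis m_lt : m < w.

Lemma main_large t y :
  exec (If (Arr (Cst 0)) vX
        (If (Arr vN1) vX (Halt vN1) (Seq setup (Loop outer_body)))
        (Halt (Bin OpSub (Cst 0) (Cst 1)))) v0 t (inr y) ->
  exec (main m) v0 (ecost (Cst 0) + ecost (Cst (2 ^ m)) + t).+2 (inr y).
Proof.
move=> ex; apply: ExIf; rewrite eval_zero.
have -> : eval v0 (Cst (2 ^ m)) = 2 ^ m :> nat by apply: modn_small; rewrite ltn_exp2l.
by rewrite expn_gt0.
Qed.

Lemma eval_arr0 : eval v0 (Arr (Cst 0)) = s 0 :> nat.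
Proof. by rewrite -[LHS]/(nat_of_ord (nth (to_word w 0) arr (eval v0 (Cst 0)))) eval_zero. Qed.

Lemma main_first : x <= s 0 ->
  exists2 t, t <= main_cost & exec (main m) v0 t (inr (to_word w (2 ^ w).-1)).
Proof.
move=> x0; eexists; last first.
  apply: main_large; apply: ExIf; rewrite eval_arr0 (v0_0 : eval v0 vX = x) ltnNge x0 /=.
  have -> : to_word w (2 ^ w).-1 = eval v0 (Bin OpSub (Cst 0) (Cst 1)).
    apply: val_inj; rewrite [LHS]/= -[RHS]/((eval v0 (Cst 0) + (2 ^ w - eval v0 (Cst 1))) %% 2 ^ w).
    rewrite eval_zero add0n -subn1; congr ((_ - _) %% _); apply/esym/modn_small.
    by rewrite -{1}(expn0 2) ltn_exp2l.
  exact: ExHalt.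
rewrite cost_pow /main_cost; clear; lia.
Qed.

Lemma main_last : s 0 < x -> s n.-1 < x ->
  exists2 t, t <= main_cost & exec (main m) v0 t (inr (v0 1)).
Proof.
move=> x0 xl; eexists; last first.
  apply: main_large; apply: ExIf; rewrite eval_arr0 (v0_0 : eval v0 vX = x) x0.
  apply: ExIf; rewrite (v0_0 : eval v0 vX = x).
  have -> : eval v0 (Arr vN1) = s n.-1 :> nat by rewrite /elt -v0_1.
  rewrite xl; exact: ExHalt.
rewrite cost_pow /main_cost; clear; lia.
Qed.

Lemma main_mid t y : s 0 < x -> x <= s n.-1 ->
  exec (Seq setup (Loop outer_body)) v0 t (inr y) ->
  exists2 t', t' <= main_cost + t & exec (main m) v0 t' (inr y).
Proof.
move=> x0 xl ex; eexists; last first.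
  apply: main_large; apply: ExIf; rewrite eval_arr0 (v0_0 : eval v0 vX = x) x0.
  apply: ExIf; rewrite (v0_0 : eval v0 vX = x).
  have -> : eval v0 (Arr vN1) = s n.-1 :> nat by rewrite /elt -v0_1.
  rewrite ltnNge xl; exact: ex.
rewrite cost_pow /main_cost; clear; lia.
Qed.

End Main.


(** * Layout of the index *)

Lemma split_lt_n (s : nat -> nat) l r n : 0 < n -> r <= n -> split s l r < n.
Proof.
move=> n0 rn; rewrite /split /argmax_seq; set g := iota _ _; set i := find _ _.
case: (ltnP i (size g)) => hi; last by rewrite nth_default.
have := mem_nth 0 hi; rewrite mem_iota => /andP[]; move: (nth _ _ _) => y; move: rn n0; clear; lia.
Qed.

Section Tables.

Variables (w : nat) (S : {set word w}) (H : hash_family w).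
Local Notation n := #|S|.
Local Notation s := (elt S).

Variables (K D T e1 e2 e3 e4 g2 : nat) (fl : bool).
Hypothesis DE : D = 2 ^ K.
Hypothesis TE : T = 2 ^ D.
Local Notation r0 := K.+1.
Local Notation off1 := (13 * D).
Local Notation off0 := (off1 + 2 ^ e2 * (6 * D)).
Local Notation cell_end := (off0 + 2 ^ e3 * r0).

Hypothesis w_gt0 : 0 < w.
Hypothesis cap_w : cell_end <= w.
Hypothesis n_gt0 : 0 < n.
Hypothesis fl_n : ~~ fl -> n <= T.

Definition cell_vertex e e' f q tag := (hval H T g2 tag f q %% 2 ^ e, hval H T g2 tag.+1 f q %% 2 ^ e').

Definition value0 t q := logn 2 (node_handle s n T t q).
Definition value1 f q :=
  let cs := node_cands S (blk_lo s n f q) (blk_hi s n f q) in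
  let enc c := [:: (gap_handle s n T (bucket_top s n T (c %/ T)) - f) %% T; c %% T] in
  pack T (enc (nth 0 cs 0) ++ enc (nth 0 cs 1) ++ enc (nth 0 cs 2)).
Definition value2 h q := split s (blk_lo s n h q) (blk_hi s n h q) %/ T.

Variables (a0 a1 a2 : nat -> nat * nat -> bool) (hdr : nat).
Hypothesis hdr_lt : hdr < 2 ^ off1.
Hypothesis a0_ok : forall k i b, k <= K -> i < n -> b < r0 ->
  let t := 2 ^ 2 ^ k in let q := s i %/ 2 ^ t in
  a0 b (cell_vertex e1 e3 t q 0) (+) a0 b (cell_vertex e1 e3 t q 2) = bit (value0 t q) b.
Hypothesis a1_ok : forall f q b, (f, q) \in keys1 s n T -> b < 6 * D ->
  a1 b (cell_vertex e1 e2 f q 4) (+) a1 b (cell_vertex e1 e2 f q 6) = bit (value1 f q) b.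
Hypothesis a2_ok : forall h q b, (h, q) \in keys2 s n T -> b < w ->
  a2 b (cell_vertex e4 0 h q 8) (+) a2 b (cell_vertex e4 0 h q 10) = bit (value2 h q) b.

(** Without a bucket table the last row is cut after its used bits. For few keys there is a single
    row, and storing all [w] bits of it would exceed the space bound. *)
Definition index_size := if fl then (2 ^ e1 + 2 ^ e4) * w else (2 ^ e1 - 1) * w + cell_end.

(* Word [c < 2 ^ e1] holds row [c] of the tables of [keys1] and of the levels
   [2 ^ 2 ^ k], after [off1] bits reserved for the header; the next [2 ^ e4] words
   are the table of [keys2], omitted when there is only one bucket. *)
Definition index_bit (P : nat) : bool :=
  let c := P %/ w in let p := P %% w in
  if c < 2 ^ e1 then
    if p < off1 then bit hdr p
    else if p < off0 then a1 ((p - off1) %% (6 * D)) (c, (p - off1) %/ (6 * D))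
    else a0 ((p - off0) %% r0) (c, (p - off0) %/ r0)
  else a2 p (c - 2 ^ e1, 0).

Definition index_bits : bitseq := mkseq index_bit index_size.
Local Notation idx := index_bits.

Lemma nth_cell c p : c < 2 ^ e1 -> p < cell_end -> nth false idx (c * w + p) = index_bit (c * w + p).
Proof.
move=> hc hp; rewrite nth_mkseq // /index_size; have pw := leq_trans hp cap_w.
case: fl.
  apply: (@leq_trans (c.+1 * w)); first by rewrite mulSnr ltn_add2l.
  by rewrite leq_mul2r (leq_trans hc) ?orbT // leq_addr.
rewrite -addnS leq_add // leq_mul2r; apply/orP; right.
by rewrite -ltnS subn1 prednK ?expn_gt0.
Qed.

Lemma index_bitE c p : p < w -> index_bit (c * w + p) =
  if c < 2 ^ e1 then
    if p < off1 then bit hdr p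
    else if p < off0 then a1 ((p - off1) %% (6 * D)) (c, (p - off1) %/ (6 * D))
    else a0 ((p - off0) %% r0) (c, (p - off0) %/ r0)
  else a2 p (c - 2 ^ e1, 0).
Proof.
by move=> pw; rewrite /index_bit divnMDl // divn_small // addn0 modnMDl modn_small.
Qed.

Lemma index_header : word_at w idx 0 %% 2 ^ off1 = hdr.
Proof.
apply: bits_inj => i; rewrite bit_modn (@bit_sum w (fun k => nth false idx (0 * w + k))).
case: (ltnP i off1) => hi; last by rewrite (bit_small hdr_lt).
have hi' : i < cell_end by apply: leq_trans hi _; rewrite -addnA leq_addr.
have iw := leq_trans hi' cap_w.
by rewrite iw nth_cell ?expn_gt0 // index_bitE // expn_gt0 hi.
Qed.

Lemma nth_cell1 c t b : c < 2 ^ e1 -> t < 2 ^ e2 -> b < 6 * D ->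
  off1 + t * (6 * D) + b < w /\ nth false idx (c * w + (off1 + t * (6 * D) + b)) = a1 b (c, t).
Proof.
move=> hc ht hb; have D0 := (D_gt0 DE).
have lt : off1 + t * (6 * D) + b < off0.
  rewrite -addnA ltn_add2l; apply: (@leq_trans (t.+1 * (6 * D))); first by rewrite [t.+1 * _]mulSnr ltn_add2l.
  by rewrite leq_mul2r ht orbT.
have lt' : off1 + t * (6 * D) + b < cell_end := leq_trans lt (leq_addr _ _).
have ltw := leq_trans lt' cap_w; split=> //.
rewrite nth_cell // index_bitE // hc lt -addnA ltnNge leq_addr /= addKn.
by rewrite divnMDl ?muln_gt0 // modnMDl modn_small // divn_small // addn0.
Qed.

Lemma nth_cell0 c t b : c < 2 ^ e1 -> t < 2 ^ e3 -> b < r0 ->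
  off0 + t * r0 + b < w /\ nth false idx (c * w + (off0 + t * r0 + b)) = a0 b (c, t).
Proof.
move=> hc ht hb.
have lt : off0 + t * r0 + b < cell_end.
  rewrite -addnA ltn_add2l; apply: (@leq_trans (t.+1 * r0)); first by rewrite mulSnr ltn_add2l.
  by rewrite leq_mul2r ht orbT.
have ltw := leq_trans lt cap_w; split=> //.
have ge : off0 <= off0 + t * r0 + b by rewrite -addnA leq_addr.
have ge1 : off1 <= off0 + t * r0 + b := leq_trans (leq_addr _ _) ge.
rewrite nth_cell // index_bitE // hc ltnNge ge1 /= ltnNge ge /= -addnA addKn.
by rewrite divnMDl // modnMDl modn_small // divn_small // addn0.
Qed.

Lemma nth_cell2 c b : fl -> c < 2 ^ e4 -> b < w ->
  nth false idx ((2 ^ e1 + c) * w + b) = a2 b (c, 0).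
Proof.
move=> f hc hb; have lt : (2 ^ e1 + c) * w + b < index_size.
  rewrite /index_size f; apply: (@leq_trans ((2 ^ e1 + c).+1 * w)).
    by rewrite [_.+1 * w]mulSnr ltn_add2l.
  by rewrite leq_mul2r ltn_add2l hc orbT.
rewrite (nth_mkseq _ _ lt) (index_bitE _ hb) [2 ^ e1 + c < _]ltnNge leq_addr.
by rewrite [~~ true]/= addKn.
Qed.

(** Both halves are shifted cells, so their exclusive or is the stored value bit by bit; only the
    low [m] bits are specified. *)
Lemma lookN_val base off r m e e' (a : nat -> nat * nat -> bool) lev q tag V :
  (forall c t b, c < 2 ^ e -> t < 2 ^ e' -> b < m -> off + t * r + b < w /\
     nth false idx ((base + c) * w + (off + t * r + b)) = a b (c, t)) ->
  (forall b, b < m -> a b (cell_vertex e e' lev q tag) (+) a b (cell_vertex e e' lev q tag.+2) = bit V b) ->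
  V < 2 ^ m ->
  lookN H idx T g2 base off r e e' lev q tag %% 2 ^ m = V.
Proof.
move=> hn ha hV; apply: bits_inj => b; rewrite bit_modn.
case: (ltnP b m) => hb; last by rewrite (bit_small hV).
have half_bit tg : bit (halfN H idx T g2 base off r e e' lev q tg) b = a b (cell_vertex e e' lev q tg).
  rewrite /halfN bit_divn; set c := _ %% 2 ^ e; set t := _ %% 2 ^ e'.
  have [||l1 l2] := hn c t b _ _ hb; rewrite ?ltn_mod ?expn_gt0 //.
  by rewrite /word_at (@bit_sum w (fun k => nth false idx ((base + c) * w + k))) l1 l2.
by rewrite /= /lookN bit_xor !half_bit ha.
Qed.

Lemma tables0 k i : k <= K -> i < n ->
  look0N H idx K D T e1 e2 e3 g2 (2 ^ 2 ^ k) (s i %/ 2 ^ 2 ^ 2 ^ k) =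
  logn 2 (node_handle s n T (2 ^ 2 ^ k) (s i %/ 2 ^ 2 ^ 2 ^ k)).
Proof.
move=> kK hi; apply: (@lookN_val _ _ _ _ _ _ a0).
- by move=> c t b; exact: nth_cell0.
- by move=> b hb; exact: a0_ok.
set h := node_handle _ _ _ _ _.
have hT : h <= T by exact: handle_leT.
(* The exponent can be [D = 2 ^ K] itself, which explains the width [K.+1]. *)
have lD : logn 2 h <= D.
  case: (posnP h) => [->|h0]; first by rewrite logn0.
  rewrite -(@leq_exp2l 2) // -TE; apply: leq_trans hT.
  by apply: dvdn_leq => //; apply: pfactor_dvdnn.
apply: leq_ltn_trans lD _; rewrite DE ltn_exp2l //.
Qed.

Lemma value1_lt f q : value1 f q < 2 ^ (6 * D).
Proof.
rewrite mulnC expnM -TE; apply: pack_lt; rewrite /= !ltn_mod (T_gt0 TE) //.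
Qed.

Lemma tables1 f q j : (f, q) \in keys1 s n T -> j < 3 ->
  let c := nth 0 (node_cands S (blk_lo s n f q) (blk_hi s n f q)) j in
  (look1N H idx D T e1 e2 g2 f q %/ 2 ^ (j.*2 * D)) %% T =
    (gap_handle s n T (bucket_top s n T (c %/ T)) - f) %% T /\
  (look1N H idx D T e1 e2 g2 f q %/ 2 ^ (j.*2.+1 * D)) %% T = c %% T.
Proof.
move=> hk j3 c.
have e : look1N H idx D T e1 e2 g2 f q %% 2 ^ (6 * D) = value1 f q.
  apply: (@lookN_val _ _ _ _ _ _ a1); last exact: value1_lt.
    by move=> c' t b; exact: nth_cell1.
  by move=> b hb; exact: a1_ok.
have fld k : k < 6 -> (look1N H idx D T e1 e2 g2 f q %/ 2 ^ (k * D)) %% T = (value1 f q %/ T ^ k) %% T.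
  move=> k6; have k1 : k + 1 <= 6 by rewrite addn1.
  have := @div_mod_field _ 6 D k 1 _ (D_gt0 DE) k1 e; rewrite mul1n -TE => ->.
  by rewrite [k * D]mulnC expnM -TE.
have T0 := (T_gt0 TE).
by rewrite !fld /value1 ?pack_digit /= ?ltn_mod ?T0 //; rewrite /c; case: j j3 {c} => [|[|[|]]].
Qed.

Lemma tables2 h q : (h, q) \in keys2 s n T ->
  look2N H idx T e1 e4 g2 fl h q = split s (blk_lo s n h q) (blk_hi s n h q) %/ T.
Proof.
move=> hk; rewrite /look2N /vmask2; have sp := split_lt_n s (blk_lo s n h q) n_gt0 (blk_hi_le s n h q).
(* When the table is omitted the mask is 0, and [n <= T] puts every gap into bucket 0. *)
case E: fl; last first.
  by rewrite PeanoNat.Nat.land_0_r divn_small // (leq_trans sp) // fl_n ?E.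
rewrite land_ones; apply: (@lookN_val _ _ _ _ _ _ a2).
- case=> [|c] // t b; rewrite ?expn0; case: t => // hc _ hb; rewrite muln0 !add0n; split=> //.
    by rewrite (@nth_cell2 0).
  by rewrite (@nth_cell2 c.+1).
- by move=> b hb; exact: a2_ok.
have nw : n <= 2 ^ w by rewrite -[X in _ <= X](card_ord (2 ^ w)) max_card.
by apply: leq_ltn_trans (leq_div _ _) _; apply: leq_trans nw.
Qed.

End Tables.

(** * Failure probability of the seeds *)

Lemma card_mod_word w e v : e <= w -> v < 2 ^ e ->
  #|[set y : word w | y %% 2 ^ e == v]| * 2 ^ e = 2 ^ w.
Proof.
move=> ew ve; have p2 : 0 < 2 ^ e by rewrite expn_gt0.
have wE : 2 ^ w = 2 ^ (w - e) * 2 ^ e by rewrite -expnD subnK.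
have lt (i : 'I_(2 ^ (w - e))) : i * 2 ^ e + v < 2 ^ w.
  apply: (@leq_trans (i.+1 * 2 ^ e)); first by rewrite mulSnr ltn_add2l.
  by rewrite wE leq_mul2r ltn_ord orbT.
pose f (i : 'I_(2 ^ (w - e))) : word w := Ordinal (lt i).
have inj : injective f.
  move=> i j [] /eqP; rewrite eqn_add2r eqn_mul2r eqn0Ngt p2 /= => /eqP e'.
  exact: val_inj.
have -> : [set y : word w | y %% 2 ^ e == v] = [set f i | i : 'I_(2 ^ (w - e))].
  apply/setP => y; rewrite inE; apply/eqP/imsetP => [h|[i _ ->]]; last first.
    by rewrite /= modnMDl modn_small.
  have hi : y %/ 2 ^ e < 2 ^ (w - e) by rewrite ltn_divLR // -wE.
  by exists (Ordinal hi) => //; apply: val_inj; rewrite /= -h -divn_eq.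
by rewrite card_imset // card_ord wE.
Qed.

Lemma card_mod_word_le w e v : e <= w ->
  #|[set y : word w | y %% 2 ^ e == v]| * 2 ^ e <= #|word w|.
Proof.
move=> ew; rewrite card_ord; case: (ltnP v (2 ^ e)) => hv; first by rewrite card_mod_word.
suff -> : [set y : word w | y %% 2 ^ e == v] = set0 by rewrite cards0.
apply/setP => y; rewrite !inE; apply/eqP => h; move: hv; rewrite leqNgt -h ltn_mod expn_gt0 //.
Qed.

(** Bernoulli's inequality, proved in [h] without division: [T] independent trials of success
    probability [1 / T] all fail with probability at most 1/2. *)
Lemma pow_pred_bound T : 0 < T -> 2 * T.-1 ^ T <= T ^ T.
Proof.
case: T => // a _; rewrite -pred_Sn.
have h k : a ^ k * (a + k) <= a.+1 ^ k * a.
  elim: k => [|k IH]; first by rewrite addn0.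
  rewrite !expnS -mulnA [X in _ <= X]mulnAC [X in _ <= X]mulnC [X in _ <= X]mulnC.
  apply: (@leq_trans (a.+1 * (a ^ k * (a + k)))); last first.
    by rewrite -mulnA [a * _]mulnC leq_mul2l IH orbT.
  by move: (a ^ k) => z; clear; nia.
case: (posnP a) => [->|a0]; first by rewrite muln0.
rewrite -(leq_pmul2r a0); apply: leq_trans (h _).
by rewrite mulnAC mulnC leq_mul2l; apply/orP; right; clear; lia.
Qed.

Lemma leq_cnt (P Y : finType) (A B : pred {ffun P -> Y}) : (forall H, A H -> B H) -> cnt A <= cnt B.
Proof. by move=> h; apply: leq_sum => H _; case: (boolP (A H)) => // /h ->. Qed.

Lemma leq_cntU (P Y : finType) (A B : pred {ffun P -> Y}) :
  cnt (fun H => A H || B H) <= cnt A + cnt B.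
Proof. by rewrite /cnt -big_split; apply: leq_sum => H _ /=; case: (A H); case: (B H). Qed.

Section Seeds.

Variables (w D T : nat).
Hypothesis TE : T = 2 ^ D.
Hypothesis D_w : D <= w.

Lemma word_gt0 : 0 < #|word w|. Proof. by rewrite card_ord expn_gt0. Qed.

Definition bad_seed1 (g : nat) (H : hash_family w) :=
  H (to_word w (T + 2 * T * g), to_word w 0) %% T != D.

(** A seed yields [D] with probability exactly [1 / T], so [T] seeds all fail with probability at
    most 1/2, and [T ^ 3] seeds form [T ^ 2] such groups. *)
Lemma cnt_bad_seed1 : T + 2 * T * T ^ 3 < 2 ^ w ->
  2 ^ (T ^ 2) * cnt (fun H => all (bad_seed1^~ H) (iota 0 (T ^ 3))) <= #|hash_family w|.
Proof.
move=> cap; have T0 : 0 < T by rewrite TE expn_gt0.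
pose pt g : word w * word w := (to_word w (T + 2 * T * g), to_word w 0).
have small g : g < T ^ 3 -> to_word w (T + 2 * T * g) = T + 2 * T * g :> nat.
  move=> hg; apply: modn_small; apply: leq_ltn_trans cap.
  by rewrite leq_add2l leq_mul2l ltnW ?orbT.
have h1 g (Q : pred (hash_family w)) : g < T ^ 3 ->
    (forall H p y, pred1 (pt g) p -> Q (upd H p y) = Q H) ->
    T * cnt (fun H => bad_seed1 g H && Q H) <= T.-1 * cnt Q.
  move=> _ iQ; have DT : D < T by rewrite TE ltn_expl.
  apply: (@cnt_miss _ _ word_gt0 (fun y : word w => y %% T)).
    by have := @card_mod_word w D D D_w; rewrite -TE card_ord => /(_ DT) ->.
  by move=> H y; apply: iQ; apply: eqxx.
have h2 g g' (H : hash_family w) p y : g' < g -> g < T ^ 3 -> pred1 (pt g) p ->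
    bad_seed1 g' (upd H p y) = bad_seed1 g' H.
  move=> gg hg /eqP ->; rewrite /bad_seed1 ffunE; suff /negbTE-> : pt g' != pt g by [].
  apply/eqP => -[/eqP]; rewrite -[_ %% _]/(nat_of_ord (to_word w _)) -[X in _ == X]/(nat_of_ord (to_word w _)).
  rewrite !small ?(ltn_trans gg) // eqn_add2l eqn_mul2l (ltn_eqF gg).
  by rewrite orbF muln_eq0 (gtn_eqF T0).
have := cnt_all (a := T) (b := T.-1) (S := fun g => pred1 (pt g)) h1 h2.
set c := cnt _ => h; have p : 0 < T ^ T ^ 3 by rewrite expn_gt0 T0.
rewrite -(leq_pmul2l p) mulnCA; apply: leq_trans (leq_mul (leqnn _) h) _.
rewrite mulnA leq_mul2r; apply/orP; right.
rewrite [T ^ 3]expnS (expnM T.-1) (expnM T) -expnMn leq_exp2r ?pow_pred_bound //.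
by rewrite expn_gt0 T0.
Qed.

Section Table.

Variables (l : seq (nat * nat)) (tag e e' : nat).
Hypothesis l_uniq : uniq l.
Hypothesis l_ok : forall f q, (f, q) \in l -> f <= T /\ q < 2 ^ w.
Hypothesis tag_lt : tag + 4 <= 16.
Hypothesis e_w : e <= w.
Hypothesis e'_w : e' <= w.
Hypothesis cap_l : 16 * size l <= 2 ^ e * 2 ^ e'.

(** Seed [g] owns the hash functions from [32 * T * g] up to [32 * T * g.+1]: levels are at most [T]
    and use sixteen functions each, and [16 * T + 16 <= 32 * T]. Distinct seeds are therefore
    independent. *)
Definition key_pt g (i : 'I_(size l)) (j : nat) : word w * word w :=
  let: (f, q) := nth (0, 0) l i in (to_word w (32 * T * g + f * 16 + (tag + j)), to_word w q).

Definition seed_pts g (p : word w * word w) := 32 * T * g <= p.1 < 32 * T * g.+1.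

Definition bad_table g (H : hash_family w) :=
  dependent (fun y : word w => y %% 2 ^ e) (fun y : word w => y %% 2 ^ e') (key_pt g) H.

Lemma key_pt_val g (i : 'I_(size l)) j : 32 * T * g + 16 * T + 16 <= 2 ^ w -> j < 4 ->
  let: (f, q) := nth (0, 0) l i in
  [/\ (key_pt g i j).1 = 32 * T * g + f * 16 + (tag + j) :> nat, (key_pt g i j).2 = q :> nat & f <= T].
Proof.
move=> cap j4; rewrite /key_pt; have := mem_nth (0, 0) (ltn_ord i).
case: (nth _ _ _) => f q /l_ok[fT qw] /=; split=> //; last exact: modn_small.
by apply: modn_small; apply: leq_trans cap; move: fT tag_lt j4; clear; lia.
Qed.

Lemma key_pt_inj g i i' j j' : 32 * T * g + 16 * T + 16 <= 2 ^ w -> j < 4 -> j' < 4 ->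
  key_pt g i j = key_pt g i' j' -> i = i' /\ j = j'.
Proof.
move=> cap j4 j4' e0; have := key_pt_val i cap j4; have := key_pt_val i' cap j4'; rewrite -e0.
case E: (nth _ _ i) => [f q]; case E': (nth _ _ i') => [f' q'] [-> -> _] [e1 qq _].
have [ff jj] : f' = f /\ j' = j by move: e1 tag_lt j4 j4'; clear; lia.
split; last by rewrite jj.
apply/val_inj/eqP; rewrite -(nth_uniq (0, 0) (ltn_ord i) (ltn_ord i') l_uniq).
by rewrite E E' ff qq.
Qed.

Lemma key_pt_seed g i j : 0 < T -> 32 * T * g + 16 * T + 16 <= 2 ^ w -> j < 4 -> seed_pts g (key_pt g i j).
Proof.
move=> T0 cap j4; have := key_pt_val i cap j4; case: (nth _ _ i) => f q [e1 _ fT].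
by rewrite /seed_pts e1; move: fT tag_lt j4 T0; clear; nia.
Qed.

Lemma bad_table_upd g g' H p y : 32 * T * g.+1 <= 2 ^ w -> g' < g -> seed_pts g p ->
  bad_table g' (upd H p y) = bad_table g' H.
Proof.
move=> cap gg hp; have T0 : 0 < T by rewrite TE expn_gt0.
have cap' : 32 * T * g' + 16 * T + 16 <= 2 ^ w.
  by apply: leq_trans cap; move: gg T0; clear; nia.
have same i j : j < 4 -> upd H p y (key_pt g' i j) = H (key_pt g' i j).
  move=> j4; rewrite ffunE; case: eqP => // e0; move: hp; rewrite -e0 => /andP[h _].
  have /andP[_ h'] := key_pt_seed i T0 cap' j4.
  by have := leq_ltn_trans h h'; rewrite ltn_mul2l ltnS [g <= _]leqNgt gg andbF.
rewrite /bad_table /dependent; apply: eq_existsb => E; congr (_ && evenly _).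
rewrite /ends_of; congr flatten; apply: eq_map => i.
by rewrite /edge1 /edge2 /vertex !same.
Qed.

Lemma cnt_bad_table g (Q : pred (hash_family w)) : 32 * T * g.+1 <= 2 ^ w ->
  (forall H p y, seed_pts g p -> Q (upd H p y) = Q H) ->
  7 * cnt (fun H => bad_table g H && Q H) <= cnt Q.
Proof.
move=> cap iQ; have T0 : 0 < T by rewrite TE expn_gt0.
have cap' : 32 * T * g + 16 * T + 16 <= 2 ^ w.
  by apply: leq_trans cap; move: T0; clear; nia.
apply: (@cnt_dependent _ _ word_gt0 (2 ^ e) (2 ^ e')).
- by move=> v; exact: card_mod_word_le.
- by move=> v; exact: card_mod_word_le.
- by move=> i i' j j' j4 j4'; exact: key_pt_inj.
- exact: cap_l.
- by move=> H i j y j4; apply: iQ; exact: key_pt_seed.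
Qed.

(** The graph does not depend on the values, so one good seed solves the systems of all bit
    positions. *)
Lemma table_solution g (H : hash_family w) (val : nat -> nat -> nat -> bool) : ~~ bad_table g H ->
  exists a : nat -> nat * nat -> bool, forall f q b, (f, q) \in l ->
    a b (cell_vertex H T g e e' f q tag) (+) a b (cell_vertex H T g e e' f q tag.+2) = val b f q.
Proof.
move=> nb; have hb b : exists a : nat * nat -> bool, forall f q, (f, q) \in l ->
    a (cell_vertex H T g e e' f q tag) (+) a (cell_vertex H T g e e' f q tag.+2) = val b f q.
  have [a ha] := solvable_graph (fun i : 'I_(size l) => let: (f, q) := nth (0, 0) l i in val b f q) nb.
  exists a => f q /(nthP (0, 0))[i il E]; have := ha (Ordinal il).
  by rewrite /edge1 /edge2 /vertex /key_pt /= E /cell_vertex /hval addn0 !addnS addn0.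
by exists (fun b => projT1 (cid (hb b))) => f q b; exact: (projT2 (cid (hb b))).
Qed.

End Table.

End Seeds.

(** * Correctness for fixed parameters *)

Section Instance.

Variables (w : nat) (S : {set word w}).
Local Notation n := #|S|.
Local Notation s := (elt S).

Variables (K D T e1 e2 e3 e4 : nat).
Hypothesis DE : D = 2 ^ K.
Hypothesis TE : T = 2 ^ D.
Hypothesis w_T : w <= T.
Hypothesis cap_w : 13 * D + 2 ^ e2 * (6 * D) + 2 ^ e3 * K.+1 <= w.
Hypothesis cap_i : 2 ^ e1 + 2 ^ e4 < 2 ^ w.
Hypothesis cap_T : 64 * T ^ 4 <= 2 ^ w.
Hypothesis es_lt : [&& e1 < w, e2 < w, e3 < w & e4 < w].
Hypothesis n_gt0 : 0 < n.
Hypothesis size0 : 16 * (K.+1 * n) <= 2 ^ e1 * 2 ^ e3.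
Hypothesis size1 : 16 * n.*2 <= 2 ^ e1 * 2 ^ e2.
Hypothesis size2 : 16 * (n %/ T).+1 <= 2 ^ e4.

Lemma D_le_w : D <= w.
Proof. by apply: leq_trans cap_w; rewrite -addnA; apply: leq_trans (leq_addr _ _); rewrite leq_pmull. Qed.

Definition level_keys := [seq (2 ^ 2 ^ k, s i %/ 2 ^ 2 ^ 2 ^ k) | k <- iota 0 K.+1, i <- iota 0 n].

(** Duplicates are removed because a repeated key would give two identical edges, which form an even
    set. *)
Definition table_keys (j : nat) : seq (nat * nat) :=
  undup (nth [::] [:: level_keys; keys1 s n T; keys2 s n T] j).

Definition slot_bits (j : nat) : nat * nat := nth (0, 0) [:: (e1, e3); (e1, e2); (e4, 0)] j.

Lemma size_table_keys j : j < 3 ->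
  16 * size (table_keys j) <= 2 ^ (slot_bits j).1 * 2 ^ (slot_bits j).2.
Proof.
move=> j3; apply: (@leq_trans (16 * size (nth [::] [:: level_keys; keys1 s n T; keys2 s n T] j))).
  by rewrite leq_mul2l size_undup.
case: j j3 => [|[|[|]]] // _ /=.
- by apply: leq_trans size0; rewrite size_allpairs !size_iota.
- apply: leq_trans size1; rewrite size_cat !size_map !size_iota leq_mul2l -addnn leq_add2l /=.
  exact: leq_pred.
by rewrite muln1 size_map size_iota.
Qed.

Lemma table_keys_ok j f q : j < 3 -> (f, q) \in table_keys j -> f <= T /\ q < 2 ^ w.
Proof.
have shr i t : s i %/ 2 ^ t < 2 ^ w := leq_ltn_trans (leq_div _ _) (elt_bound S i).
case: j => [|[|[|]]] // _; rewrite mem_undup /=.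
- case/allpairsP => -[k i] [kK _ [-> ->]]; split; last exact: shr.
  by rewrite TE DE !leq_exp2l // -ltnS; rewrite mem_iota in kK.
- rewrite mem_cat => /orP[] /mapP[m _ [-> ->]]; split; try exact: shr; exact: handle_leT.
by case/mapP => m _ [-> ->]; split; [exact: handle_leT | exact: shr].
Qed.

Lemma slot_bits_le j : j < 3 -> (slot_bits j).1 <= w /\ (slot_bits j).2 <= w.
Proof. by case/and4P: es_lt => l1 l2 l3 l4; case: j => [|[|[|]]] // _; split=> //; apply: ltnW. Qed.

Definition bad_tables g (H : hash_family w) j :=
  bad_table T (table_keys j) (4 * j) (slot_bits j).1 (slot_bits j).2 g H.

Definition bad_seed2 g H := has (bad_tables g H) (iota 0 3).

Definition seeds_ok (H : hash_family w) :=
  ~~ all (bad_seed1 D T ^~ H) (iota 0 (T ^ 3)) && ~~ all (bad_seed2^~ H) (iota 0 (T ^ 2)).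

Lemma cap_seed g : g < T ^ 2 -> 32 * T * g.+1 <= 2 ^ w.
Proof.
move=> hg; apply: leq_trans cap_T; apply: (@leq_trans (32 * T * T ^ 2)); first by rewrite leq_mul2l hg orbT.
have T0 := (T_gt0 TE); rewrite -mulnA -expnS leq_mul // leq_pexp2l //.
Qed.

(** Each of the three tables fails with probability at most 1/7, and 3/7 is below 1/2; the [T ^ 2]
    seeds read disjoint sets of hash values. *)
Lemma cnt_bad_seed2 :
  2 ^ (T ^ 2) * cnt (fun H => all (bad_seed2^~ H) (iota 0 (T ^ 2))) <= #|hash_family w|.
Proof.
have tag j : j < 3 -> 4 * j + 4 <= 16 by clear; lia.
have h1 g (Q : pred (hash_family w)) : g < T ^ 2 ->
    (forall H p y, seed_pts T g p -> Q (upd H p y) = Q H) ->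
    2 * cnt (fun H => bad_seed2 g H && Q H) <= 1 * cnt Q.
  move=> hg iQ; pose b j := cnt (fun H => bad_tables g H j && Q H).
  have hb j : j < 3 -> 7 * b j <= cnt Q.
    move=> j3; have [l1 l2] := slot_bits_le j3.
    apply: (@cnt_bad_table w D T TE) => //; first exact: undup_uniq.
    - by move=> f q; exact: table_keys_ok.
    - exact: tag.
    - exact: size_table_keys.
    exact: cap_seed.
  have le : cnt (fun H => bad_seed2 g H && Q H) <= b 0 + (b 1 + b 2).
    apply: leq_trans (leq_add (leqnn _) (leq_cntU _ _)); apply: leq_trans (leq_cntU _ _).
    apply: leq_cnt => H /andP[]; rewrite /bad_seed2 /= orbF.
    by do 2?[case/orP]; move=> -> ->; rewrite ?orbT.
  have := hb 0 isT; have := hb 1 isT; have := hb 2 isT; move: le; clear; lia.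
have h2 g g' (H : hash_family w) p y : g' < g -> g < T ^ 2 -> seed_pts T g p ->
    bad_seed2 g' (upd H p y) = bad_seed2 g' H.
  move=> gg hg hp; apply: eq_in_has => j; rewrite mem_iota => /andP[_ j3].
  apply: (@bad_table_upd w D T TE) hp => //; [by move=> f q; exact: table_keys_ok | exact: tag|].
  exact: cap_seed.
by have := cnt_all h1 h2; rewrite exp1n mul1n.
Qed.

(** A union bound over the two kinds of seeds, which may share hash values; it accounts for the
    factor 2. *)
Lemma cnt_seeds_bad : 2 ^ (T ^ 2) * cnt (fun H => ~~ seeds_ok H) <= 2 * #|hash_family w|.
Proof.
have cap1 : T + 2 * T * T ^ 3 < 2 ^ w.
  apply: leq_trans cap_T; have T0 := (T_gt0 TE); rewrite -mulnA -expnS.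
  have : T <= T ^ 4 by rewrite -{1}(expn1 T) leq_pexp2l.
  by move: (T ^ 4) T0 => z; clear; lia.
have h := leq_add (cnt_bad_seed1 TE D_le_w cap1) cnt_bad_seed2.
rewrite [2 * _]mul2n -addnn; apply: leq_trans h; rewrite -mulnDr leq_mul2l; apply/orP; right.
apply: leq_trans (leq_cntU _ _); apply: leq_cnt => H; rewrite /seeds_ok negb_and !negbK.
exact: id.
Qed.

Variable fl : bool.
Hypothesis fl_n : ~~ fl -> n <= T.

(** The constant alternative is for queries settled at the array ends or at the first level; in the
    other one the level of [k] has failed, which bounds the distance from below, and the search ends
    by the next level. *)
Definition dist_bound (x : word w) (t : nat) :=
  t <= main_cost + cmax setup + body_cost + inner_cost \/
  exists2 k, 2 ^ 2 ^ 2 ^ k < dist_min S x &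
    t <= main_cost + cmax setup + k.+2 * body_cost + 2 ^ k.+1 * inner_cost.

Lemma word_size_gt0 : 0 < w.
Proof. exact: leq_trans (D_gt0 DE) D_le_w. Qed.

Lemma word_pred_card : n.-1 < 2 ^ w.
Proof.
by rewrite prednK // -[X in _ <= X](card_ord (2 ^ w)) max_card.
Qed.

Lemma search_index (H : hash_family w) : seeds_ok H ->
  exists2 idx, size idx = index_size w K D e1 e2 e3 e4 fl &
  forall (x : word w) (v0 : env w) m, m < w ->
    v0 0 = x -> v0 1 = n.-1 :> nat -> v0 2 = w :> nat ->
    exists t i, [/\ exec H (sorted_array S) idx (main m) v0 t (inr i),
      is_pred_index S x i & dist_bound x t].
Proof.
case/andP => /allPn[g1]; rewrite mem_iota => /andP[_ g1T]; rewrite /bad_seed1 negbK => /eqP seed.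
case/allPn => g2; rewrite mem_iota => /andP[_ g2T] /hasPn nb.
have sol j V : j < 3 -> exists a : nat -> nat * nat -> bool, forall f q b, (f, q) \in table_keys j ->
    a b (cell_vertex H T g2 (slot_bits j).1 (slot_bits j).2 f q (4 * j)) (+)
    a b (cell_vertex H T g2 (slot_bits j).1 (slot_bits j).2 f q (4 * j).+2) = Nat.testbit (V f q) b.
  move=> j3; apply: (table_solution (fun b f q => Nat.testbit (V f q) b) (nb j _)).
  by rewrite mem_iota.
have [a0 h0] := sol 0 (value0 S T) isT.
have [a1 h1] := sol 1 (value1 S T) isT.
have [a2 h2] := sol 2 (value2 S T) isT.
have cap_a : 32 * T * g2 + 16 * T + 16 <= 2 ^ w.
  apply: leq_trans (cap_seed g2T); rewrite mulnS; have := (T_gt0 TE).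
  by move: (32 * T * g2) => z; clear; lia.
have cap_T4 : 2 * T ^ 4 < 2 ^ w.
  have : 0 < T ^ 4 by rewrite expn_gt0 (T_gt0 TE).
  by move: cap_T; move: (T ^ 4) => z; clear; lia.
have hdr_lt := header_lt fl DE TE w_T cap_w cap_a cap_i cap_T4 g1T g2T es_lt.
have w0 := word_size_gt0.
have h0' k i b : k <= K -> i < n -> b < K.+1 ->
    let t := 2 ^ 2 ^ k in let q := s i %/ 2 ^ t in
    a0 b (cell_vertex H T g2 e1 e3 t q 0) (+) a0 b (cell_vertex H T g2 e1 e3 t q 2) =
    Nat.testbit (value0 S T t q) b.
  move=> kK hi _ t q; apply: (h0 t q b); rewrite mem_undup; apply/allpairsP.
  by exists (k, i); rewrite !mem_iota.
set idx := index_bits w K D e1 e2 e3 e4 fl a0 a1 a2 (header K T e1 e2 e3 e4 g2 fl g1).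
have l0 := tables0 e4 fl DE TE w0 cap_w a1 a2 (header K T e1 e2 e3 e4 g2 fl g1) h0'.
have l1 f q j := @tables1 w S H K D T e1 e2 e3 e4 g2 fl DE TE w0 cap_w a0 a1 a2
  (header K T e1 e2 e3 e4 g2 fl g1) (fun f q b k _ => h1 f q b (etrans (mem_undup _ _) k)) f q j.
have l2 h q := @tables2 w S H K D T e1 e2 e3 e4 g2 fl w0 n_gt0 fl_n a0 a1 a2
  (header K T e1 e2 e3 e4 g2 fl g1) (fun f q b k _ => h2 f q b (etrans (mem_undup _ _) k)) h q.
have hdr := index_header e1 e4 fl w0 cap_w a0 a1 a2 hdr_lt.
exists idx; first by rewrite size_mkseq.
move=> x v0 m mw v00 v01 v02.
case: (leqP x (s 0)) => x0.
  have [t le ex] := main_first H idx w0 v00 mw x0.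
  exists t, (to_word w (2 ^ w).-1); split=> //; first exact: pred_index_first.
  by left; apply: leq_trans le _; rewrite -!addnA leq_addr.
case: (ltnP (s n.-1) x) => xn.
  have [t le ex] := main_last H idx v00 v01 mw x0 xn.
  exists t, (v0 1); split=> //.
    have -> : v0 1 = to_word w n.-1 by apply: val_inj; rewrite /= modn_small // word_pred_card.
    exact: pred_index_last word_pred_card (prednK n_gt0) xn.
  by left; apply: leq_trans le _; rewrite -!addnA leq_addr.
have [c [cn cx xc]] : exists c, [/\ c.+1 < n, s c < x & x <= s c.+1].
  have ex0 : exists c, x <= s c by exists n.-1.
  case: (ex_minnP ex0) => c xc min_c; have c_n : c <= n.-1 by exact: min_c.
  case: c xc c_n min_c => [|c] xc c_n min_c; first by move: xc; rewrite leqNgt x0.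
  exists c; split=> //; last by rewrite ltnNge; apply/negP => /min_c; rewrite ltnn.
  by apply: leq_ltn_trans c_n _; rewrite prednK.
have cw : c < 2 ^ w.
  by apply: leq_trans word_pred_card; apply: leq_trans (ltnW cn) _; rewrite prednK.
have [isp dE] := pred_index_between cn cx xc cw.
have ex_near : exists k, near_block S x k by exists K; exact: (near_top DE TE w_T x cn).
case: (ex_minnP ex_near) => k nk min_k.
have kK : k <= K by apply: min_k; exact: (near_top DE TE w_T x cn).
have [v [sv pv v14 v15]] := setup_ok DE TE w_T cap_w cap_a cap_i cap_T4 g1T g2T es_lt hdr seed v00 v01 v02.
have st : exists2 v, sem H (sorted_array S) idx setup v0 = inl v &
    outer_state S K D T e1 e2 e3 e4 g2 fl x 0 v by exists v.
have [t le ex] := query_mid DE TE w_T cap_w cap_a cap_i cap_T4 l0 l1 l2 cn cx xc x0 v00 v01 v02 st nk kK.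
have [t' le' ex'] := main_mid v00 v01 mw x0 xn ex.
exists t', (to_word w c); split=> //.
have {}le' := leq_trans le' (leq_add (leqnn main_cost) le).
case: k nk min_k kK le le' => [|k] nk min_k kK le le'.
  by left; move: le'; rewrite !mul1n !addnA.
right; exists k; last by move: le'; rewrite !addnA.
by rewrite dE; apply: (not_near_dist TE) => //; apply/negP => /min_k; rewrite ltnn.
Qed.

End Instance.

(** * Choice of the parameters *)

Lemma poly_le_exp a : exists m, forall w, m <= w -> w ^ a <= 2 ^ w.
Proof.
have lin k : a.*2.+2 <= k -> a * k.+1 <= 2 ^ k.
  move/subnK <-; elim: (k - _) => [|j IH].
    rewrite add0n (_ : 2 ^ a.*2.+2 = 4 * (2 ^ a) ^ 2); last by rewrite -expnM [a * 2]muln2 !expnS mulnA.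
    have : a.+1 ^ 2 <= (2 ^ a) ^ 2 by rewrite leq_exp2r // ltn_expl.
    by rewrite -!mulnn; move: (2 ^ a) => z; clear; nia.
  by move: IH; rewrite addSn expnS; move: (j + _) => z; move: (2 ^ z) => y; clear; nia.
exists (2 ^ a.*2.+2) => w hw; have w0 : 0 < w by apply: leq_trans hw; rewrite expn_gt0.
have /andP[l1 l2] := trunc_log_bounds (isT : 1 < 2) w0; set k := trunc_log 2 w in l1 l2.
apply: (@leq_trans ((2 ^ k.+1) ^ a)); first by case: (posnP a) => [->|a0] //; rewrite leq_exp2r // ltnW.
rewrite -expnM leq_exp2l // mulnC; apply: leq_trans l1; apply: lin.
by rewrite -ltnS -(@ltn_exp2l 2) //; apply: leq_ltn_trans l2.
Qed.

Lemma up_log_double n : 0 < n -> n <= 2 ^ up_log 2 n < n.*2.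
Proof.
move=> n0; rewrite up_logP //=; case: (ltnP 1 n) => n1; last first.
  by case: n n0 n1 => [|[|]].
have /andP[l _] := up_log_bounds (isT : 1 < 2) n1.
have : 0 < up_log 2 n by rewrite up_log_gt0.
by case: (up_log 2 n) l => // k l _; rewrite expnS mul2n ltn_double.
Qed.

Lemma square_le_exp k : k.+1 ^ 2 <= 4 * 2 ^ k.
Proof.
elim: k => [|[|[|k]] IH] //; rewrite [2 ^ _.+3]expnS; move: IH; rewrite -!mulnn.
by move: (2 ^ k.+2) => z; clear; nia.
Qed.

Definition params_ok w n K D T e1 e2 e3 e4 := [/\ D = 2 ^ K, T = 2 ^ D, w <= T,
    13 * D + 2 ^ e2 * (6 * D) + 2 ^ e3 * K.+1 <= w & 2 ^ e1 + 2 ^ e4 < 2 ^ w] /\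
  [/\ 64 * T ^ 4 <= 2 ^ w, [&& e1 < w, e2 < w, e3 < w & e4 < w],
    16 * (K.+1 * n) <= 2 ^ e1 * 2 ^ e3, 16 * n.*2 <= 2 ^ e1 * 2 ^ e2 & 16 * (n %/ T).+1 <= 2 ^ e4].

Section Sizes.

Variables w n L K eQ : nat.
Hypothesis n_gt0 : 0 < n.
Hypothesis n_w : n <= 2 ^ w.
Hypothesis w8 : 8 <= w.
Hypothesis w_L : w + 8 <= 2 ^ L.
Hypothesis L_w : 2 ^ L < (w + 8).*2.
Hypothesis L_K : L <= 2 ^ K < L.*2.
Local Notation D := (2 ^ K).
Local Notation T := (2 ^ D).
Hypothesis L_small : 2 ^ 14 * L <= w.
Hypothesis w_big : 2 ^ 22 * w ^ 8 <= 2 ^ w.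
Hypothesis eQ_def : 2 ^ eQ <= w %/ (28 * D) < 2 ^ eQ.+1.

(** The at most [2 * n] keys of [keys1] need 16 cells each, hence [32 * n] cells, arranged as
    [2 ^ e1] rows of [2 ^ e2] slots. The number of slots that fit into a word caps [e2] at [eQ]; the
    level table has about [K.+1] times as many slots in each row. *)
Definition hash_bits := up_log 2 (32 * n).
Definition slot_exp := minn hash_bits eQ.
Definition cell_exp := hash_bits - slot_exp.
Definition level_exp := slot_exp + up_log 2 K.+1.
Definition bucket_exp := up_log 2 (16 * (n %/ T).+1).
Local Notation e1 := cell_exp.
Local Notation e2 := slot_exp.
Local Notation e3 := level_exp.
Local Notation e4 := bucket_exp.

Lemma cell_slot : e1 + e2 = hash_bits.
Proof. by rewrite subnK // geq_minl. Qed.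

Lemma hash_bits_bounds : 32 * n <= 2 ^ hash_bits < 64 * n.
Proof.
have /up_log_double : 0 < 32 * n by rewrite muln_gt0.
by rewrite -muln2 mulnAC.
Qed.

Lemma D_positive : 0 < D. Proof. by rewrite expn_gt0. Qed.

Lemma eQ_ge : 7 <= eQ.
Proof.
rewrite -ltnS -(@ltn_exp2l 2) //; case/andP: eQ_def => _; apply: leq_ltn_trans.
rewrite leq_divRL ?muln_gt0 ?D_positive //; apply: leq_trans L_small; case/andP: L_K => _.
rewrite -[2 ^ 7]/128 (_ : 14 = 7 + 7) // expnD -[2 ^ 7]/128 -!mulnA leq_mul2l /=.
by move: (2 ^ K) => z; clear; lia.
Qed.

Lemma w_cell : w <= 56 * D * 2 ^ eQ.
Proof.
case/andP: eQ_def => _; rewrite ltn_divLR ?muln_gt0 ?D_positive // expnS => /ltnW h.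
by apply: leq_trans h _; move: (2 ^ eQ) (2 ^ K) => y z; clear; nia.
Qed.

Lemma cell_le : 28 * D * 2 ^ eQ <= w.
Proof. by case/andP: eQ_def => h _; rewrite mulnC -leq_divRL ?muln_gt0 ?D_positive. Qed.

(** Per slot of [keys1], the level table takes at most [2 * K.+1 ^ 2 <= 8 * D] bits. With 13 [D] for
    the header and 6 [D] for the fields this stays within 28 [D]. *)
Lemma cell_end_le : 13 * D + 2 ^ e2 * (6 * D) + 2 ^ e3 * K.+1 <= 28 * D * 2 ^ e2.
Proof.
have h : 2 ^ up_log 2 K.+1 * K.+1 <= 8 * D.
  have /andP[_ h1] := @up_log_double K.+1 isT; have := square_le_exp K.
  by move: h1; rewrite -mulnn; move: (2 ^ K) (2 ^ _) => y z; clear; nia.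
rewrite expnD -mulnA; have p : 0 < 2 ^ e2 by rewrite expn_gt0.
by move: h p; move: (2 ^ e2) (2 ^ _ * _) D_positive; move: (2 ^ K) => x y z; clear; nia.
Qed.

Lemma slot_le : 2 ^ e2 <= 2 ^ eQ.
Proof. by rewrite leq_exp2l // geq_minr. Qed.

Lemma L_le_D : L <= D. Proof. by case/andP: L_K. Qed.

Lemma size_le_T : w <= T.
Proof.
apply: (@leq_trans (2 ^ L)); last by rewrite leq_exp2l // L_le_D.
by apply: leq_trans w_L; rewrite leq_addr.
Qed.

(** Rounding [L] up to the power of two [D] at most squares [2 ^ L], and
    [2 ^ L < (w + 8).*2 <= 4 * w]. *)
Lemma T_small : T <= 16 * w ^ 2.
Proof.
apply: (@leq_trans ((2 ^ L) ^ 2)).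
  by rewrite -expnM leq_exp2l // mulnC mul2n ltnW //; case/andP: L_K.
by move: L_w w8; rewrite -!mulnn; move: (2 ^ L) => z; clear; nia.
Qed.

Lemma T_le_pow4 : T <= w ^ 4.
Proof.
apply: leq_trans T_small _; have : 4 ^ 2 <= w ^ 2 by rewrite leq_exp2r // (leq_trans _ w8).
by rewrite (_ : 4 = 2 + 2) // expnD => h; apply: leq_mul.
Qed.

Lemma eQ_lt : eQ < w.
Proof.
rewrite -(@ltn_exp2l 2) //; apply: leq_ltn_trans (ltn_expl w (isT : 1 < 2)).
by apply: leq_trans cell_le; rewrite leq_pmull // muln_gt0 D_positive.
Qed.

Lemma cell_exp_le : e1 <= w - 2.
Proof.
rewrite /cell_exp /slot_exp; have /andP[_ h] := hash_bits_bounds.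
have : hash_bits < w + 6.
  rewrite -(@ltn_exp2l 2) //; apply: leq_trans h _; rewrite expnD mulnC; exact: leq_mul.
by have := eQ_ge; move: w8; clear; lia.
Qed.

Lemma bucket_exp_le : e4 <= w - 2.
Proof.
have D_ge7 : 7 <= D.
  apply: leq_trans L_le_D; case: L L_small w_L => [|[|[|[|[|[|[|]]]]]]] //; move: w8; clear; lia.
rewrite /bucket_exp; apply: up_log_min => //.
have h : 16 * (n %/ T) <= 2 ^ (w - 3).
  apply: (@leq_trans (16 * (2 ^ w %/ T))); first by rewrite leq_mul2l leq_div2r.
  case: (leqP D w) => Dw; last first.
    by rewrite divn_small // ltn_exp2l.
  rewrite -expnB // -[16]/(2 ^ 4) -expnD leq_exp2l //.
  by move: D_ge7 Dw w8; move: (2 ^ K) => z; clear; lia.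
have h' : 16 <= 2 ^ (w - 3).
  by rewrite -[16]/(2 ^ 4) leq_exp2l //; move: w8; clear; lia.
rewrite mulnS -[w - 2](_ : (w - 3).+1 = _); last by move: w8; clear; lia.
by rewrite expnS mul2n -addnn leq_add.
Qed.

Lemma chosen_params_ok : params_ok w n K D T e1 e2 e3 e4.
Proof.
have cw : 13 * D + 2 ^ e2 * (6 * D) + 2 ^ e3 * K.+1 <= w.
  apply: leq_trans cell_end_le _; apply: leq_trans cell_le.
  by rewrite leq_mul2l slot_le orbT.
have c1 := cell_exp_le; have c4 := bucket_exp_le.
have w2 : w - 2 < w by move: w8; clear; lia.
have /andP[hb _] := hash_bits_bounds.
have e3K : K.+1 <= 2 ^ up_log 2 K.+1 by case/andP: (@up_log_double K.+1 isT).
split; split=> //; first exact: size_le_T.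
- apply: (@leq_ltn_trans (2 ^ (w - 2) + 2 ^ (w - 2))); first by rewrite leq_add // leq_exp2l.
  rewrite addnn -mul2n -expnS ltn_exp2l //; move: w8; clear; lia.
(* By [T_small], [64 * T ^ 4] is at most [64 * 16 ^ 4 * w ^ 8 = 2 ^ 22 * w ^ 8]. *)
- apply: leq_trans w_big; apply: (@leq_trans (64 * (16 * w ^ 2) ^ 4)).
    by rewrite leq_mul2l leq_exp2r ?T_small.
  rewrite expnMn -(expnM w) mulnA -[16]/(2 ^ 4) -[64]/(2 ^ 6) -(expnM 2) -expnD.
  exact: leqnn.
- rewrite (leq_ltn_trans c1) // (leq_ltn_trans c4) // (leq_ltn_trans (geq_minr _ _) eQ_lt) /=.
  rewrite andbT -(@ltn_exp2l 2) //; apply: leq_ltn_trans (ltn_expl w (isT : 1 < 2)).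
  apply: leq_trans cw; apply: leq_trans (leq_addl _ _); exact: leq_pmulr.
- rewrite -expnD /level_exp addnA cell_slot expnD; apply: leq_trans (leq_mul hb e3K).
  by move: (n) (K) => a b; clear; nia.
- by rewrite -expnD cell_slot; apply: leq_trans hb; move: (n) => a; clear; lia.
by apply: proj1 (andP (@up_log_double (16 * (n %/ T).+1) isT)).
Qed.

Lemma index_size_le : index_size w K D e1 e2 e3 e4 (T < n) <= 4000 * (n * D).
Proof.
have /andP[_ hb] := hash_bits_bounds.
(* The constant is [56 * 64], from [w_cell] and [hash_bits_bounds]. *)
have cell : eQ <= hash_bits -> 2 ^ e1 * w <= 3584 * (n * D).
  move=> h; have e2E : e2 = eQ by apply/minn_idPr.
  apply: leq_trans (leq_mul (leqnn _) w_cell) _; rewrite mulnCA -expnD.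
  rewrite -{1}e2E cell_slot; move: hb (D_positive); move: (2 ^ K) (2 ^ _) (n) => x y z; clear; nia.
rewrite /index_size; case: (ltnP T n) => Tn.
  (* More than [T >= w] keys are enough to fill the slots of a word. *)
  have h : eQ <= hash_bits.
    rewrite -(@leq_exp2l 2) //; apply: leq_trans (proj1 (andP hash_bits_bounds)).
    apply: (@leq_trans w); first by apply: leq_trans cell_le; rewrite leq_pmull // muln_gt0 D_positive.
    by apply: leq_trans size_le_T _; apply: leq_trans (ltnW Tn) _; rewrite leq_pmull.
  have h4 : 2 ^ e4 * w <= 64 * n.
    have /andP[_ h4] := @up_log_double (16 * (n %/ T).+1) isT.
    apply: leq_trans (leq_mul (ltnW h4) size_le_T) _.
    have := leq_divM n T; move: Tn.
    by move: (n %/ T) => y; move: (n) (T) => z x; clear; nia.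
  rewrite mulnDl; apply: leq_trans (leq_add (cell h) h4) _.
  by move: (D_positive); move: (2 ^ K) (n) => x y; clear; nia.
have cw : 13 * D + 2 ^ e2 * (6 * D) + 2 ^ e3 * K.+1 <= w.
  by case: chosen_params_ok => -[].
case: (leqP eQ hash_bits) => h.
  apply: leq_trans (leq_add (leqnn _) cw) _; rewrite -mulSnr subn1 prednK ?expn_gt0 //.
  by apply: leq_trans (cell h) _; rewrite leq_mul2r orbT.
(* Few keys: there is a single row, and the size is [cell_end] rather than a whole word. *)
have e2E : e2 = hash_bits by apply/minn_idPl/ltnW.
rewrite /cell_exp e2E subnn mul0n add0n -e2E; apply: leq_trans cell_end_le _.
by rewrite e2E; move: hb (D_positive); move: (2 ^ K) (2 ^ _) (n) => x y z; clear; nia.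
Qed.

End Sizes.

Lemma params_exist : exists m, forall w n, m <= w -> 0 < n <= 2 ^ w ->
  exists K D T e1 e2 e3 e4, [/\ params_ok w n K D T e1 e2 e3 e4, 2 ^ D <= w ^ 4 &
    index_size w K D e1 e2 e3 e4 (T < n) <= 4000 * (n * D)].
Proof.
(* The exponent 30 = 22 + 8 yields [2 ^ 22 * w ^ 8 <= 2 ^ w]; the exponent 17, applied to [L],
   yields [2 ^ 16 * L <= 2 ^ L < 4 * w]. *)
have [m1 h1] := poly_le_exp 30; have [m2 h2] := poly_le_exp 17.
exists (maxn 8 (maxn m1 (2 ^ maxn m2 2))) => w n; rewrite !geq_max => /and3P[w8 w1 w2] /andP[n0 nw].
have [L0 L1] := andP (@up_log_double (w + 8) (ltn_addl w (isT : 0 < 8))).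
set L := up_log 2 (w + 8) in L0 L1.
have Lm : maxn m2 2 <= L.
  by rewrite -(@leq_exp2l 2) //; apply: leq_trans w2 _; apply: leq_trans L0; rewrite leq_addr.
move: Lm; rewrite geq_max => /andP[Lm L2].
have LK := @up_log_double L (ltnW L2); set K := up_log 2 L in LK.
have Ls : 2 ^ 14 * L <= w.
  have a : 2 ^ 16 * L <= 2 ^ L.
    by apply: leq_trans (h2 L Lm); rewrite (expnSr L 16) leq_mul2r leq_exp2r // L2 orbT.
  have b : 2 ^ 16 * L < 4 * w.
    by apply: leq_ltn_trans a _; apply: leq_trans L1 _; move: w8; clear; lia.
  by rewrite -(@leq_pmul2l 4) // mulnA; apply: ltnW.
have wb : 2 ^ 22 * w ^ 8 <= 2 ^ w.
  apply: leq_trans (h1 w w1); rewrite (_ : 30 = 22 + 8) // [w ^ (_ + _)]expnD leq_mul2r.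
  by rewrite leq_exp2r // (leq_trans _ w8) ?orbT.
have q0 : 0 < w %/ (28 * 2 ^ K).
  rewrite divn_gt0 ?muln_gt0 ?expn_gt0 //; apply: leq_trans Ls.
  case/andP: LK => _; rewrite (_ : 14 = 7 + 7) // expnD -[2 ^ 7]/128; move: (2 ^ K) => z; clear; lia.
have eQb := trunc_log_bounds (isT : 1 < 2) q0; set eQ := trunc_log 2 _ in eQb.
exists K, (2 ^ K), (2 ^ 2 ^ K), (cell_exp n eQ), (slot_exp n eQ), (level_exp n K eQ), (bucket_exp n K).
split; [exact: (chosen_params_ok n0 nw w8 L0 L1 LK Ls wb eQb) | exact: (T_le_pow4 w8 L1 LK)|].
exact: (index_size_le n0 nw w8 L0 L1 LK Ls wb eQb).
Qed.

(** * Small words and logarithms *)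

Lemma pred_index_exists w (S : {set word w}) x : exists i, is_pred_index S x i.
Proof.
rewrite /is_pred_index; case E: (pred_of S x) => [y|]; last by eexists.
have yS : y \in S.
  by move: E; rewrite /pred_of; case: pickP => // z /and3P[zS _ _] [<-].
have hi : index y (sorted_array S) < #|S| by rewrite -size_arr index_mem mem_arr.
exists (to_word w (index y (sorted_array S))).
have -> : to_word w (index y (sorted_array S)) = index y (sorted_array S) :> nat.
  by apply: modn_small; apply: leq_trans hi _; rewrite -[X in _ <= X](card_ord (2 ^ w)) max_card.
by split=> //; rewrite nth_index // mem_arr.
Qed.

Definition answer_table w (f : word w -> word w) : bitseq :=
  mkseq (fun p => Nat.testbit (f (to_word w (p %/ w))) (p %% w)) (2 ^ w * w).

Lemma index_word_table w (f : word w -> word w) x : 0 < w -> index_word (answer_table f) x = f x.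
Proof.
move=> w0; apply: val_inj; rewrite [LHS]/=.
rewrite modn_small; last exact: (@sum_bits_lt w (fun k => nth false (answer_table f) (x * w + k))).
apply: bits_inj => i.
rewrite (@bit_sum w (fun k => nth false (answer_table f) (x * w + k))).
case: (ltnP i w) => iw; last first.
  by rewrite (@bit_small (f x) i) //; apply: leq_trans (ltn_ord _) _; rewrite leq_exp2l.
have lt : x * w + i < 2 ^ w * w.
  apply: (@leq_trans (x.+1 * w)); first by rewrite mulSnr ltn_add2l.
  by rewrite leq_mul2r ltn_ord orbT.
rewrite nth_mkseq // divnMDl // divn_small // addn0 modnMDl modn_small //.
by congr (Nat.testbit (f _) _); apply: val_inj; apply: modn_small.
Qed.

(** The variables of the program are the registers 0 to 25, so expressions are evaluated from
    register 26 on. *)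
Lemma run_query_exec w (H : hash_family w) (S : {set word w}) idx x c t y : cvars 26 c ->
  exec H (sorted_array S) idx c (regs (init_state (sorted_array S) x)) t (inr y) ->
  exists2 t', t' <= t & run_query (compile 26 c) H S idx x t' = Some y.
Proof.
move=> nc ex; have cat : code_at (compile 26 c) 0 (ccmd 26 0 c) by [].
have ag : agree 26 (regs (init_state (sorted_array S) x)) (regs (init_state (sorted_array S) x)) by [].
have [t' le h] := run_ccmd ex nc (fun _ => to_word w 0) cat ag.
by exists t' => //; have := h 0; rewrite addn0.
Qed.

(** * Probabilities and real logarithms *)

Section Final.

Variable R : realType.
Import Order.TTheory GRing.Theory Num.Theory.
Local Open Scope ring_scope.

Lemma log2_ge1 (z : R) : 1 <= log2 z.
Proof.
rewrite /log2; case: ltP => // z2; rewrite ler_pdivlMr ?ln_gt0 ?ltr1n // mul1r.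
by rewrite ler_ln // posrE // (lt_le_trans _ z2).
Qed.

Lemma log2_ge_nat (z : R) (j : nat) : 2 ^+ j <= z -> j%:R <= log2 z.
Proof.
case: j => [|j] h; first exact: le_trans (log2_ge1 z).
have z2 : 2 <= z.
  by apply: le_trans h; rewrite exprS ler_peMr // exprn_ege1 // ler1n.
rewrite /log2 ltNge z2 /= ler_pdivlMr ?ln_gt0 ?ltr1n // mulr_natl.
by rewrite -lnXn // ler_ln ?posrE ?exprn_gt0 // (lt_le_trans _ z2).
Qed.

Lemma log2_le_nat (w D a : nat) : (2 ^ D <= w ^ a)%N -> (1 < w)%N -> D%:R <= a%:R * log2 (w%:R : R).
Proof.
move=> h w1; have w2 : (2 : R) <= w%:R by rewrite ler_nat.
have wpos : (0 : R) < w%:R by rewrite ltr0n ltnW.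
rewrite /log2 ltNge w2 /= mulrA ler_pdivlMr ?ln_gt0 ?ltr1n // !mulr_natl -!lnXn //.
by rewrite ler_ln ?posrE ?exprn_gt0 // -!natrX ler_nat.
Qed.

Lemma hash_prob_ge w (k : nat) (E : hash_family w -> Prop) (G : pred (hash_family w)) :
  (forall H, G H -> E H) -> (2 ^ k * cnt (fun H => ~~ G H) <= #|hash_family w|)%N ->
  1 - 2 ^- k <= hash_prob R E.
Proof.
move=> GE le; rewrite /hash_prob; set A := [set H | _].
have F0 : (0 < #|hash_family w|)%N.
  by apply/card_gt0P; exists [ffun _ => to_word w 0].
have leA : (#|hash_family w| <= #|A| + cnt (fun H => ~~ G H))%N.
  rewrite cnt_card -cardsT; apply: leq_trans (leq_card_setU _ _).
  apply/subset_leq_card/subsetP => H _; rewrite !inE.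
  by case: (boolP (G H)) => [/GE/asboolP-> //|_]; rewrite orbT.
rewrite ler_pdivlMr ?ltr0n // mulrBl mul1r lerBlDr.
apply: (@le_trans _ _ (#|A|%:R + (cnt (fun H => ~~ G H))%:R)); first by rewrite -natrD ler_nat.
by rewrite lerD2l ler_pdivlMl ?exprn_gt0 // -natrX -natrM ler_nat.
Qed.

Definition time_const := (main_cost + cmax setup + 2 * body_cost + 2 * inner_cost)%N.

Lemma time_le w (S : {set word w}) x t : dist_bound S x t ->
  t%:R <= time_const%:R * log2 (log2 (dist_min S x)%:R) :> R.
Proof.
case=> [h|[k d_gt h]].
  apply: (@le_trans _ _ time_const%:R); last by rewrite ler_peMr // log2_ge1.
  rewrite ler_nat; apply: leq_trans h _; rewrite /time_const; clear; lia.
have d2 : 2 ^+ (2 ^ 2 ^ k) <= (dist_min S x)%:R :> R by rewrite -natrX ler_nat ltnW.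
have l1 := log2_ge_nat d2; rewrite natrX in l1; have l2 := log2_ge_nat l1.
apply: (@le_trans _ _ (time_const%:R * (2 ^ k)%:R)); last by rewrite ler_wpM2l.
rewrite -natrM ler_nat; apply: leq_trans h _; rewrite /time_const expnS.
(* Since [k < 2 ^ k], the [k.+2] passes of the outer loop are at most [2 * 2 ^ k], and [2 ^ k] is at
   most log log of the distance. *)
have := ltn_expl k (isT : 1 < 2)%N.
move: (2 ^ k)%N main_cost (cmax setup) body_cost inner_cost => a b c d e; clear; nia.
Qed.

End Final.

Import Order.TTheory GRing.Theory Num.Theory.
Local Open Scope ring_scope.

Theorem theorem4 (R : realType) (c : nat) :
  exists (P : program) (C : R),
    forall (w : nat) (S : {set word w}),
      (0 < w)%N -> S != set0 ->
      1 - (2 ^- (c * w) : R) <=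
        hash_prob R (fun H : hash_family w =>
          exists idx : bitseq, good_index P C S H idx).
Proof.
(* The program depends on [c] through the threshold [m]: above it [c.+2 <= w], below it the table of
   all answers takes at most [2 ^ m * m] bits. The term [4000 * 4] comes from [index_size_le] and
   [2 ^ D <= w ^ 4]. *)
have [m0 params] := params_exist; pose m := maxn m0 c.+2.
pose N := (2 ^ m * m + (time_const + 4000 * 4))%N.
have N1 : (2 ^ m * m <= N)%N by rewrite leq_addr.
have N2 : (time_const <= N)%N by rewrite /N addnCA leq_addr.
have N3 : (4000 * 4 <= N)%N by rewrite /N addnA leq_addl.
exists (compile 26 (main m)), N%:R => w S w0 S0.
have n0 : (0 < #|S|)%N by rewrite card_gt0.
set C : R := N%:R; have C_time : time_const%:R <= C by rewrite ler_nat.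
have log_ge := log2_ge1.
have space j : (j <= 2 ^ m * m)%N -> j%:R <= C * (#|S|%:R * log2 w%:R).
  move=> hj; apply: (@le_trans _ _ C); first by rewrite ler_nat (leq_trans hj).
  rewrite ler_peMr // -[leLHS]mulr1; apply: ler_pM => //; by rewrite ler1n.
have vars : cvars 26 (main m) by [].
have reg0 x : regs (init_state (sorted_array S) x) 0 = x by [].
have reg1 x : regs (init_state (sorted_array S) x) 1 = #|S|.-1 :> nat.
  by rewrite /= size_arr modn_small // word_pred_card.
have reg2 x : regs (init_state (sorted_array S) x) 2 = w :> nat.
  by rewrite /= modn_small // ltn_expl.
have time1 (z : R) (t : nat) : (t <= time_const)%N -> t%:R <= C * log2 z.
  move=> ht; apply: (@le_trans _ _ time_const%:R); first by rewrite ler_nat.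
  by apply: le_trans C_time _; rewrite ler_peMr.
case: (leqP w m) => wm.
  (* The table of all answers works for every hash family. *)
  apply: (@hash_prob_ge _ _ _ _ predT); last by rewrite /cnt big1 ?muln0.
  move=> H _; pose f x := projT1 (cid (pred_index_exists S x)).
  exists (answer_table f); split.
    apply: space; rewrite size_mkseq leq_mul // leq_exp2l //.
  move=> x; have [t le ex] := main_small S H (answer_table f) (reg0 x) wm.
  have [t' le' rq] := run_query_exec vars ex; exists t', (f x).
  rewrite -index_word_table //; split=> //.
    by rewrite index_word_table //; exact: (projT2 (cid (pred_index_exists S x))).
  by apply: time1; apply: leq_trans le' _; apply: leq_trans le _; rewrite /time_const; lia.
have m0w : (m0 <= w)%N by apply: leq_trans (ltnW wm); exact: leq_maxl.
have cw : (c.+2 <= w)%N by apply: leq_trans (ltnW wm); exact: leq_maxr.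
have nw : (#|S| <= 2 ^ w)%N by rewrite -[X in (_ <= X)%N](card_ord (2 ^ w)) max_card.
have [|K [D [T [e1 [e2 [e3 [e4 [[[DE TE wT cap_w cap_i] [cap_T es z0 z1 z2]] Dw sz]]]]]]]] := params w #|S| m0w.
  by rewrite n0.
apply: (@hash_prob_ge _ _ _ _ (seeds_ok S K D T e1 e2 e3 e4)); last first.
  have := cnt_seeds_bad DE TE cap_w cap_T es z0 z1 z2.
  set b := cnt _ => hb; rewrite -(leq_pmul2l (isT : 0 < 2)%N); apply: leq_trans hb.
  rewrite mulnA -expnS leq_mul2r leq_exp2l //; apply/orP; right.
  (* From [c.+2 <= w <= T] follows [c * w + 1 <= T ^ 2]; the extra 1 absorbs the factor 2 of the
     union bound. *)
  by move: cw wT; rewrite -mulnn; clear; nia.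
move=> H ok.
have fl_n : ~~ (T < #|S|)%N -> (#|S| <= T)%N by rewrite -leqNgt.
have [idx szI q] := search_index DE TE wT cap_w cap_i cap_T es n0 fl_n ok.
exists idx; split.
  rewrite szI; apply: (@le_trans _ _ (4000 * (#|S| * D))%N%:R); first by rewrite ler_nat.
  have w1 : (1 < w)%N by apply: leq_trans cw.
  rewrite !natrM; apply: (@le_trans _ _ (4000%:R * (#|S|%:R * (4%:R * log2 w%:R)))).
    by rewrite !ler_wpM2l // log2_le_nat.
  rewrite [#|S|%:R * (4%:R * _)]mulrCA (mulrA 4000%:R) -(natrM _ 4000 4); apply: ler_wpM2r.
    by rewrite mulr_ge0 // (le_trans ler01).
  by rewrite ler_nat.
move=> x; have [t [i [ex isp db]]] := q x _ m wm (reg0 x) (reg1 x) (reg2 x).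
have [t' le' rq] := run_query_exec vars ex; exists t', i; split=> //.
apply: (@le_trans _ _ t%:R); first by rewrite ler_nat.
apply: le_trans (time_le R db) _; rewrite ler_wpM2r // (le_trans ler01) //.
Qed.
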